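(* Let $m>3$ be an integer and let $\eta_0^{+},\eta_0^{-}\in H^m(\mathbb{T})$. Then for every $T>0$ there exists a unique classical solution $(\eta^{+},\eta^{-})$ of the linearized system \[ \partial_t\eta^{+}=\Big\{\tfrac12\eta^{+}+v^{+},\ \sin(2\theta)\Big\},\qquad \partial_t\eta^{-}=\Big\{\tfrac12\eta^{-}-v^{-},\ \sin(2\theta)\Big\},\qquad \partial_\theta v^{\pm}=H\eta^{\pm},\ v^{\pm}(t,0)=0, \] for $t>0$, $\theta\in\mathbb{T}$, with $\eta^{\pm}(0,\cdot)=\eta_0^{\pm}$, satisfying \[ \eta^{\pm}\in C([0,T];H^m(\mathbb{T}))\cap C^2([0,T];H^{m-2}(\mathbb{T})). \]
   Context: $\mathbb{T}=[-\pi,\pi]$ with periodic identification. $H$ is the Hilbert transform on $\mathbb{T}$: $Hf(\theta)=\frac{1}{2\pi}\,\mathrm{p.v.}\int_{-\pi}^{\pi}\cot\big(\frac{\theta-\vartheta}{2}\big)f(\vartheta)\,d\vartheta$. The Lie bracket is $\{f,g\}=f\,\partial_\theta g-g\,\partial_\theta f$. $H^m(\mathbb{T})$ denotes the periodic Sobolev space. *)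

(* Defs.v *)
From HB Require Import structures.
From mathcomp Require Import all_boot all_order all_algebra.
From mathcomp Require Import all_classical all_reals all_analysis.
Set Implicit Arguments. Unset Strict Implicit. Unset Printing Implicit Defensive.
Import Order.TTheory GRing.Theory Num.Theory.
Import numFieldNormedType.Exports.
Local Open Scope classical_set_scope.
Local Open Scope ring_scope.

Section Defs.
Variable R : realType.

Definition periodic2pi (f : R -> R) : Prop :=
  forall x, f (x + 2 * pi) = f x.

Definition fcos (f : R -> R) (k : nat) : R :=
  pi^-1 * \int[lebesgue_measure]_(x in `[(- pi)%R, pi]) (f x * cos (k%:R * x)).
Definition fsin (f : R -> R) (k : nat) : R :=
  pi^-1 * \int[lebesgue_measure]_(x in `[(- pi)%R, pi]) (f x * sin (k%:R * x)).

(* k-th term of sum_{n in Z} (1+n^2)^s |f^(n)|^2, grouping n and -n. *)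
Definition sob_term (s : nat) (f : R -> R) (k : nat) : R :=
  if k == 0%N then (fcos f 0) ^+ 2 / 4
  else (1 + k%:R ^+ 2) ^+ s * ((fcos f k) ^+ 2 + (fsin f k) ^+ 2) / 2.

Definition inH (s : nat) (f : R -> R) : Prop :=
  [/\ periodic2pi f, measurable_fun setT f,
      lebesgue_measure.-integrable `[(- pi)%R, pi] (fun x => ((f x) ^+ 2)%:E)
    & cvgn (series (sob_term s f))].

Definition Hnorm (s : nat) (f : R -> R) : R :=
  Num.sqrt (limn (series (sob_term s f))).

(* Hilbert transform as a principal value: p.v. integral over the period
   window [theta - pi, theta + pi] (periodic identification). *)
Definition is_hilbert (f : R -> R) (theta l : R) : Prop :=
  (fun eps : R => (2 * pi)^-1 *
     \int[lebesgue_measure]_(x in [set x | theta - pi <= x <= theta + pi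
                                            /\ eps < `|theta - x|])
        (cos ((theta - x) / 2) / sin ((theta - x) / 2) * f x))
  @ 0^'+ --> l.

Definition lie_bracket (f g : R -> R) (theta : R) : R :=
  f theta * derive1 g theta - g theta * derive1 f theta.

Definition cont_H (s : nat) (T : R) (eta : R -> R -> R) : Prop :=
  (forall t, 0 <= t <= T -> inH s (eta t)) /\
  forall t, 0 <= t <= T -> forall e : R, 0 < e -> exists2 d : R, 0 < d &
    forall u, 0 <= u <= T -> `|u - t| < d ->
      Hnorm s (fun th => eta u th - eta t th) < e.

Definition deriv_H (s : nat) (T : R) (eta eta1 : R -> R -> R) : Prop :=
  (forall t, 0 <= t <= T -> inH s (eta t) /\ inH s (eta1 t)) /\
  forall t, 0 <= t <= T -> forall e : R, 0 < e -> exists2 d : R, 0 < d &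
    forall u, 0 <= u <= T -> 0 < `|u - t| < d ->
      Hnorm s (fun th => (eta u th - eta t th) / (u - t) - eta1 t th) < e.

Definition C2_H (s : nat) (T : R) (eta : R -> R -> R) : Prop :=
  exists eta1 eta2 : R -> R -> R,
    [/\ deriv_H s T eta eta1, deriv_H s T eta1 eta2 & cont_H s T eta2].

Definition lin_solution (m : nat) (T : R) (e0p e0m : R -> R)
  (etap etam : R -> R -> R) : Prop :=
  [/\ cont_H m T etap /\ cont_H m T etam,
      C2_H (m - 2) T etap /\ C2_H (m - 2) T etam,
      (forall th, etap 0 th = e0p th /\ etam 0 th = e0m th) &
      exists vp vm : R -> R -> R,
        forall t, 0 < t <= T ->
          [/\ forall th,
                [/\ derivable (etap t) th 1 /\ derivable (etam t) th 1,
                    derivable (vp t) th 1 /\ derivable (vm t) th 1,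
                    is_hilbert (etap t) th (derive1 (vp t) th)
                  & is_hilbert (etam t) th (derive1 (vm t) th)],
              vp t 0 = 0, vm t 0 = 0 &
              t < T -> forall th,
                [/\ derivable (fun u => etap u th) t 1,
                    derivable (fun u => etam u th) t 1,
                    derive1 (fun u => etap u th) t =
                      lie_bracket (fun x => etap t x / 2 + vp t x)
                                  (fun x => sin (2 * x)) th
                  & derive1 (fun u => etam u th) t =
                      lie_bracket (fun x => etam t x / 2 - vm t x)
                                  (fun x => sin (2 * x)) th]]].
End Defs.

(* Main.v *)
(* In Fourier variables eta = sum a_k cos kx + b_k sin kx the two equations decouple, and
   each splits further into its cosine and its sine modes: v has coefficients -a_k / k
   and -b_k / k, up to the constant mode sum a_j / j forced by v(t, 0) = 0, and
   f |-> {f, sin 2x} moves mode k to k + 2 and k - 2 with weights 1 - k/2 and 1 + k/2.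
   Each coefficient sequence thus solves x' = A x, where A is tridiagonal with step 2,
   has entries of size O(k), and is perturbed by a finite rank term.

   The entries of order k are antisymmetric, so they cancel in the energy
   sum (1 + k^2)^s x_k^2 up to terms controlled by the energy itself: every h^s norm
   grows at most exponentially, with no loss of derivatives. Truncating A to N modes
   gives linear systems with entire solutions, and the energy estimate makes these
   Galerkin approximations Cauchy in h^m, locally uniformly in time. Their limit x is
   continuous into h^m, and x' = A x, x'' = A (A x) hold in h^(m-1) and h^(m-2).

   For uniqueness, a continuous periodic function with coefficients in h^2 is the sum of
   its Fourier series, so the coefficients of any solution satisfy the same system. The
   energy of the first M modes of the difference of two solutions is driven only by the
   neglected modes, hence vanishes as M tends to infinity. *)

(* The obstacle is that the generator has order one and is unbounded on every h^s, so neither a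
   matrix exponential nor a fixed point iteration closes there. The cancellation behind the energy
   estimate is explicit: with c = 1 or c = -1, (1 - k/2)(1/2 - c/k) + (1 + (k+2)/2)(1/2 - c/(k+2)) =
   3/2 - c/k - c/(k+2) is bounded although each product grows like k/4. The weights (1 + k^2)^s
   break this antisymmetry, but their increments are smaller than the weights by a factor of order
   1/k, which absorbs the remaining linear growth.

   Truncation respects the cancellation, since a sequence supported below M produces no boundary
   term. Comparing two truncation levels does cost derivatives, so the Cauchy property is shown for
   finitely supported data and extended by density: the flows of all levels depend on the datum with
   one common constant.

   The condition m > 3 leaves m - 2 >= 2, so that even the second time derivative has coefficients
   in h^2, where the Fourier series converges uniformly and its coefficients can be read off
   again. *)
Require Import Defs.
From HB Require Import structures.
From mathcomp Require Import all_boot all_order all_algebra.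
From mathcomp Require Import all_classical all_reals all_analysis.
From mathcomp Require Import measurable_realfun.
From mathcomp Require Import ring lra.
Set Implicit Arguments. Unset Strict Implicit. Unset Printing Implicit Defensive.
Import Order.TTheory GRing.Theory Num.Theory.
Import numFieldNormedType.Exports.
Local Open Scope classical_set_scope.
Local Open Scope ring_scope.

(** * Differentiation rules and Gronwall's inequality *)

Section Derivatives.
Variable R : realType.
Implicit Types (f g : R -> R) (x a b : R).

Lemma is_derive1D f g x a b : is_derive x 1 f a -> is_derive x 1 g b ->
  is_derive x 1 (fun t => f t + g t) (a + b).
Proof. by move=> df dg; exact: is_deriveD. Qed.

Lemma is_derive1M f g x a b : is_derive x 1 f a -> is_derive x 1 g b ->
  is_derive x 1 (fun t => f t * g t) (a * g x + f x * b).
Proof.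
move=> df dg; apply: (@is_derive_eq _ _ _ (f * g)).
by rewrite /GRing.scale /= addrC mulrC.
Qed.

Lemma is_derive1C c x : is_derive x 1 (fun _ : R => c) (0 : R).
Proof. exact: is_derive_cst. Qed.

Lemma is_derive1Z c f x a : is_derive x 1 f a ->
  is_derive x 1 (fun t => c * f t) (c * a).
Proof.
move=> df; have /= H := is_derive1M (is_derive1C c x) df.
by apply: (is_derive_eq H); rewrite mul0r add0r.
Qed.

Lemma is_derive1B f g x a b : is_derive x 1 f a -> is_derive x 1 g b ->
  is_derive x 1 (fun t => f t - g t) (a - b).
Proof. by move=> df dg; exact: is_deriveB. Qed.

Lemma is_derive1_sum (F : nat -> R -> R) (dF : nat -> R) K x :
  (forall k, (k < K)%N -> is_derive x 1 (F k) (dF k)) ->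
  is_derive x 1 (fun t => \sum_(0 <= k < K) F k t) (\sum_(0 <= k < K) dF k).
Proof.
elim: K => [_|K IH H].
  under [X in is_derive _ _ X _]eq_fun do rewrite big_nil.
  by rewrite big_nil; exact: is_derive1C.
under [X in is_derive _ _ X _]eq_fun do rewrite big_nat_recr//=.
rewrite big_nat_recr//=; apply: is_derive1D; last exact: H.
by apply: IH => k kK; apply: H; rewrite ltnS ltnW.
Qed.

Lemma is_derive1_continuous f x a : is_derive x 1 f a -> {for x, continuous f}.
Proof.
by move=> df; apply/differentiable_continuous/derivable1_diffP; exact: ex_derive.
Qed.

Lemma is_derive1_pcomp f g x a b : is_derive (g x) 1 f a ->
  is_derive x 1 g b -> is_derive x 1 (fun t => f (g t)) (a * b).
Proof. exact: is_derive1_comp. Qed.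

Lemma is_derive1_expRZ c x :
  is_derive x 1 (fun t => expR (c * t)) (c * expR (c * x)).
Proof.
have H := is_derive1_pcomp (is_derive_expR _) (is_derive1Z c (is_derive_id x 1)).
by apply: (is_derive_eq H); rewrite mulr1 mulrC.
Qed.

(** The integrating factor makes [E t * expR (- C * t) - D * t] nonincreasing. Differentiability is
    asked only inside the interval because a solution of the system satisfies its equation only for
    0 < t < T. *)
Lemma gronwall (E dE : R -> R) (C D b : R) : 0 <= b -> 0 <= C -> 0 <= D ->
  (forall t, 0 < t < b -> is_derive t 1 E (dE t)) ->
  {within `[0, b], continuous E} ->
  (forall t, 0 < t < b -> dE t <= C * E t + D) ->
  E b <= expR (C * b) * (E 0 + D * b).
Proof.
move=> b0 C0 D0 dEE cE le.
pose F t := E t * expR (- C * t) - D * t.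
have dF t : 0 < t < b -> is_derive t 1 F
    ((dE t * expR (- C * t) + E t * (- C * expR (- C * t))) - D * 1).
  move=> tb; apply: is_derive1B.
  by apply: is_derive1M; [exact: dEE|exact: is_derive1_expRZ].
have : F b <= F 0.
  apply: (@ler0_derive1_le_cc _ F 0 b) => //; last 2 first.
  - by rewrite in_itv/= lexx b0.
  - by rewrite in_itv/= lexx b0.
  - by move=> t; rewrite in_itv/= => /dF ?; exact: ex_derive.
  - move=> t; rewrite in_itv/= => tb; rewrite derive1E.
    have -> := @derive_val _ _ _ _ _ _ _ (dF _ tb).
    have := le _ tb; have : 0 < expR (- C * t) <= 1.
      rewrite expR_gt0/= -expR0 ler_expR mulNr oppr_le0 mulr_ge0//.
      by case/andP: tb => /ltW.
    by nra.
  - have c1 : {within `[0, b], continuous (fun t => expR (- C * t))}.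
      apply: continuous_subspaceT => y.
      exact: is_derive1_continuous (is_derive1_expRZ _ _).
    have c2 : {within `[0, b], continuous (fun t : R => D * t)}.
      apply: continuous_subspaceT => y.
      exact: is_derive1_continuous (is_derive1Z _ (is_derive_id _ _)).
    by move=> x; exact: (continuousB (continuousM (cE x) (c1 x)) (c2 x)).
rewrite /F mulr0 expR0 mulr1 mulr0 subr0 lerBlDr mulNr expRN => h.
by rewrite -ler_pdivrMl ?expR_gt0// mulrC.
Qed.

(** Bounding [|dE|] allows time reversal, so negative times follow from [gronwall] for [E (- s)].
    The two-sided form suits the Galerkin flows, which exist for all real times and for which t = 0
    is then an interior point. *)
Lemma gronwall2 (E dE : R -> R) (C D T : R) : 0 <= C -> 0 <= D ->
  (forall t : R, is_derive t 1 E (dE t)) ->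
  (forall t, `|t| <= T -> `|dE t| <= C * E t + D) ->
  forall t, `|t| <= T -> E t <= expR (C * `|t|) * (E 0 + D * `|t|).
Proof.
move=> C0 D0 dEE le t tT.
have dEN (s : R) : is_derive s 1 (fun s => E (- s)) (- dE (- s)).
  have H := is_derive1_pcomp (dEE (- s)) (is_deriveN (is_derive_id s 1)).
  by apply: (is_derive_eq H); rewrite mulrN1.
have [t0|t0] := leP 0 t.
  rewrite ger0_norm//; apply: (@gronwall E dE) => //.
  - apply: continuous_subspaceT => x; exact: is_derive1_continuous (dEE _).
  - move=> s /andP[s0 st]; apply: le_trans (ler_norm _) (le _ _).
    rewrite gtr0_norm// (le_trans (ltW st))// (le_trans _ tT)//.
    exact: ler_norm.
rewrite ltr0_norm// -{1}(opprK t).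
rewrite -[in E 0]oppr0.
apply: (@gronwall (fun s => E (- s)) (fun s => - dE (- s))) => //.
- by rewrite oppr_ge0 ltW.
- apply: continuous_subspaceT => x; exact: is_derive1_continuous (dEN _).
- move=> s /andP[s0 st]; apply: le_trans (ler_norm _) _; rewrite normrN.
  apply: le; rewrite normrN gtr0_norm// (le_trans (ltW st))//.
  by rewrite (le_trans _ tT)// -normrN ler_norm.
Qed.

End Derivatives.

(** * Weighted sequence spaces *)

Section WeightedSequences.
Variable R : realType.
Implicit Types (x y : nat -> R) (B : R).

Lemma sum_cauchy_schwarz m n (u v : nat -> R) :
  (\sum_(m <= k < n) u k * v k) ^+ 2 <=
  (\sum_(m <= k < n) u k ^+ 2) * (\sum_(m <= k < n) v k ^+ 2).
Proof.
set U := \sum_(_ <= _ < _) u _ ^+ 2; set V := \sum_(_ <= _ < _) v _ ^+ 2.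
set S := \sum_(_ <= _ < _) _ * _.
have key a b : 0 <= a ^+ 2 * U + 2 * (a * b) * S + b ^+ 2 * V.
  have -> : a ^+ 2 * U + 2 * (a * b) * S + b ^+ 2 * V =
      \sum_(m <= k < n) (a * u k + b * v k) ^+ 2.
    rewrite !mulr_sumr -!big_split/=; apply: eq_bigr => k _.
    by ring.
  by apply: sumr_ge0 => k _; exact: sqr_ge0.
have V0 : 0 <= V by apply: sumr_ge0 => k _; exact: sqr_ge0.
have [V00|Vn] := eqVneq V 0.
  have [->|S0] := eqVneq S 0; first by rewrite V00 mulr0 expr0n.
  (* With V = 0 the form is affine in b, and this b gives it the value -1. *)
  have := key 1 (- (U + 1) / (2 * S)).
  have -> : 2 * (1 * (- (U + 1) / (2 * S))) * S = - (U + 1) by field.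
  by rewrite V00; lra.
have Vp : 0 < V by rewrite lt_def Vn.
(* For a = V the form is minimal at b = -S. *)
have := key V (- S).
have -> : V ^+ 2 * U + 2 * (V * - S) * S + (- S) ^+ 2 * V = V * (U * V - S ^+ 2).
  by ring.
by rewrite pmulr_rge0// subr_ge0.
Qed.

Lemma sum_nat_ge0 m n (u : nat -> R) : (forall k, 0 <= u k) ->
  0 <= \sum_(m <= k < n) u k.
Proof. by move=> u0; apply: sumr_ge0. Qed.

Lemma sum_nat_le m n n' (u : nat -> R) : (forall k, 0 <= u k) -> (n <= n')%N ->
  \sum_(m <= k < n) u k <= \sum_(m <= k < n') u k.
Proof.
move=> u0 nn'; have [mn|nm] := leqP m n.
  by rewrite (@big_cat_nat _ _ _ n m n')//= lerDl; apply: sumr_ge0.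
by rewrite big_geq ?(ltnW nm)//; apply: sumr_ge0.
Qed.

Lemma sum_shift2 K (u : nat -> R) :
  \sum_(0 <= k < K.+2) u k = u 0%N + u 1%N + \sum_(0 <= k < K) u k.+2.
Proof. by rewrite 2?big_nat_recl//= addrA. Qed.

Lemma cvg_sum_nat K (u : nat -> nat -> R) (l : nat -> R) :
  (forall k, (u ^~ k) N @[N --> \oo] --> l k) ->
  \sum_(0 <= k < K) u N k @[N --> \oo] --> \sum_(0 <= k < K) l k.
Proof.
move=> h; elim: K => [|K IH].
  under eq_cvg do rewrite big_nil.
  by rewrite big_nil; exact: cvg_cst.
under eq_cvg do rewrite big_nat_recr//=.
by rewrite big_nat_recr//=; apply: cvgD.
Qed.

Definition wt (k : nat) : R := 1 + k%:R ^+ 2.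

Lemma wt_ge1 k : 1 <= wt k.
Proof. by rewrite lerDl sqr_ge0. Qed.

Lemma wt_gt0 k : 0 < wt k.
Proof. exact: lt_le_trans ltr01 (wt_ge1 k). Qed.

Lemma wt_ge0 k : 0 <= wt k. Proof. by rewrite ltW ?wt_gt0. Qed.
Hint Resolve wt_gt0 wt_ge0 wt_ge1 : core.

Lemma wtX_gt0 s k : 0 < wt k ^+ s. Proof. exact: exprn_gt0. Qed.
Lemma wtX_ge0 s k : 0 <= wt k ^+ s. Proof. by rewrite ltW// wtX_gt0. Qed.
Hint Resolve wtX_gt0 wtX_ge0 : core.

Lemma wt_homo j k : (j <= k)%N -> wt j <= wt k.
Proof. by move=> jk; rewrite lerD2l lerXn2r ?nnegrE// ler_nat. Qed.

Lemma wtX_homo s j k : (j <= k)%N -> wt j ^+ s <= wt k ^+ s.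
Proof. by move=> jk; rewrite lerXn2r ?nnegrE// wt_homo. Qed.

Lemma natSS k : k.+2%:R = k%:R + 2 :> R.
Proof. by rewrite -addn2 natrD. Qed.

Lemma wt_shift k : wt k.+2 <= 5 * wt k.
Proof.
rewrite /wt natSS; case: k => [|[|k]]; [lra|lra|].
by rewrite natSS; have := ler0n R k; nra.
Qed.

Lemma wtX_shift s k : wt k.+2 ^+ s <= 5 ^+ s * wt k ^+ s.
Proof. by rewrite -exprMn lerXn2r ?nnegrE ?mulr_ge0// wt_shift. Qed.

Lemma sqr_succ_le_wt k : (k%:R + 1) ^+ 2 <= 2 * wt k.
Proof. by rewrite /wt; have := sqr_ge0 (k%:R - 1 : R); nra. Qed.

(** For n > 0 the terms are at most 2 / (n (n + 1)), which telescopes; the stronger bound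
    [3 - 2 / n.+1%:R] carries the induction. *)
Lemma sum_inv_wt K : \sum_(0 <= k < K) (wt k)^-1 <= 3.
Proof.
suff H n : \sum_(0 <= k < n.+1) (wt k)^-1 <= 3 - 2 / n.+1%:R.
  case: K => [|K]; first by rewrite big_geq.
  by apply: le_trans (H K) _; rewrite gerBl divr_ge0.
elim: n => [|n IH].
  by rewrite big_nat1 /wt expr0n /= !addr0 !invr1 mulr1; lra.
rewrite big_nat_recr//=; apply: le_trans (lerD IH (lexx _)) _.
rewrite -lerBrDl.
have n0 : 0 <= n%:R :> R by [].
have -> : 3 - 2 / n.+2%:R - (3 - 2 / n.+1%:R) = 2 / (n.+1%:R * n.+2%:R) :> R.
  by rewrite natSS -addn1 natrD; field; apply/andP; split; lra.
rewrite ler_pdivlMr ?mulr_gt0// mulrC ler_pdivrMr// /wt natSS -addn1 natrD.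
by nra.
Qed.

(** This bounds the squared h^s norm. Uniform bounds on partial sums replace the sum of the series,
    so that norm estimates carry no convergence proofs and pass to pointwise limits. *)
Definition hb (s : nat) x B := forall K, \sum_(0 <= k < K) wt k ^+ s * x k ^+ 2 <= B.

Lemma hb_ge0 s x B : hb s x B -> 0 <= B.
Proof. by move/(_ 0%N); rewrite big_geq. Qed.

Lemma hb_term_ge0 s x k : 0 <= wt k ^+ s * x k ^+ 2.
Proof. by rewrite mulr_ge0 ?sqr_ge0. Qed.
Hint Resolve hb_term_ge0 : core.

Lemma hb_term s x B k : hb s x B -> wt k ^+ s * x k ^+ 2 <= B.
Proof.
move=> /(_ k.+1); apply: le_trans; rewrite big_nat_recr//= lerDr.
exact: sumr_ge0.
Qed.

Lemma hb_le s x B B' : B <= B' -> hb s x B -> hb s x B'.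
Proof. by move=> BB' h K; exact: le_trans (h K) BB'. Qed.

Lemma hb_dom s s' x y B c : 0 <= c ->
  (forall k, wt k ^+ s * y k ^+ 2 <= c * (wt k ^+ s' * x k ^+ 2)) ->
  hb s' x B -> hb s y (c * B).
Proof.
move=> c0 h hx K; apply: (@le_trans _ _ (c * \sum_(0 <= k < K) wt k ^+ s' * x k ^+ 2)).
  by rewrite mulr_sumr; apply: ler_sum.
by rewrite ler_wpM2l.
Qed.

Lemma hb_lower s s' x B : (s <= s')%N -> hb s' x B -> hb s x B.
Proof.
move=> ss' h; rewrite -[B]mul1r; apply: hb_dom h => // k.
by rewrite mul1r ler_wpM2r ?sqr_ge0// ler_weXn2l.
Qed.

Lemma hbD s x y B B' : hb s x B -> hb s y B' ->
  hb s (fun k => x k + y k) (2 * B + 2 * B').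
Proof.
move=> hx hy K; apply: (@le_trans _ _ (2 * (\sum_(0 <= k < K) wt k ^+ s * x k ^+ 2)
   + 2 * (\sum_(0 <= k < K) wt k ^+ s * y k ^+ 2))); last first.
  by rewrite lerD// ler_wpM2l.
rewrite !mulr_sumr -big_split/=; apply: ler_sum => k _.
rewrite !(mulrCA 2) -mulrDr ler_wpM2l//.
by have := sqr_ge0 (x k - y k); nra.
Qed.

Lemma hbZ s x B c : hb s x B -> hb s (fun k => c * x k) (c ^+ 2 * B).
Proof.
apply: hb_dom => [|k]; first exact: sqr_ge0.
by rewrite exprMn mulrCA.
Qed.

Lemma hbN s x B : hb s x B -> hb s (fun k => - x k) B.
Proof. by move=> h K; under eq_bigr do rewrite sqrrN; exact: h. Qed.

Lemma hbB s x y B B' : hb s x B -> hb s y B' ->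
  hb s (fun k => x k - y k) (2 * B + 2 * B').
Proof. by move=> hx hy; apply: hbD => //; exact: hbN. Qed.

Lemma hb_ext s x y B : x =1 y -> hb s x B -> hb s y B.
Proof. by move=> /funext ->. Qed.

Lemma hb_shift s x B : hb s x B -> hb s (fun k => x k.+2) B.
Proof.
move=> h K; apply: le_trans (h K.+2); rewrite sum_shift2 ler_wpDl ?addr_ge0//.
by apply: ler_sum => k _; rewrite ler_wpM2r ?sqr_ge0// wtX_homo// -addn2 leq_addr.
Qed.

Lemma hb_unshift s x y B : (forall k, y k.+2 = x k) -> y 0%N = 0 -> y 1%N = 0 ->
  hb s x B -> hb s y (5 ^+ s * B).
Proof.
move=> yx y0 y1 h [|[|K]].
- by rewrite big_geq// mulr_ge0 ?exprn_ge0// (hb_ge0 h).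
- by rewrite big_nat1 y0 expr0n mulr0 mulr_ge0 ?exprn_ge0// (hb_ge0 h).
rewrite sum_shift2 y0 y1 expr0n/= !mulr0 !add0r.
apply: le_trans (ler_wpM2l _ (h K)); last by rewrite exprn_ge0.
rewrite mulr_sumr; apply: ler_sum => k _.
by rewrite yx [leRHS]mulrA; apply: ler_wpM2r; rewrite ?sqr_ge0 ?wtX_shift.
Qed.

Lemma hb_lim s (X : nat -> nat -> R) x B :
  (forall k, X ^~ k @ \oo --> x k) -> (\forall N \near \oo, hb s (X N) B) ->
  hb s x B.
Proof.
move=> Xx hX K.
apply: (@cvgr_to_le _ \oo _ _ (fun N => \sum_(0 <= k < K) wt k ^+ s * X N k ^+ 2)).
  apply: cvg_sum_nat => k.
  by apply: cvgM; [exact: cvg_cst|apply: cvgM; exact: Xx].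
by apply: filterS hX => N; exact.
Qed.

(** Spare derivatives turn into decay of the tail: from M on, each term of the stronger norm carries
    an extra factor of at least [wt M ^+ j]. *)
Lemma hb_sum_ge s j M x B K : hb (s + j) x B ->
  \sum_(M <= k < K) wt k ^+ s * x k ^+ 2 <= (wt M ^+ j)^-1 * B.
Proof.
move=> h; have [MK|KM] := leqP M K; last first.
  by rewrite big_geq ?(ltnW KM)// mulr_ge0 ?invr_ge0// (hb_ge0 h).
rewrite ler_pdivlMl ?exprn_gt0//; apply: le_trans (h K).
rewrite (@big_cat_nat _ _ _ M 0 K)//= ler_wpDl ?sumr_ge0//.
rewrite mulr_sumr; apply: ler_sum_nat => k /andP[Mk _].
by rewrite exprD mulrA ler_wpM2r ?sqr_ge0// mulrC ler_wpM2l// wtX_homo.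
Qed.

(** Cauchy-Schwarz against the square roots of [(wt k)^-1] embeds h^1 into l^1; the 3 is that of
    [sum_inv_wt]. *)
Lemma hb_sum_norm x B m n : hb 1 x B ->
  (\sum_(m <= k < n) `|x k|) ^+ 2 <= 3 * B.
Proof.
move=> h.
have -> : \sum_(m <= k < n) `|x k| =
   \sum_(m <= k < n) Num.sqrt (wt k)^-1 * (Num.sqrt (wt k) * `|x k|).
  apply: eq_bigr => k _; rewrite mulrA -sqrtrM ?invr_ge0 //.
  by rewrite mulVf ?sqrtr1 ?mul1r// gt_eqF.
apply: le_trans (sum_cauchy_schwarz _ _ _ _) _.
have H (u : nat -> R) : (forall k, 0 <= u k) ->
  \sum_(m <= k < n) u k <= \sum_(0 <= k < n) u k.
  move=> u0; have [mn|nm] := leqP m n; last by rewrite big_geq ?(ltnW nm)// sum_nat_ge0.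
  by rewrite [leRHS](@big_cat_nat _ _ _ m 0 n)//= lerDr sum_nat_ge0.
apply: ler_pM; [by apply: sum_nat_ge0 => k; rewrite sqr_ge0| |  |].
- by apply: sum_nat_ge0 => k; rewrite sqr_ge0.
- under eq_bigr do rewrite sqr_sqrtr ?invr_ge0 //.
  by apply: le_trans (H _ _) (sum_inv_wt _) => k; rewrite invr_ge0 ltW.
- apply: le_trans (h n); apply: le_trans (H _ _) _ => [k|]; first exact: sqr_ge0.
  apply: ler_sum => k _; rewrite exprMn sqr_sqrtr// real_normK ?num_real//.

Qed.

End WeightedSequences.
Arguments wt {R} k.
#[global] Hint Extern 0 (is_true (0 <= wt _)) => exact: wt_ge0 : core.
#[global] Hint Extern 0 (is_true (0 < wt _)) => exact: wt_gt0 : core.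
#[global] Hint Extern 0 (is_true (0 <= wt _ ^+ _)) => exact: wtX_ge0 : core.
#[global] Hint Extern 0 (is_true (0 < wt _ ^+ _)) => exact: wtX_gt0 : core.

(** * Absolutely convergent series and the constant mode of the velocity *)

Section AbsolutelyConvergentSeries.
Variable R : realType.
Implicit Types (u v x y : nat -> R) (B : R).

Lemma sum_norm_is_cvg u B : (forall K, \sum_(0 <= k < K) `|u k| <= B) ->
  cvgn (series u).
Proof.
move=> h; apply: normed_cvg; apply: nondecreasing_is_cvgn.
  by apply: nondecreasing_series => k _ _ /=.
by exists B => _ [K _ <-]; exact: h.
Qed.

Lemma sum_norm_lim_le u B : (forall K, \sum_(0 <= k < K) `|u k| <= B) ->
  `|limn (series u)| <= B.
Proof.
move=> h; have cu := sum_norm_is_cvg h.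
have cn : `|series u K| @[K --> \oo] --> `|limn (series u)| by exact: cvg_norm.
apply: (cvgr_to_le cn); apply: nearW => K.
by apply: le_trans (h K); exact: ler_norm_sum.
Qed.

Lemma sum_norm_sqr_le u B : (forall K, (\sum_(0 <= k < K) `|u k|) ^+ 2 <= B) ->
  forall K, \sum_(0 <= k < K) `|u k| <= Num.sqrt B.
Proof.
move=> h K; have s0 : 0 <= \sum_(0 <= k < K) `|u k| by exact: sumr_ge0.
by rewrite -(ger0_norm s0) -sqrtr_sqr ler_wsqrtr.
Qed.

Lemma series_limD u v : cvgn (series u) -> cvgn (series v) ->
  limn (series (fun k => u k + v k)) = limn (series u) + limn (series v).
Proof. by move=> cu cv; rewrite -[LHS]/(limn (series (u + v))) lim_seriesD. Qed.

Lemma series_limZ u c : cvgn (series u) ->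
  limn (series (fun k => c * u k)) = c * limn (series u).
Proof. by move=> cu; rewrite -[LHS]/(limn (series (c *: u))) lim_seriesZ. Qed.

Lemma series_limB u v : cvgn (series u) -> cvgn (series v) ->
  limn (series (fun k => u k - v k)) = limn (series u) - limn (series v).
Proof. by move=> cu cv; rewrite -[LHS]/(limn (series (u - v))) lim_seriesB. Qed.

Lemma sum_nat_eq0 m n u : (forall k, (m <= k)%N -> u k = 0) ->
  \sum_(m <= k < n) u k = 0.
Proof. by move=> u0; rewrite big_nat_cond big1// => k /andP[/andP[/u0]]. Qed.

Lemma series_eventually0 u M : (forall k, (M <= k)%N -> u k = 0) ->
  series u @ \oo --> \sum_(0 <= k < M) u k.
Proof.
move=> u0; apply: cvg_near_cst; exists M => // K /= MK.
rewrite /series/= (@big_cat_nat _ _ _ M 0 K)//= (@sum_nat_eq0 M K u u0) ?addr0//.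
Qed.

Lemma series_eventually0_lim u M : (forall k, (M <= k)%N -> u k = 0) ->
  limn (series u) = \sum_(0 <= k < M) u k.
Proof. by move=> u0; apply: cvg_lim => //; exact: series_eventually0. Qed.

(* The constant mode that [v 0 = 0] forces on the primitive v of the Hilbert transform
   of [sum_j x j cos (j th)]; the term j = 0 drops out since [0^-1 = 0]. *)
Definition prim0 x : R := limn (series (fun j => j%:R^-1 * x j)).

Lemma prim0_sum_norm x B m n : hb 0 x B ->
  (\sum_(m <= j < n) `|j%:R^-1 * x j|) ^+ 2 <= 6 * B.
Proof.
move=> h; have -> : \sum_(m <= j < n) `|j%:R^-1 * x j| =
  \sum_(m <= j < n) `|j%:R^-1| * `|x j| by apply: eq_bigr => j _; rewrite normrM.
apply: le_trans (sum_cauchy_schwarz _ _ _ _) _.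
have H u : (forall k, 0 <= u k) ->
  \sum_(m <= k < n) u k <= \sum_(0 <= k < n) u k.
  move=> u0; have [mn|nm] := leqP m n; last by rewrite big_geq ?(ltnW nm)// sum_nat_ge0.
  by rewrite [leRHS](@big_cat_nat _ _ _ m 0 n)//= lerDr sum_nat_ge0.
apply: ler_pM; [by apply: sum_nat_ge0 => k; rewrite sqr_ge0| |  |].
- by apply: sum_nat_ge0 => k; rewrite sqr_ge0.
- apply: le_trans (H _ _) _ => [k|]; first exact: sqr_ge0.
  (* For j > 0 the inverse square of j is at most 2 / [wt j], hence twice the bound of
     [sum_inv_wt]. *)
  apply: (@le_trans _ _ (2 * 3)); last by lra.
  apply: le_trans (ler_wpM2l _ (sum_inv_wt R n)) => //.
  rewrite mulr_sumr; apply: ler_sum => -[|k] _.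
    by rewrite invr0 normr0 expr0n/= divr_ge0 ?wt_ge0.
  rewrite real_normK ?num_real// exprVn.
  rewrite ler_pdivlMr// mulrC ler_pdivrMr ?exprn_gt0// /wt.
  have : 1 <= k.+1%:R :> R by rewrite ler1n.
  by nra.
- apply: le_trans (h n); apply: le_trans (H _ _) _ => [k|]; first exact: sqr_ge0.
  by apply: ler_sum => k _; rewrite real_normK ?num_real// expr0 mul1r.
Qed.

Lemma prim0_cvg x B : hb 0 x B -> cvgn (series (fun j => j%:R^-1 * x j)).
Proof.
move=> h; apply: sum_norm_is_cvg (sum_norm_sqr_le _) => K.
exact: prim0_sum_norm h.
Qed.

Lemma prim0_sqr_le x B : hb 0 x B -> prim0 x ^+ 2 <= 6 * B.
Proof.
move=> h.
have := sum_norm_lim_le (sum_norm_sqr_le (fun K => prim0_sum_norm 0 K h)).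
rewrite -/(prim0 x) => {}h'; rewrite -real_normK ?num_real//.
have B0 : 0 <= 6 * B by rewrite mulr_ge0// (hb_ge0 h).
by rewrite -(sqr_sqrtr B0) lerXn2r// nnegrE sqrtr_ge0.
Qed.

Lemma prim0B x y B B' : hb 0 x B -> hb 0 y B' ->
  prim0 (fun k => x k - y k) = prim0 x - prim0 y.
Proof.
move=> hx hy; rewrite /prim0.
under eq_fun do rewrite mulrBr.
by rewrite series_limB//; [exact: prim0_cvg hx|exact: prim0_cvg hy].
Qed.

Lemma prim0Z c x B : hb 0 x B -> prim0 (fun k => c * x k) = c * prim0 x.
Proof.
move=> hx; rewrite /prim0.
under eq_fun do rewrite mulrCA.
by rewrite series_limZ//; exact: prim0_cvg hx.
Qed.

Lemma prim0_finite x M : (forall k, (M <= k)%N -> x k = 0) ->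
  prim0 x = \sum_(0 <= j < M) j%:R^-1 * x j.
Proof.
move=> x0; apply: series_eventually0_lim => k Mk; by rewrite x0// mulr0.
Qed.

Lemma hb_finite s x M : (forall k, (M <= k)%N -> x k = 0) ->
  hb s x (\sum_(0 <= k < M) wt k ^+ s * x k ^+ 2).
Proof.
move=> x0 K; have [KM|MK] := leqP K M; first by apply: sum_nat_le => // k; exact: hb_term_ge0.
rewrite (@big_cat_nat _ _ _ M 0 K) ?(ltnW MK)//= [X in _ + X]sum_nat_eq0 ?addr0//.
by move=> k /x0 ->; rewrite expr0n mulr0.
Qed.

End AbsolutelyConvergentSeries.

(** * Band operators and energy estimates *)

Section Operators.
Variable R : realType.
Implicit Types (x y z : nat -> R) (B : R).

(* [cp], [cd], [cq] are the entries of a band operator coupling the mode k with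
   k - 2, k and k + 2; [cr] carries the nonlocal rank-one term [prim0]. The entries
   may grow linearly, but by [cpq_le] their growing parts are antisymmetric. *)
Record bandop := Bandop {
  cp : nat -> R; cd : nat -> R; cq : nat -> R; cr : nat -> R; cK : R;
  cK_ge0 : 0 <= cK;
  cp0 : cp 0%N = 0; cp1 : cp 1%N = 0;
  cp_le : forall k, `|cp k| <= cK * (k%:R + 1);
  cq_le : forall k, `|cq k| <= cK * (k%:R + 1);
  cd_le : forall k, `|cd k| <= cK;
  cr_le : forall k, `|cr k| <= cK;
  cr0 : forall k, (3 <= k)%N -> cr k = 0;
  cpq_le : forall k, `|cp k.+2 + cq k| <= cK }.

Variable o : bandop.

(** At k = 0 and k = 1 the truncated subtraction reads [x 0], but [cp] vanishes there. *)
Definition bapp x k := cp o k * x (k - 2)%N + cd o k * x k + cq o k * x k.+2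
  + cr o k * prim0 x.

Let K := cK o.
Let K0 : 0 <= K := cK_ge0 o.

Lemma bappB x y B B' : hb 0 x B -> hb 0 y B' ->
  forall k, bapp (fun k => x k - y k) k = bapp x k - bapp y k.
Proof. by move=> hx hy k; rewrite /bapp (prim0B hx hy); ring. Qed.

Lemma bappZ c x B : hb 0 x B ->
  forall k, bapp (fun k => c * x k) k = c * bapp x k.
Proof. by move=> hx k; rewrite /bapp (prim0Z _ hx); ring. Qed.

Lemma sqr_le_of_norm (a b : R) : `|a| <= b -> a ^+ 2 <= b ^+ 2.
Proof.
by move=> ab; rewrite -real_normK ?num_real// lerXn2r// nnegrE// (le_trans _ ab).
Qed.

Lemma sqr_coef_le (a : R) k : `|a| <= K * (k%:R + 1) -> a ^+ 2 <= 2 * K ^+ 2 * wt k.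
Proof.
move=> /sqr_le_of_norm; rewrite exprMn => /le_trans; apply.
rewrite (_ : 2 * K ^+ 2 * wt k = K ^+ 2 * (2 * wt k)); last by ring.
by apply: ler_wpM2l; rewrite ?sqr_ge0 ?sqr_succ_le_wt.
Qed.

(** [cr] lives on the three modes 0, 1, 2, whose weights are at most [wt 2], that is 5. *)
Lemma hb_rank_one s B (c : R) : c ^+ 2 <= B ->
  hb s (fun k => cr o k * c) (3 * 5 ^+ s * K ^+ 2 * B).
Proof.
move=> cB; have B0 : 0 <= B by apply: le_trans cB; exact: sqr_ge0.
apply: (@hb_le _ _ _ (\sum_(0 <= k < 3) wt k ^+ s * (cr o k * c) ^+ 2)); last first.
  by apply: hb_finite => k k3; rewrite cr0// mul0r.
apply: (@le_trans _ _ (\sum_(0 <= k < 3) 5 ^+ s * K ^+ 2 * B)); last first.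
  rewrite 3?big_nat_recr//= big_geq// le_eqVlt; apply/orP; left; apply/eqP.
  by ring.
apply: ler_sum_nat => k /andP[_ k3]; rewrite -mulrA.
apply: ler_pM => //; rewrite ?sqr_ge0//.
  rewrite lerXn2r ?nnegrE//; apply: (@le_trans _ _ (wt 2)).
    exact: wt_homo.
  by rewrite /wt; lra.
rewrite exprMn; apply: ler_pM; rewrite ?sqr_ge0//.
exact/sqr_le_of_norm/cr_le.
Qed.

(** Entries of size O(k) cost one derivative; the constant is the sum of the contributions of the
    four terms of [bapp]. *)
Lemma bapp_bound s : {c : R | 0 <= c &
  forall x B, hb s.+1 x B -> hb s (bapp x) (c * B)}.
Proof.
exists (2 * (2 * (2 * (2 * K ^+ 2 * 5 ^+ s.+1) + 2 * K ^+ 2) + 2 * (2 * K ^+ 2))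
  + 2 * (3 * 5 ^+ s * K ^+ 2 * 6)).
  by rewrite ?(addr_ge0, mulr_ge0, exprn_ge0).
move=> x B h; have B0 := hb_ge0 h.
have h0 : hb 0 x B by apply: hb_lower h.
have hs : hb s x B by apply: hb_lower h.
have K2 : 0 <= 2 * K ^+ 2 by rewrite mulr_ge0 ?sqr_ge0.
have coef (a : nat -> R) y B' : (forall k, `|a k| <= K * (k%:R + 1)) ->
    hb s.+1 y B' -> hb s (fun k => a k * y k) (2 * K ^+ 2 * B').
  move=> ha; apply: hb_dom => // k.
  rewrite (_ : _ * (_ * _) ^+ 2 = wt k ^+ s * y k ^+ 2 * a k ^+ 2); last by ring.
  rewrite (_ : 2 * K ^+ 2 * (_ * _) = wt k ^+ s * y k ^+ 2 * (2 * K ^+ 2 * wt k)); last by rewrite (exprS (wt k)); ring.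
  by apply: ler_wpM2l; [rewrite mulr_ge0 ?sqr_ge0|exact: sqr_coef_le].
have h1 : hb s (fun k => cp o k * x (k - 2)%N) (2 * K ^+ 2 * (5 ^+ s.+1 * B)).
  (* As [cp] vanishes at 0 and 1, the shifted sequence may start with two zeros, as [hb_unshift]
     requires. *)
  apply: (@hb_ext _ _ (fun k => cp o k * (if (k < 2)%N then 0 else x (k - 2)%N))).
    by move=> [|[|k]] //=; rewrite ?cp0 ?cp1 !mul0r.
  apply: coef; first exact: cp_le.
  by apply: (hb_unshift (x := x)) => // k /=; rewrite subn2.
have h2 : hb s (fun k => cd o k * x k) (K ^+ 2 * B).
  apply: hb_dom hs => [|k]; first exact: sqr_ge0.
  rewrite exprMn mulrCA; apply: ler_wpM2r => //.
    by rewrite mulr_ge0 ?sqr_ge0.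
  exact/sqr_le_of_norm/cd_le.
have h3 : hb s (fun k => cq o k * x k.+2) (2 * K ^+ 2 * B).
  by apply: coef; [exact: cq_le|exact: hb_shift].
have h4 : hb s (fun k => cr o k * prim0 x) (3 * 5 ^+ s * K ^+ 2 * (6 * B)).
  exact/hb_rank_one/prim0_sqr_le.
apply: hb_le (hbD (hbD (hbD h1 h2) h3) h4).
by rewrite le_eqVlt; apply/orP; left; apply/eqP; ring.
Qed.

End Operators.

Section Energy.
Variable R : realType.
Implicit Types (x y z : nat -> R) (B : R).

(** Increments of the weight gain a factor of order 1/k. The factor k + 3 is the growth allowed to
    [cp] at the mode k + 2; the induction on s uses the product rule for differences. *)
Lemma wtX_diff s : {c : R | 0 <= c &
  forall k, (k%:R + 3) * `|wt k.+2 ^+ s - wt k ^+ s| <= c * wt k ^+ s}.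
Proof.
elim: s => [|s [c c0 IH]].
  by exists 0 => // k; rewrite !expr0 subrr normr0 mulr0 mul0r.
exists (5 * c + 20) => [|k]; first by rewrite addr_ge0 ?mulr_ge0.
have -> : wt k.+2 ^+ s.+1 - wt k ^+ s.+1 =
    wt k.+2 * (wt k.+2 ^+ s - wt k ^+ s) + (wt k.+2 - wt k) * wt k ^+ s :> R.
  by rewrite !exprS; ring.
have k0 : 0 <= k%:R :> R by [].
have k3 : 0 <= k%:R + 3 :> R by lra.
apply: le_trans (ler_wpM2l k3 (ler_normD _ _)) _.
rewrite !normrM (ger0_norm (wt_ge0 _ _)) (ger0_norm (wtX_ge0 _ _ _)) mulrDr [leRHS]mulrDl.
apply: lerD.
  rewrite mulrCA exprS (_ : 5 * c * _ = 5 * wt k * (c * wt k ^+ s)); last by ring.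
  by apply: ler_pM; rewrite ?mulr_ge0 ?wt_shift.
rewrite mulrA exprS mulrA; apply: ler_wpM2r => //.
have -> : wt k.+2 - wt k = 4 * k%:R + 4 :> R by rewrite /wt natSS; ring.
rewrite ger0_norm; last by lra.
by rewrite /wt; have := sqr_ge0 (2 * k%:R - 1 : R); nra.
Qed.

Variable o : bandop R.
Let K := cK o.
Let K0 : 0 <= K := cK_ge0 o.

(** The product [z k * z k.+2] collects wt(k+2)^s cp(k+2) + wt(k)^s cq(k). Writing this as wt(k)^s
    (cp(k+2) + cq(k)) plus cp(k+2) times the increment of the weight, [cpq_le] bounds the first part
    and [wtX_diff] the second. The constant does not depend on M. *)
Lemma energy_form s : {c : R | 0 <= c & forall M z,
  (forall k, (M <= k)%N -> z k = 0) ->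
  `|\sum_(0 <= k < M) wt k ^+ s * z k * bapp o z k| <=
    c * \sum_(0 <= k < M) wt k ^+ s * z k ^+ 2}.
Proof.
have [c c0 hc] := wtX_diff s.
exists ((K + K * c) + K + 2^-1 * (1 + 3 * 5 ^+ s * K ^+ 2 * 6)).
  by rewrite ?(addr_ge0, mulr_ge0, exprn_ge0, invr_ge0).
move=> M z z0; set e := (X in _ <= _ * X).
have hz := hb_finite s z0; rewrite -/e in hz.
have h0 := hb_lower (leq0n s) hz.
(* Reindexing by two brings both couplings of the modes k and k + 2 under one index. No boundary
   terms appear, since z vanishes from M on and [cp] vanishes at 0 and 1. *)
have shiftp : \sum_(0 <= k < M) wt k ^+ s * z k * (cp o k * z (k - 2)%N) =
    \sum_(0 <= k < M) wt k.+2 ^+ s * z k.+2 * (cp o k.+2 * z k).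
  set F := fun k => wt k ^+ s * z k * (cp o k * z (k - 2)%N).
  have : \sum_(0 <= k < M.+2) F k = \sum_(0 <= k < M) F k.
    have F0 k : (M <= k)%N -> F k = 0 by move=> Mk; rewrite /F z0// mulr0 mul0r.
    by rewrite big_nat_recr// big_nat_recr// (F0 M)// (F0 M.+1) ?leqnSn//= !addr0.
  rewrite sum_shift2 {1 2}/F cp0 cp1 !mul0r !mulr0 !add0r => <-.
  by apply: eq_bigr => k _; rewrite /F subn2.
have -> : \sum_(0 <= k < M) wt k ^+ s * z k * bapp o z k =
  \sum_(0 <= k < M) ((wt k ^+ s * (cp o k.+2 + cq o k) +
      cp o k.+2 * (wt k.+2 ^+ s - wt k ^+ s)) * (z k * z k.+2)
    + wt k ^+ s * cd o k * z k ^+ 2 + wt k ^+ s * (z k * (cr o k * prim0 z))).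
  transitivity (\sum_(0 <= k < M) wt k ^+ s * z k * (cp o k * z (k - 2)%N) +
     \sum_(0 <= k < M) wt k ^+ s * z k *
       (cd o k * z k + cq o k * z k.+2 + cr o k * prim0 z)).
    by rewrite -big_split/=; apply: eq_bigr => k _; rewrite /bapp; ring.
  by rewrite shiftp -big_split/=; apply: eq_bigr => k _; ring.
apply: le_trans (ler_norm_sum _ _ _) _.
(* Each product is split by 2|ab| <= a^2 + b^2, so that only weighted squares are left to sum. *)
apply: (@le_trans _ _ (\sum_(0 <= k < M)
   ((K + K * c) * 2^-1 * (wt k ^+ s * z k ^+ 2) +
    (K + K * c) * 2^-1 * (wt k ^+ s * z k.+2 ^+ 2) + K * (wt k ^+ s * z k ^+ 2) +
    2^-1 * (wt k ^+ s * z k ^+ 2) +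
    2^-1 * (wt k ^+ s * (cr o k * prim0 z) ^+ 2)))); last first.
  rewrite !big_split/= -!mulr_sumr -/e.
  have h1 := hb_shift hz M.
  have h2 : \sum_(0 <= k < M) wt k ^+ s * (cr o k * prim0 z) ^+ 2 <=
      3 * 5 ^+ s * K ^+ 2 * (6 * e) by exact: (hb_rank_one o s (prim0_sqr_le h0)).
  have KK : 0 <= (K + K * c) * 2^-1 by rewrite ?(addr_ge0, mulr_ge0, invr_ge0).
  have := ler_wpM2l KK h1; move: h2; set A := 5 ^+ s; set b1 := bigop _ _ _; set b2 := bigop _ _ _.
  move=> h2 h3; lra.
apply: ler_sum => k _; apply: le_trans (ler_normD _ _) _.
rewrite -[leRHS]addrA; apply: lerD.
  apply: le_trans (ler_normD _ _) _; apply: lerD.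
    rewrite normrM -mulrDr -mulrDr.
    have -> : (K + K * c) / 2 * (wt k ^+ s * (z k ^+ 2 + z k.+2 ^+ 2)) =
      ((K + K * c) * wt k ^+ s) * ((z k ^+ 2 + z k.+2 ^+ 2) / 2) by field.
    apply: ler_pM => //; last first.
      rewrite normrM -(real_normK (num_real (z k))) -(real_normK (num_real (z k.+2))).
      by have := sqr_ge0 (`|z k| - `|z k.+2|); nra.
    apply: le_trans (ler_normD _ _) _; rewrite mulrDl; apply: lerD.
      by rewrite normrM (ger0_norm (wtX_ge0 _ _ _)) mulrC ler_wpM2r// cpq_le.
    rewrite normrM -mulrA; apply: le_trans (ler_wpM2l K0 (hc k)).
    rewrite mulrA; apply: ler_wpM2r => //.
    by apply: le_trans (cp_le o _) _; rewrite natSS -/K -addrA (_ : 2 + 1 = 3 :> R)//; lra.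
  rewrite -(mulrA (wt k ^+ s)) normrM (ger0_norm (wtX_ge0 _ _ _)).
  rewrite [leRHS]mulrCA; apply: ler_wpM2l => //.
  rewrite normrM (ger0_norm (sqr_ge0 _)); apply: ler_wpM2r; rewrite ?sqr_ge0//.
  exact: cd_le.
rewrite normrM (ger0_norm (wtX_ge0 _ _ _)) -mulrDr -mulrDr [leRHS]mulrCA.
apply: ler_wpM2l => //; set a := cr o k * _; rewrite normrM.
rewrite -(real_normK (num_real (z k))) -(real_normK (num_real a)).
by have := sqr_ge0 (`|z k| - `|a|); nra.
Qed.

Definition energy s M z := \sum_(0 <= k < M) wt k ^+ s * z k ^+ 2.

Lemma is_derive_energy s M (Z : R -> nat -> R) (dZ : nat -> R) (t : R) :
  (forall k, (k < M)%N -> is_derive t 1 (Z ^~ k) (dZ k)) ->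
  is_derive t 1 (fun t => energy s M (Z t))
    (\sum_(0 <= k < M) wt k ^+ s * (2 * (Z t k * dZ k))).
Proof.
move=> h; apply: is_derive1_sum => k kM; apply: is_derive1Z.
have H := is_derive1M (h k kM) (h k kM).
by apply: (is_derive_eq H); ring.
Qed.

(** The forcing g enters through 2 z g <= z^2 + g^2, which accounts for the extra 1 in the
    constant. *)
Lemma energy_rate s : {c : R | 0 <= c & forall M z (g : nat -> R) (G : R),
  (forall k, (M <= k)%N -> z k = 0) ->
  \sum_(0 <= k < M) wt k ^+ s * g k ^+ 2 <= G ->
  `|\sum_(0 <= k < M) wt k ^+ s * (2 * (z k * (bapp o z k + g k)))| <=
    c * energy s M z + G}.
Proof.
have [c c0 hc] := energy_form s.
exists (2 * c + 1) => [|M z g G z0 gG]; first by rewrite addr_ge0 ?mulr_ge0.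
have -> : \sum_(0 <= k < M) wt k ^+ s * (2 * (z k * (bapp o z k + g k))) =
   2 * (\sum_(0 <= k < M) wt k ^+ s * z k * bapp o z k) +
   \sum_(0 <= k < M) 2 * (wt k ^+ s * (z k * g k)).
  by rewrite mulr_sumr -big_split/=; apply: eq_bigr => k _; ring.
apply: le_trans (ler_normD _ _) _; rewrite [leRHS](_ : _ = 2 * c * energy s M z + (energy s M z + G)); last by ring.
apply: lerD.
  by rewrite normrM ger0_norm// -mulrA ler_wpM2l// hc.
apply: (@le_trans _ _ (energy s M z + \sum_(0 <= k < M) wt k ^+ s * g k ^+ 2)).
  rewrite /energy -big_split/=; apply: le_trans (ler_norm_sum _ _ _) _.
  apply: ler_sum => k _; rewrite normrM ger0_norm// normrM (ger0_norm (wtX_ge0 _ _ _)).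
  rewrite mulrCA -mulrDr; apply: ler_wpM2l => //; rewrite normrM.
  rewrite -(real_normK (num_real (z k))) -(real_normK (num_real (g k))).
  by have := sqr_ge0 (`|z k| - `|g k|); nra.
by rewrite lerD2l.
Qed.

Lemma energy_estimate s : {c : R | 0 <= c & forall M (Z g : R -> nat -> R) (T G : R),
  0 <= G -> (forall (t : R) k, (M <= k)%N -> Z t k = 0) ->
  (forall (t : R) k, (k < M)%N -> is_derive t 1 (Z ^~ k) (bapp o (Z t) k + g t k)) ->
  (forall t : R, `|t| <= T -> \sum_(0 <= k < M) wt k ^+ s * g t k ^+ 2 <= G) ->
  forall t : R, `|t| <= T ->
    energy s M (Z t) <= expR (c * `|t|) * (energy s M (Z 0) + G * `|t|)}.
Proof.
have [c c0 hc] := energy_rate s.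
exists c => // M Z g T G G0 Z0 dZ gG.
apply: (gronwall2 (E := fun t => energy s M (Z t)) c0 G0) => [t|t tT].
  by apply: is_derive_energy => k kM; exact: dZ.
by apply: hc; [exact: Z0|exact: gG].
Qed.

(** The variant for arbitrary solutions on [0, T], differentiable only in the interior;
    [energy_estimate] is meant for Galerkin flows. *)
Lemma energy_estimate_oo s : {c : R | 0 <= c & forall M (Z g : R -> nat -> R) (T G : R),
  0 <= T -> 0 <= G -> (forall (t : R) k, (M <= k)%N -> Z t k = 0) ->
  (forall (t : R) k, 0 < t < T -> (k < M)%N ->
    is_derive t 1 (Z ^~ k) (bapp o (Z t) k + g t k)) ->
  (forall k, (k < M)%N -> {within `[0, T], continuous (Z ^~ k)}) ->
  (forall t : R, 0 < t < T -> \sum_(0 <= k < M) wt k ^+ s * g t k ^+ 2 <= G) ->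
  energy s M (Z T) <= expR (c * T) * (energy s M (Z 0) + G * T)}.
Proof.
have [c c0 hc] := energy_rate s.
exists c => // M Z g T G T0 G0 Z0 dZ cZ gG.
apply: (gronwall (E := fun t => energy s M (Z t)) T0 c0 G0) => [t tT||t tT].
- by apply: is_derive_energy => k kM; exact: dZ.
- rewrite /energy; elim: M cZ {Z0 dZ gG} => [_|M IH cZ].
    rewrite (_ : (fun t => _) = fun=> 0); last by apply/funext => t; rewrite big_geq.
    by apply: continuous_subspaceT => x; exact: cst_continuous.
  rewrite (_ : (fun t => _) = fun t => \sum_(0 <= k < M) wt k ^+ s * Z t k ^+ 2 +
      wt M ^+ s * Z t M ^+ 2); last by apply/funext => t; rewrite big_nat_recr.
  have cZM := cZ M (ltnSn M).
  have {}IH := IH (fun k kM => cZ k (ltnW kM)).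
  have cc : {within `[0, T], continuous (fun _ : R => wt M ^+ s : R)}.
    by apply: continuous_subspaceT => x; exact: cst_continuous.
  move=> x; exact: (continuousD (IH x)
    (continuousM (cc x) (continuousM (cZM x) (cZM x)))).
- apply: le_trans (ler_norm _) _; by apply: hc; [exact: Z0|exact: gG].
Qed.

End Energy.

(** * Finite linear systems solved by the exponential series *)

Section LinearODE.
Variable R : realType.
Variables (N : nat) (mat : nat -> nat -> R) (v : nat -> R).

(** Coordinates of A^n v; divided by n! they are the Taylor coefficients of exp(tA) v. *)
Fixpoint mxiter n k : R :=
  if n is n'.+1 then \sum_(0 <= j < N) mat k j * mxiter n' j else v k.

(** One step multiplies the l^1 norm of the first N coordinates by at most the sum of the row sums.
    B depends on k because coordinates from N on are included. *)
Lemma mxiter_bound : exists2 L : R, 0 <= L &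
  forall k, exists2 B : R, 0 <= B & forall n, `|mxiter n k| <= B * L ^+ n.
Proof.
pose rowsum k : R := \sum_(0 <= j < N) `|mat k j|.
pose S n : R := \sum_(0 <= j < N) `|mxiter n j|.
have row0 k : 0 <= rowsum k by exact: sumr_ge0.
have S0 n : 0 <= S n by exact: sumr_ge0.
pose L := \sum_(0 <= k < N) rowsum k.
have L0 : 0 <= L by exact: sumr_ge0.
have step n k : `|mxiter n.+1 k| <= rowsum k * S n.
  rewrite /= mulr_suml; apply: le_trans (ler_norm_sum _ _ _) _.
  apply: ler_sum_nat => j /andP[_ jN]; rewrite normrM ler_wpM2l//.
  rewrite /S (@big_cat_nat _ _ _ j 0 N) ?(ltnW jN)//= (@big_ltn _ _ _ j)//=.
  by rewrite addrCA lerDl addr_ge0// sumr_ge0.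
have SL n : S n <= S 0%N * L ^+ n.
  elim: n => [|n IH]; first by rewrite expr0 mulr1.
  apply: (@le_trans _ _ (L * S n)).
    by rewrite /L mulr_suml; apply: ler_sum => k _; exact: step.
  by rewrite exprS mulrCA ler_wpM2l.
(* Adding 1 makes the powers nondecreasing, which makes up for the exponent lost in passing from
   [S n] to the iterate n + 1. *)
exists (L + 1) => [|k]; first by rewrite addr_ge0.
exists (`|v k| + rowsum k * S 0%N) => [|[|n]].
- by rewrite addr_ge0// mulr_ge0.
- by rewrite expr0 mulr1 lerDl mulr_ge0.
apply: le_trans (step n k) _.
apply: (@le_trans _ _ (rowsum k * S 0%N * (L + 1) ^+ n.+1)); last first.
  by rewrite ler_wpM2r ?exprn_ge0 ?addr_ge0// lerDr.
rewrite -mulrA; apply: ler_wpM2l => //; apply: le_trans (SL n) _.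
apply: ler_wpM2l => //; apply: (@le_trans _ _ ((L + 1) ^+ n)).
  by rewrite lerXn2r ?nnegrE ?addr_ge0// lerDl.
by rewrite ler_weXn2l// lerDr.
Qed.

(** Taylor coefficients of the i-th time derivative, so that differentiating term by term only
    raises i. *)
Definition ode_coef i k n : R := mxiter (n + i) k / n`!%:R.

Lemma ode_coef_cvg i k t : cvgn (pseries (ode_coef i k) t).
Proof.
have [L L0 /(_ k)[B B0 hB]] := mxiter_bound.
apply: normed_cvg.
apply: (@series_le_cvg _ _ (fun n => B * L ^+ i * exp_coeff (L * `|t|) n)) => //.
- by move=> n /=.
- by move=> n; rewrite mulr_ge0 ?exp_coeff_ge0 ?mulr_ge0 ?exprn_ge0.
- move=> n /=; rewrite /ode_coef normrM normrX normrM normfV (ger0_norm (ler0n _ _)).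
  rewrite /exp_coeff/= exprMn mulrAC !mulrA; apply: ler_wpM2r; first by rewrite invr_ge0.
  apply: ler_wpM2r; first by rewrite exprn_ge0.
  by rewrite -mulrA -exprD addnC.
- exact: (is_cvg_seriesZ (k := B * L ^+ i) (@is_cvg_series_exp_coeff R (L * `|t|))).
Qed.

Definition ode_sol t k : R := limn (pseries (ode_coef 0 k) t).

Lemma ode_sol0 k : ode_sol 0 k = v k.
Proof.
rewrite /ode_sol /pseries.
rewrite (@series_eventually0_lim _ _ 1%N) => [|[|n] _//]; last first.
  by rewrite /= expr0n mulr0.
by rewrite big_nat1 /= expr0 mulr1 /ode_coef /= divr1.
Qed.

(** This confines the Galerkin solutions to the first N modes. *)
Lemma ode_sol_eq0 k : v k = 0 -> (forall j, mat k j = 0) -> forall t, ode_sol t k = 0.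
Proof.
move=> vk mk t; rewrite /ode_sol /pseries.
rewrite (@series_eventually0_lim _ _ 0%N) ?big_geq// => n _.
rewrite /= /ode_coef addn0; case: n => [|n] /=; first by rewrite vk !mul0r.
by rewrite big1 ?mul0r// => j _; rewrite mk mul0r.
Qed.

Lemma is_derive_ode_sol (t : R) k :
  is_derive t 1 (ode_sol ^~ k) (\sum_(0 <= j < N) mat k j * ode_sol t j).
Proof.
have diffsE i : pseries_diffs (ode_coef i k) = ode_coef i.+1 k.
  apply/funext => n; rewrite /pseries_diffs /ode_coef addSnnS factS natrM.
  rewrite invfM mulrCA; congr (_ * _); rewrite mulrA mulfV ?mul1r//.
have H : is_derive t 1 (ode_sol ^~ k) (limn (pseries (pseries_diffs (ode_coef 0 k)) t)).
  apply: (@pseries_snd_diffs _ _ (`|t| + 1)); rewrite ?diffsE.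
  - exact: ode_coef_cvg.
  - exact: ode_coef_cvg.
  - exact: ode_coef_cvg.
  - by rewrite [ltRHS]ger0_norm ?addr_ge0// ltrDl.
apply: (is_derive_eq H); rewrite diffsE; apply: cvg_lim => //.
have -> : pseries (ode_coef 1 k) t =
    fun n => \sum_(0 <= j < N) mat k j * pseries (ode_coef 0 j) t n.
  apply/funext => n; rewrite /pseries /series/=.
  under [RHS]eq_bigr do rewrite mulr_sumr.
  rewrite exchange_big/=; apply: eq_bigr => i _.
  rewrite /ode_coef addn1/= !mulr_suml; apply: eq_bigr => j _.
  by rewrite addn0 !mulrA.
apply: cvg_sum_nat => j; apply: cvgM; first exact: cvg_cst.
exact: ode_coef_cvg.
Qed.

End LinearODE.

(** * Galerkin approximation *)

Section Galerkin.
Variable R : realType.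
Implicit Types (x y v : nat -> R) (B T e t u : R).

Lemma sum_delta N a x : (forall k, (N <= k)%N -> x k = 0) ->
  \sum_(0 <= j < N) (j == a)%:R * x j = x a.
Proof.
move=> x0; transitivity (\sum_(0 <= j < N | j == a) x j).
  rewrite [RHS]big_mkcond/=; apply: eq_bigr => j _.
  by case: ifP; rewrite (mul1r, mul0r).
by rewrite big_nat1_eq leq0n/=; case: ltnP => // /x0 ->.
Qed.

Lemma MVT_dist (f df : R -> R) (t u : R) : (forall s : R, is_derive s 1 f (df s)) ->
  exists2 c : R, `|c - t| <= `|u - t| & f u - f t = df c * (u - t).
Proof.
move=> dff; have cf a b : {within `[a, b], continuous f}.
  by apply: continuous_subspaceT => x; exact: is_derive1_continuous (dff x).
have [tu|ut] := leP t u.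
  have [c] := MVT_segment tu (fun (x : R) _ => dff x) (cf _ _).
  rewrite in_itv/= => /andP[tc cu] e; exists c => //.
  by rewrite !ger0_norm ?subr_ge0// lerD2r.
have [c] := MVT_segment (ltW ut) (fun (x : R) _ => dff x) (cf _ _).
rewrite in_itv/= => /andP[tc cu] e; exists c.
  by rewrite !ler0_norm ?subr_le0 ?(ltW ut)// lerN2 lerD2r.
by rewrite -opprB e -mulrN opprB.
Qed.

(** A mean value inequality for vectors. The scalar mean value theorem is applied to the inner
    product of [x s - s y] with the increment z itself, whose variation from t to u is the squared
    norm of z. *)
Lemma sum_sqr_mvt K (W : nat -> R) (x dx : R -> nat -> R) y (t u e : R) :
  (forall k, 0 <= W k) ->
  (forall (s : R) k, is_derive s 1 (x ^~ k) (dx s k)) ->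
  (forall s : R, `|s - t| <= `|u - t| ->
    \sum_(0 <= k < K) W k * (dx s k - y k) ^+ 2 <= e) ->
  \sum_(0 <= k < K) W k * (x u k - x t k - (u - t) * y k) ^+ 2 <= e * (u - t) ^+ 2.
Proof.
move=> W0 dxE he; pose z k := x u k - x t k - (u - t) * y k.
pose f s := \sum_(0 <= k < K) (W k * z k) * (x s k - s * y k).
have df (s : R) : is_derive s 1 f (\sum_(0 <= k < K) (W k * z k) * (dx s k - y k)).
  apply: is_derive1_sum => k _; apply: is_derive1Z; apply: is_derive1B => //.
  have H := is_derive1M (is_derive_id s 1) (is_derive1C (y k) s).
  by apply: (is_derive_eq H); rewrite mul1r mulr0 addr0.
have [c ct] := MVT_dist t u df.
have -> : f u - f t = \sum_(0 <= k < K) W k * z k ^+ 2.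
  by rewrite /f -sumrB; apply: eq_bigr => k _; rewrite /z; ring.
set S := (X in X = _); set D := (X in X * _) => SE.
change (S <= e * (u - t) ^+ 2).
have := he c ct; set Q := (X in X <= e) => Qe.
(* By 2ab <= a^2 + b^2 in each term; one S is then absorbed on the left. *)
have h : 2 * S <= S + (u - t) ^+ 2 * Q.
  rewrite {1}SE /D mulr_suml mulr_sumr /S /Q mulr_sumr -big_split/=.
  apply: ler_sum => k _.
  rewrite (_ : 2 * _ = W k * (2 * (z k * ((dx c k - y k) * (u - t))))); last by ring.
  rewrite [leRHS](_ : _ = W k * (z k ^+ 2 + ((dx c k - y k) * (u - t)) ^+ 2)); last by ring.
  apply: ler_wpM2l => //; have := sqr_ge0 (z k - (dx c k - y k) * (u - t)).
  by nra.
have u2 : 0 <= (u - t) ^+ 2 by exact: sqr_ge0.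
have := ler_wpM2l u2 Qe; lra.
Qed.

Definition trunc N v : nat -> R := fun k => if (k < N)%N then v k else 0.

Lemma trunc_ge N v k : (N <= k)%N -> trunc N v k = 0.
Proof. by rewrite /trunc ltnNge => ->. Qed.

Lemma trunc_lt N v k : (k < N)%N -> trunc N v k = v k.
Proof. by rewrite /trunc => ->. Qed.

Lemma hb_trunc s N v B : hb s v B -> hb s (trunc N v) B.
Proof.
rewrite -[B in X in _ -> X]mul1r; apply: hb_dom => // k; rewrite mul1r /trunc.
by case: ifP => // _; rewrite expr0n mulr0 hb_term_ge0.
Qed.

(** Tails of a convergent series of nonnegative terms. No derivative is spared, so J comes without a
    rate. *)
Lemma hb_tail s v B e : hb s v B -> 0 < e ->
  exists J, hb s (fun k => v k - trunc J v k) e.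
Proof.
move=> h e0; pose u k := wt k ^+ s * v k ^+ 2.
have cu : cvgn (series u).
  apply: (@sum_norm_is_cvg _ _ B) => K.
  under eq_bigr do rewrite ger0_norm ?hb_term_ge0//.
  exact: h.
move/cvgrPdist_le/(_ _ e0): (cu) => [J _ /(_ J (leqnn J)) hJ].
exists J => K; have [KJ|JK] := leqP K J.
  rewrite big_nat_cond big1 ?ltW// => k /andP[/andP[_ kK] _].
  by rewrite trunc_lt ?(leq_trans kK)// subrr expr0n mulr0.
rewrite (@big_cat_nat _ _ _ J 0 K) ?(ltnW JK)//= [X in X + _]big_nat_cond big1; last first.
  by move=> k /andP[/andP[_ kK] _]; rewrite trunc_lt// subrr expr0n mulr0.
rewrite add0r; apply: le_trans hJ; apply: le_trans (ler_norm _).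
rewrite lerBrDr; apply: le_trans (nondecreasing_cvgn_le _ cu K); last first.
  by apply: nondecreasing_series => k _ _; exact: hb_term_ge0.
rewrite addrC [series u K](@big_cat_nat _ _ _ J 0 K) ?(ltnW JK)//= lerD2l.
apply: ler_sum_nat => k /andP[Jk _].
by rewrite trunc_ge// subr0.
Qed.

Variable o : bandop R.

(** The operator compressed to the modes below N; [j%:R^-1] represents [prim0] on finitely supported
    sequences. *)
Definition bmat N k j : R :=
  if (k < N)%N then cp o k * (j == k - 2)%N%:R + cd o k * (j == k)%N%:R +
    cq o k * (j == k.+2)%N%:R + cr o k * j%:R^-1 else 0.

Lemma bmat_sum N x k : (forall k, (N <= k)%N -> x k = 0) ->
  \sum_(0 <= j < N) bmat N k j * x j = trunc N (bapp o x) k.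
Proof.
move=> x0; rewrite /bmat /trunc; case: ifP => kN; last first.
  by rewrite big1// => j _; rewrite mul0r.
rewrite /bapp (prim0_finite x0) -(sum_delta (k - 2)%N x0) -{1}(sum_delta k x0).
rewrite -(sum_delta k.+2 x0) !mulr_sumr -!big_split/=; apply: eq_bigr => j _.
by ring.
Qed.

Definition gal N v t := ode_sol N (bmat N) (trunc N v) t.

Lemma gal_ge N v t k : (N <= k)%N -> gal N v t k = 0.
Proof.
move=> Nk; apply: ode_sol_eq0 => [|j]; first exact: trunc_ge.
by rewrite /bmat ltnNge Nk.
Qed.

Lemma is_derive_gal N v (t : R) k :
  is_derive t 1 (gal N v ^~ k) (trunc N (bapp o (gal N v t)) k).
Proof. by rewrite -bmat_sum; [exact: is_derive_ode_sol|exact: gal_ge]. Qed.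

Lemma gal0 N v k : gal N v 0 k = trunc N v k.
Proof. exact: ode_sol0. Qed.

Lemma hb_finite0 x M : (forall k, (M <= k)%N -> x k = 0) -> {B | hb 0 x B}.
Proof. by move=> /(hb_finite 0); exists (\sum_(0 <= k < M) wt k ^+ 0 * x k ^+ 2). Qed.

(** The equation is required only below M, so this covers both a Galerkin solution and the
    difference of two at the same level. *)
Lemma hb_flow s : {c : R | 0 <= c & forall M (Z : R -> nat -> R) B T,
  (forall (t : R) k, (M <= k)%N -> Z t k = 0) ->
  (forall (t : R) k, (k < M)%N -> is_derive t 1 (Z ^~ k) (bapp o (Z t) k)) ->
  hb s (Z 0) B ->
  forall t : R, `|t| <= T -> hb s (Z t) (expR (c * T) * B)}.
Proof.
have [c c0 hc] := energy_estimate o s; exists c => // M Z B T Z0 dZ h t tT.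
have T0 : 0 <= T := le_trans (normr_ge0 t) tT.
apply: (hb_le _ (hb_finite (M := M) _ (Z0 t))).
have /= := hc M Z (fun _ _ => 0) T 0 (lexx _) Z0 _ _ t tT.
rewrite mul0r addr0 /energy => H; apply: le_trans (H _ _) _.
- by move=> r k kM; rewrite addr0; exact: dZ.
- by move=> r _; rewrite big1// => k _; rewrite expr0n mulr0.
- apply: ler_pM; rewrite ?expR_ge0//.
  + by apply: sumr_ge0 => k _; exact: hb_term_ge0.
  + by rewrite ler_expR ler_wpM2l.
Qed.

Lemma gal_bound s : {c : R | 0 <= c & forall N v B T, hb s v B ->
  forall t : R, `|t| <= T -> hb s (gal N v t) (expR (c * T) * B)}.
Proof.
have [c c0 hc] := hb_flow s; exists c => // N v B T h; apply: (hc N (gal N v) B T).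
- by move=> t k; exact: gal_ge.
- by move=> t k kN; have := is_derive_gal N v t k; rewrite trunc_lt.
- by rewrite (_ : gal N v 0 = trunc N v); [exact: hb_trunc|apply/funext => k; exact: gal0].
Qed.

Lemma gal_dist s : {c : R | 0 <= c & forall N v v' B T, hb s (fun k => v k - v' k) B ->
  forall t : R, `|t| <= T ->
    hb s (fun k => gal N v t k - gal N v' t k) (expR (c * T) * B)}.
Proof.
have [c c0 hc] := hb_flow s; exists c => // N v v' B T h.
apply: (hc N (fun t k => gal N v t k - gal N v' t k) B T).
- by move=> t k Nk; rewrite !gal_ge// subrr.
- move=> t k kN.
  have [B1 h1] := hb_finite0 (fun k => @gal_ge N v t k).
  have [B2 h2] := hb_finite0 (fun k => @gal_ge N v' t k).
  rewrite (bappB _ h1 h2).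
  by have := is_derive1B (is_derive_gal N v t k) (is_derive_gal N v' t k); rewrite !trunc_lt.
- apply: hb_ext (hb_trunc N h) => k; rewrite !gal0 /trunc.
  by case: ifP; rewrite ?subrr.
Qed.

(* For data with finitely many modes [gal N v] is bounded in h^(s+2), so that the modes
   beyond N, which drive the difference with [gal N' v], are small in h^s. *)
Lemma gal_cauchy_finite s J v T e : 0 <= T -> (forall k, (J <= k)%N -> v k = 0) -> 0 < e ->
  exists N0, forall N N', (N0 <= N)%N -> (N <= N')%N -> forall t : R, `|t| <= T ->
    hb s (fun k => gal N v t k - gal N' v t k) e.
Proof.
move=> T0 v0 e0.
have [c c0 hc] := energy_estimate o s.
have [c1 c10 hc1] := gal_bound s.+2.
have [c2 c20 hc2] := bapp_bound o s.+1.
have hv := hb_finite s.+2 v0; set Bv := (X in hb _ _ X) in hv.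
pose D := c2 * (expR (c1 * T) * Bv).
have D0 : 0 <= D by rewrite !mulr_ge0 ?expR_ge0// (hb_ge0 hv).
pose F := expR (c * T) * (D * T).
have F0 : 0 <= F by rewrite mulr_ge0 ?expR_ge0// mulr_ge0.
have [N1 N1P] : exists N1 : nat, F / e <= N1%:R.
  by exists (Num.Def.archi_bound (F / e)); apply/ltW/archi_boundP; rewrite divr_ge0// ltW.
exists (maxn N1 J) => N N'; rewrite geq_max => /andP[N1N JN] NN' t tT.
have hx r : `|r| <= T -> hb s.+1 (bapp o (gal N v r)) D by move=> rT; apply/hc2/hc1.
pose Z t k := gal N v t k - gal N' v t k.
(* From N on the coarse solution stays at 0, so the equation for the difference has to be corrected
   by [bapp o (gal N v t)] there. *)
pose g t k := if (k < N)%N then 0 else - bapp o (gal N v t) k.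
have Z0 (r : R) k : (N' <= k)%N -> Z r k = 0.
  by move=> N'k; rewrite /Z !gal_ge// ?subrr// (leq_trans NN').
apply: hb_le (hb_finite s (Z0 t)).
have G0 : 0 <= (wt N)^-1 * D by rewrite mulr_ge0// invr_ge0.
apply: (@le_trans _ _ (expR (c * `|t|) * (energy s N' (Z 0) + (wt N)^-1 * D * `|t|))).
  apply: (hc N' Z g T) => //.
  - move=> r k kN'.
    have [B1 h1] := hb_finite0 (fun k => @gal_ge N v r k).
    have [B2 h2] := hb_finite0 (fun k => @gal_ge N' v r k).
    rewrite (bappB _ h1 h2).
    have H := is_derive1B (is_derive_gal N v r k) (is_derive_gal N' v r k).
    apply: (is_derive_eq H); rewrite (trunc_lt _ kN') /g /trunc.
    by case: ifP => _; rewrite ?addr0//; ring.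
  - move=> r rT; rewrite (@big_cat_nat _ _ _ N 0 N')//= [X in X + _]big_nat_cond big1; last first.
      by move=> k /andP[/andP[_ kN] _]; rewrite /g kN expr0n mulr0.
    rewrite add0r (eq_big_nat _ _ (F2 := fun k => wt k ^+ s * bapp o (gal N v r) k ^+ 2)); last first.
      by move=> k /andP[Nk _]; rewrite /g ltnNge Nk/= sqrrN.
    by rewrite -(expr1 (wt N)); apply: hb_sum_ge; rewrite addn1; exact: hx.
(* Both levels start from v itself, whose support lies below J <= N. *)
have -> : energy s N' (Z 0) = 0.
  rewrite /energy big1// => k _; rewrite /Z !gal0 /trunc.
  case: (ltnP k N) => [kN|Nk]; first by rewrite (leq_trans kN NN') subrr expr0n mulr0.
  by rewrite (v0 k) ?(leq_trans JN)//; case: ifP; rewrite subrr expr0n mulr0.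
rewrite add0r; apply: (@le_trans _ _ ((wt N)^-1 * F)).
  rewrite (_ : _ * F = expR (c * T) * ((wt N)^-1 * D * T)); last by rewrite /F; ring.
  apply: ler_pM; rewrite ?expR_ge0//.
  - by rewrite mulr_ge0.
  - by rewrite ler_expR ler_wpM2l.
  - by rewrite ler_wpM2l// mulr_ge0 ?invr_ge0.
rewrite mulrC ler_pdivrMr// mulrC -ler_pdivrMr//; apply: le_trans N1P _.
apply: (@le_trans _ _ N%:R); first by rewrite ler_nat.
have : (N%:R : R) = 0 \/ 1 <= (N%:R : R).
  by case: (N) => [|n]; [left|right; rewrite ler1n].
by rewrite /wt => -[->|h]; nra.
Qed.

(** By density: replacing v by a truncation costs an error that [gal_dist] bounds independently of
    N. *)
Lemma gal_cauchy s v B T e : hb s v B -> 0 < e ->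
  exists N0, forall N N', (N0 <= N)%N -> (N0 <= N')%N -> forall t : R, `|t| <= T ->
    hb s (fun k => gal N v t k - gal N' v t k) e.
Proof.
move=> h e0.
have [T0|T0] := ltP T 0.
  by exists 0%N => N N' _ _ t tT; have := le_lt_trans tT T0; rewrite ltNge normr_ge0.
have [c c0 hc] := gal_dist s.
(* With the error e / 8 for the truncated datum, the three errors add up to 7/8 of e. *)
pose e1 := e / (16 * expR (c * T)).
have E0 := expR_gt0 (c * T).
have e10 : 0 < e1 by rewrite divr_gt0// mulr_gt0.
have [J hJ] := hb_tail h e10.
have [N0 hN0] := gal_cauchy_finite s T0 (fun k => @trunc_ge J v k) (divr_gt0 e0 (ltr0n _ 8) : 0 < e / 8).
have key N N' : (N0 <= N)%N -> (N <= N')%N -> forall t : R, `|t| <= T ->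
    hb s (fun k => gal N v t k - gal N' v t k) e.
  move=> N0N NN' t tT.
  have h1 := hc N _ _ _ T hJ t tT.
  have h2 := hc N' _ _ _ T hJ t tT.
  have h3 := hN0 _ _ N0N NN' t tT.
  apply: hb_le (hb_ext _ (hbB (hbD h1 h3) h2)); last by move=> k /=; ring.
  have -> : expR (c * T) * e1 = e / 16 by rewrite /e1; field; rewrite gt_eqF.
  by lra.
exists N0 => N N' N0N N0N' t tT; have [NN'|N'N] := leqP N N'; first exact: key.
by apply: hb_ext (hbN (key N' N N0N' (ltnW N'N) t tT)) => k; rewrite opprB.
Qed.

Definition flow v t k : R := limn (fun N => gal N v t k).

Lemma hb_cauchy_cvg s v B t : hb s v B -> forall k, gal N v t k @[N --> \oo] --> flow v t k.
Proof.
move=> h k; suff : cvgn (fun N => gal N v t k) by [].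
apply/cauchy_cvgP/cauchy_exP => e e0.
have e2 : 0 < (e / 2) ^+ 2 by rewrite exprn_gt0// divr_gt0.
have [N0 hN0] := gal_cauchy `|t| h e2.
exists (gal N0 v t k); exists N0 => // N /= N0N.
have := hb_term k (hb_lower (leq0n s) (hN0 N0 N (leqnn _) N0N t (lexx _))).
rewrite expr0 mul1r /ball/= -[X in X <= _ -> _]real_normK ?num_real// => h2.
rewrite (@le_lt_trans _ _ (e / 2))//; last by rewrite ltr_pdivrMr// ltr_pMr// ltr1n.
by rewrite -(@ler_pXn2r _ 2)// nnegrE divr_ge0// ltW.
Qed.

Lemma flow_approx s v B T e : hb s v B -> 0 < e ->
  exists N0, forall N, (N0 <= N)%N -> forall t : R, `|t| <= T ->
    hb s (fun k => gal N v t k - flow v t k) e.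
Proof.
move=> h e0; have [N0 hN0] := gal_cauchy T h e0; exists N0 => N N0N t tT.
apply: (@hb_lim _ _ (fun N' k => gal N v t k - gal N' v t k)).
  by move=> k; apply: cvgB; [exact: cvg_cst|exact: hb_cauchy_cvg h k].
by exists N0 => // N' /= N0N'; exact: hN0.
Qed.

Lemma flow0 v B : hb 0 v B -> flow v 0 = v.
Proof.
move=> h; apply/funext => k; apply: cvg_lim => //.
by apply: cvg_near_cst; exists k.+1 => // N /= kN; rewrite gal0 trunc_lt.
Qed.

Lemma flow_bound s v B T : hb s v B ->
  exists B', forall t : R, `|t| <= T -> hb s (flow v t) B'.
Proof.
move=> h; have [c c0 hc] := gal_bound s; exists (expR (c * T) * B) => t tT.
apply: (@hb_lim _ _ (fun N => gal N v t)); first exact: hb_cauchy_cvg h.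
by apply: nearW => N; exact: hc.
Qed.

Lemma gal_continuous s N v t e : 0 < e ->
  exists2 d : R, 0 < d & forall u : R, `|u - t| < d ->
    hb s (fun k => gal N v u k - gal N v t k) e.
Proof.
move=> e0; pose f u := \sum_(0 <= k < N) wt k ^+ s * (gal N v u k - gal N v t k) ^+ 2.
have df (r : R) : is_derive r 1 f (\sum_(0 <= k < N) wt k ^+ s *
    (2 * ((gal N v r k - gal N v t k) * trunc N (bapp o (gal N v r)) k))).
  apply: is_derive1_sum => k kN; apply: is_derive1Z.
  have H := is_derive1B (is_derive_gal N v r k) (is_derive1C (gal N v t k) r).
  by have H2 := is_derive1M H H; apply: (is_derive_eq H2); ring.
have := is_derive1_continuous (df t).
move/cvgrPdist_lt => /(_ _ e0) /nbhs_ballP[d /= d0 hd].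
exists d => // u ut; have : `|f t - f u| < e by apply: hd; rewrite /ball/= distrC.
rewrite [f t]big1 ?sub0r ?normrN; last by move=> k _; rewrite subrr expr0n mulr0.
rewrite ger0_norm => [fe|]; last by apply: sumr_ge0 => k _; exact: (@hb_term_ge0 _ s (fun k => gal N v u k - gal N v t k)).
by apply: hb_le (ltW fe) (hb_finite _ _) => k Nk; rewrite !gal_ge// subrr.
Qed.

Lemma flow_continuous s v B : hb s v B -> forall (t : R) e, 0 < e ->
  exists2 d : R, 0 < d & forall u : R, `|u - t| < d ->
    hb s (fun k => flow v u k - flow v t k) e.
Proof.
move=> h t e e0; have e8 : 0 < e / 16 by rewrite divr_gt0.
have [N /(_ N (leqnn N)) hN] := flow_approx (`|t| + 1) h e8.
have [d d0 hd] := gal_continuous s N v t e8.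
exists (Num.min d 1) => [|u]; first by rewrite lt_min d0 ltr01.
rewrite lt_min => /andP[ud u1].
have ut : `|u| <= `|t| + 1.
  by rewrite -lerBlDl (le_trans (lerB_dist _ _))// ltW.
have h1 := hN u ut; have h2 := hd u ud.
have h3 := hN t (ler_wpDr ler01 (lexx _)).
apply: hb_le (hb_ext _ (hbD (hbB h2 h1) h3)); last by move=> k /=; ring.
by lra.
Qed.

(** The flow is only known as a limit, so the mean value inequality is applied to Galerkin solutions
    and N tends to infinity in each partial sum. The derivative lost is that of [bapp_bound]. *)
Lemma flow_derive s v B : hb s.+1 v B -> forall (t : R) e, 0 < e ->
  exists2 d : R, 0 < d & forall u : R, `|u - t| < d ->
    hb s (fun k => flow v u k - flow v t k - (u - t) * bapp o (flow v t) k)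
      (e * (u - t) ^+ 2).
Proof.
move=> h t e e0; have [c c0 hc] := bapp_bound o s.
(* Two errors e1 combine to 4 e1, which [bapp] multiplies by c. *)
pose e1 := e / (4 * (c + 1)).
have c1 : 0 < c + 1 by rewrite ltr_wpDl.
have e10 : 0 < e1 by rewrite divr_gt0// mulr_gt0.
have [N0 hN0] := flow_approx (`|t| + 1) h e10.
have [d d0 hd] := flow_continuous h t e10.
have [Bt hBt] := flow_bound `|t| h.
exists (Num.min d 1) => [|u]; first by rewrite lt_min d0 ltr01.
rewrite lt_min => /andP[ud u1] K.
pose Y := bapp o (flow v t).
apply: (@cvgr_to_le _ \oo _ _ (fun N => \sum_(0 <= k < K) wt k ^+ s *
    (gal N v u k - gal N v t k - (u - t) * Y k) ^+ 2)).
  apply: cvg_sum_nat => k; apply: cvgM; first exact: cvg_cst.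
  have H : gal N v u k - gal N v t k - (u - t) * Y k @[N --> \oo] -->
      flow v u k - flow v t k - (u - t) * Y k.
    by apply: cvgB; [apply: cvgB; exact: hb_cauchy_cvg h _|exact: cvg_cst].
  by have := cvgM H H; exact.
(* N >= K hides the truncation from the first K modes. *)
exists (maxn N0 K) => // N /=; rewrite geq_max => /andP[N0N KN].
apply: (sum_sqr_mvt (dx := fun r => trunc N (bapp o (gal N v r)))).
- by move=> k; exact: wtX_ge0.
- by move=> r k; exact: is_derive_gal.
move=> r rt.
have rd : `|r - t| < d by exact: le_lt_trans rt ud.
have rT : `|r| <= `|t| + 1.
  by rewrite -lerBlDl (le_trans (lerB_dist _ _))// (le_trans rt)// ltW.
have h1 := hbD (hN0 N N0N r rT) (hd r rd).
have h2 : hb s.+1 (fun k => gal N v r k - flow v t k) (4 * e1).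
  by apply: hb_le (hb_ext _ h1); [lra|move=> k /=; ring].
have := hc _ _ h2 K.
have -> : c * (4 * e1) = (c / (c + 1)) * e by rewrite /e1; field; rewrite gt_eqF.
move=> h3; apply: le_trans (le_trans h3 _); last first.
  by rewrite ler_piMl ?(ltW e0)// ler_pdivrMr// mul1r lerDl.
apply: ler_sum_nat => k /andP[_ kK].
have [B1 hB1] := hb_finite0 (fun k => @gal_ge N v r k).
by rewrite (bappB _ hB1 (hb_lower (leq0n _) (hBt t (lexx _)))) trunc_lt// (leq_trans kK).
Qed.

End Galerkin.

(** * Uniqueness for the coefficient system *)

Section SequenceUniqueness.
Variable R : realType.
Implicit Types (x y v : nat -> R) (B T e t u : R).

Lemma hb_sub_trunc s M x B : hb s.+1 x B ->
  hb s (fun k => x k - trunc M x k) ((wt M)^-1 * B).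
Proof.
move=> h K; have [KM|MK] := leqP K M.
  rewrite big_nat_cond big1; first by rewrite mulr_ge0 ?invr_ge0// (hb_ge0 h).
  move=> k /andP[/andP[_ kK] _].
  by rewrite trunc_lt ?(leq_trans kK)// subrr expr0n mulr0.
rewrite (@big_cat_nat _ _ _ M 0 K) ?(ltnW MK)//= [X in X + _]big_nat_cond big1; last first.
  by move=> k /andP[/andP[_ kK] _]; rewrite trunc_lt// subrr expr0n mulr0.
rewrite add0r -[wt M]expr1.
rewrite (eq_big_nat _ _ (F2 := fun k => wt k ^+ s * x k ^+ 2)).
  by apply: hb_sum_ge; rewrite addn1.
by move=> k /andP[Mk _]; rewrite trunc_ge// subr0.
Qed.

Lemma nat_le_bounded_eq0 (a C : R) : 0 <= a -> (forall M, wt M * a <= C) -> a = 0.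
Proof.
move=> a0 h; apply/eqP; rewrite eq_le a0 andbT leNgt; apply/negP => ap.
have C0 : 0 <= C by apply: le_trans (h 0%N); rewrite mulr_ge0.
have := archi_boundP (divr_ge0 C0 a0); set N := Num.Def.archi_bound _.
rewrite ltr_pdivrMr// ltNge => /negP; apply.
apply: le_trans (h N); apply: ler_wpM2r => //.
have [->|] : (N%:R : R) = 0 \/ 1 <= (N%:R : R).
- by case: N => [|n]; [left|right; rewrite ler1n].
- by rewrite wt_ge0.
- by rewrite /wt => h1; nra.
Qed.

(** The h^2 bound is spent twice: one derivative pays for [bapp], the other gives the factor
    [(wt M)^-1] that makes the forcing by the modes beyond M vanish in the limit. *)
Lemma bapp_unique (o : bandop R) (Z : R -> nat -> R) T B : 0 <= T ->
  (forall t, 0 <= t <= T -> hb 2 (Z t) B) ->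
  (forall k, {within `[0, T], continuous (Z ^~ k)}) ->
  (forall t k, 0 < t < T -> is_derive t 1 (Z ^~ k) (bapp o (Z t) k)) ->
  (forall k, Z 0 k = 0) -> forall k, Z T k = 0.
Proof.
move=> T0 hZ cZ dZ Z0 k.
have [c c0 hc] := energy_estimate_oo o 0.
have [c1 c10 hc1] := bapp_bound o 0.
have B0 : 0 <= B := hb_ge0 (hZ 0 (introT andP (conj (lexx _) T0))).
suff : Z T k ^+ 2 = 0 by move/eqP; rewrite sqrf_eq0 => /eqP.
pose C := expR (c * T) * (c1 * B * T).
have C0 : 0 <= C by rewrite !mulr_ge0 ?expR_ge0.
(* The first summand serves M <= k, where the truncation does not see mode k; C serves M > k. *)
apply: (@nat_le_bounded_eq0 _ (wt k * Z T k ^+ 2 + C)); first exact: sqr_ge0.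
move=> M; have [Mk|kM] := leqP M k.
  by apply: ler_wpDr => //; apply: ler_wpM2r; rewrite ?sqr_ge0// wt_homo.
apply: ler_wpDl; first by rewrite mulr_ge0 ?sqr_ge0.
pose g t j := bapp o (fun i => Z t i - trunc M (Z t) i) j.
pose G := c1 * ((wt M)^-1 * B).
have G0 : 0 <= G by rewrite !mulr_ge0 ?invr_ge0.
have trE t j : (j < M)%N -> trunc M (Z t) j = Z t j by exact: trunc_lt.
have Zfun j : (j < M)%N -> (fun t => trunc M (Z t) j) = Z ^~ j.
  by move=> jM; apply/funext => t; exact: trE.
have gP t : 0 < t < T -> hb 0 (g t) G.
  move=> /andP[t0 tT]; apply: hc1; apply: hb_sub_trunc; apply: hZ.
  by rewrite !ltW.
have dtr t j : 0 < t < T -> (j < M)%N ->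
    is_derive t 1 (fun s => trunc M (Z s) j) (bapp o (trunc M (Z t)) j + g t j).
  move=> t0T jM; rewrite Zfun// /g.
  have t0T' : 0 <= t <= T by move: t0T => /andP[t0 tT]; rewrite !ltW.
  have h0 := hb_lower (leq0n _) (hZ t t0T').
  rewrite (bappB _ h0 (hb_trunc M h0)) addrC subrK; exact: dZ.
have := hc M (fun t => trunc M (Z t)) g T G T0 G0 (fun t j => @trunc_ge _ M (Z t) j) dtr _ _.
have -> : energy 0 M (trunc M (Z 0)) = 0.
  rewrite /energy big_nat_cond big1// => j /andP[/andP[_ jM] _].
  by rewrite trE// Z0 expr0n mulr0.
rewrite add0r => H; have {}H : energy 0 M (trunc M (Z T)) <= expR (c * T) * (G * T).
  apply: H => [j jM|t t0T]; first by rewrite Zfun.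
  exact: gP.
have h2 : Z T k ^+ 2 <= expR (c * T) * (G * T).
  apply: le_trans H; rewrite /energy (@big_cat_nat _ _ _ k 0 M) ?(ltnW kM)//=.
  rewrite (@big_ltn _ _ _ k)//= trE// expr0 mul1r addrCA lerDl addr_ge0//.
    by apply: sumr_ge0 => j _; rewrite mul1r sqr_ge0.
  by apply: sumr_ge0 => j _; rewrite mul1r sqr_ge0.
have := ler_wpM2l (wt_ge0 R M) h2.
have -> // : wt M * (expR (c * T) * (G * T)) = C.
by rewrite /G /C; field; rewrite gt_eqF.
Qed.

(** Compactness of the segment, with B tending to infinity as the parameter of the covering;
    monotonicity in B lets finitely many local bounds merge. *)
Lemma locally_bounded_segment (P : R -> R -> Prop) T :
  (forall u B B', B <= B' -> P u B -> P u B') ->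
  (forall t, 0 <= t <= T -> exists2 d : R, 0 < d &
    exists B, forall u, 0 <= u <= T -> `|u - t| < d -> P u B) ->
  exists B, forall u, 0 <= u <= T -> P u B.
Proof.
move=> mono loc.
have /compact_near_coveringP cT := @segment_compact R 0 T.
have /= := cT R (+oo)%R (fun B u => 0 <= u <= T -> P u B) _.
have H : forall x : R, `[0, T]%classic x ->
    \forall x' \near x & i \near +oo, (0 <= x' <= T -> P x' i).
  move=> x /=; rewrite in_itv/= => /loc[d d0 [B hB]].
  exists (ball x d, [set i | B <= i]) => /=.
    split; first exact: nbhsx_ballx.
    by exists B; split; [exact: num_real|move=> i /ltW].
  move=> [u i] /= [xu Bi] uT; apply: mono Bi (hB u uT _).
  by move: xu; rewrite /ball/= distrC.
move=> /(_ _ H) [B [_ hB]].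
exists (B + 1) => u uT; apply: (hB (B + 1)) => //; first by rewrite ltrDl.
Qed.

End SequenceUniqueness.

(** * Integrals on segments and trigonometric orthogonality *)

Section Integrals.
Variable R : realType.
Implicit Types (f g F : R -> R) (D : set R) (M a b x w : R).
Notation mu := (@lebesgue_measure R).

Lemma bounded_integrable D f M : measurable D -> (mu D < +oo)%E ->
  measurable_fun D f -> (forall x, D x -> `|f x| <= M) -> mu.-integrable D (EFin \o f).
Proof.
move=> mD Dfin mf fM; apply: measurable_bounded_integrable => //.
exists M; split; first exact: num_real.
by move=> M' MM' x Dx /=; exact: le_trans (fM x Dx) (ltW MM').
Qed.

Lemma continuousD1 f g : continuous f -> continuous g -> continuous (fun x => f x + g x).
Proof. by move=> cf cg x; apply: continuousD; [exact: cf|exact: cg]. Qed.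

Lemma continuousM1 f g : continuous f -> continuous g -> continuous (fun x => f x * g x).
Proof. by move=> cf cg x; apply: continuousM; [exact: cf|exact: cg]. Qed.

Lemma continuousZ1 f (c : R) : continuous f -> continuous (fun x => c * f x).
Proof. by move=> cf; apply: continuousM1 => //; exact: cst_continuous. Qed.

Lemma Rintegrable_scale D f c : measurable D -> mu.-integrable D (EFin \o f) ->
  mu.-integrable D (EFin \o (fun x => c * f x)).
Proof.
move=> mD fi; rewrite (_ : EFin \o _ = fun x => (c%:E * (EFin \o f) x)%E)//.
exact: integrableZl.
Qed.

Lemma Rintegrable_add D f g : measurable D -> mu.-integrable D (EFin \o f) ->
  mu.-integrable D (EFin \o g) -> mu.-integrable D (EFin \o (fun x => f x + g x)).
Proof.
move=> mD fi gi.
rewrite (_ : EFin \o _ = ((EFin \o f) \+ (EFin \o g))%E)//; exact: integrableD.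
Qed.

Lemma Rintegral_bound D f M : measurable D -> (mu D < +oo)%E ->
  measurable_fun D f -> (forall x, D x -> `|f x| <= M) ->
  `|\int[mu]_(x in D) f x| <= M * fine (mu D).
Proof.
move=> mD Dfin mf fM; have fi := bounded_integrable mD Dfin mf fM.
apply: (@le_trans _ _ (\int[mu]_(x in D) `|f x|)); first exact: le_normr_Rintegral.
rewrite -Rintegral_cst//; apply: le_Rintegral => //.
- apply: (bounded_integrable (M := M) mD Dfin) => [|x Dx].
    exact: measurableT_comp mf.
  by rewrite normr_id fM.
- by apply: (bounded_integrable (M := `|M|) mD Dfin).
Qed.

Lemma itv_cc_fin a b : (mu `[a, b]%classic < +oo)%E.
Proof. exact/compact_finite_measure/segment_compact. Qed.

Lemma fine_itv_cc a b : a <= b -> fine (mu `[a, b]%classic) = b - a.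
Proof.
move=> ab; rewrite lebesgue_measure_itv/= lte_fin; case: ltP => //= ba.
by apply/esym/eqP; rewrite subr_eq0 eq_le ab ba.
Qed.

Lemma continuous_integrable f a b : continuous f -> mu.-integrable `[a, b] (EFin \o f).
Proof.
move=> cf; apply: continuous_compact_integrable; first exact: segment_compact.
exact: continuous_subspaceT.
Qed.

Lemma Rintegral_contD f g a b : continuous f -> continuous g ->
  \int[mu]_(x in `[a, b]) (f x + g x) =
  \int[mu]_(x in `[a, b]) f x + \int[mu]_(x in `[a, b]) g x.
Proof. by move=> cf cg; rewrite RintegralD//; exact: continuous_integrable. Qed.

Lemma Rintegral_contB f g a b : continuous f -> continuous g ->
  \int[mu]_(x in `[a, b]) (f x - g x) =
  \int[mu]_(x in `[a, b]) f x - \int[mu]_(x in `[a, b]) g x.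
Proof. by move=> cf cg; rewrite RintegralB//; exact: continuous_integrable. Qed.

Lemma Rintegral_contZ f a b c : continuous f ->
  \int[mu]_(x in `[a, b]) (c * f x) = c * \int[mu]_(x in `[a, b]) f x.
Proof. by move=> cf; rewrite RintegralZl//; exact: continuous_integrable. Qed.

Lemma Rintegral_FTC F f a b : a <= b -> (forall x, is_derive x 1 F (f x)) ->
  continuous f -> \int[mu]_(x in `[a, b]) f x = F b - F a.
Proof.
move=> ab dF cf; have [ab'|] := ltP a b; last first.
  move=> ba; have -> : b = a by apply/eqP; rewrite eq_le ab ba.
  by rewrite set_itv1 Rintegral_set1 subrr.
have cF : continuous F by move=> x; exact: is_derive1_continuous (dF x).
rewrite /Rintegral (continuous_FTC2 (F := F) ab').
- by rewrite -EFinB.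
- exact: continuous_subspaceT.
- split; [by move=> x _; exact: ex_derive| |].
  + exact/cvg_at_right_filter/cF.
  + exact/cvg_at_left_filter/cF.
- by move=> x _; rewrite derive1E; apply: derive_val.
Qed.

Lemma is_derive1_sinZ w x : is_derive x 1 (fun t => sin (w * t)) (w * cos (w * x)).
Proof.
have H := is_derive1_pcomp (is_derive_sin _) (is_derive1Z w (is_derive_id x 1)).
by apply: (is_derive_eq H); rewrite mulr1 mulrC.
Qed.

Lemma is_derive1_cosZ w x : is_derive x 1 (fun t => cos (w * t)) (- w * sin (w * x)).
Proof.
have H := is_derive1_pcomp (is_derive_cos _) (is_derive1Z w (is_derive_id x 1)).
by apply: (is_derive_eq H); rewrite mulr1 mulrC mulrN mulNr.
Qed.

Lemma continuous_cosZ w : continuous (fun t => cos (w * t)).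
Proof. by move=> x; exact: is_derive1_continuous (is_derive1_cosZ w x). Qed.

Lemma continuous_sinZ w : continuous (fun t => sin (w * t)).
Proof. by move=> x; exact: is_derive1_continuous (is_derive1_sinZ w x). Qed.

Lemma sin_natpi n : sin (n%:R * pi) = 0 :> R.
Proof.
elim: n => [|n IH]; first by rewrite mul0r sin0.
by rewrite -addn1 natrD mulrDl mul1r sinD IH sinpi mul0r mulr0 addr0.
Qed.

Lemma Rintegral_cosZ w : w != 0 -> sin (w * pi) = 0 ->
  \int[mu]_(x in `[- pi, pi]) cos (w * x) = 0.
Proof.
move=> w0 s0.
have pipi : - pi <= pi :> R by have := pi_gt0 R; lra.
have dF x : is_derive x 1 (fun x => w^-1 * sin (w * x)) (cos (w * x)).
  have H := is_derive1Z w^-1 (is_derive1_sinZ w x).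
  by apply: (is_derive_eq H); rewrite mulrA mulVf// mul1r.
rewrite (Rintegral_FTC pipi dF); last exact: continuous_cosZ.
by rewrite mulrN sinN s0 oppr0 mulr0 subrr.
Qed.

Lemma Rintegral_sinZ w : \int[mu]_(x in `[- pi, pi]) sin (w * x) = 0.
Proof.
have pipi : - pi <= pi :> R by have := pi_gt0 R; lra.
have [->|w0] := eqVneq w 0.
  under eq_Rintegral do rewrite mul0r sin0.
  by rewrite Rintegral_cst// mul0r.
have dF x : is_derive x 1 (fun x => - w^-1 * cos (w * x)) (sin (w * x)).
  have H := is_derive1Z (- w^-1) (is_derive1_cosZ w x).
  by apply: (is_derive_eq H); rewrite mulrA mulrNN mulVf// mul1r.
rewrite (Rintegral_FTC pipi dF); last exact: continuous_sinZ.
by rewrite mulrN cosN subrr.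
Qed.

Lemma cosMcos x y : cos x * cos y = 2^-1 * (cos (x - y) + cos (x + y)) :> R.
Proof. by rewrite cosB cosD; field. Qed.

Lemma sinMcos x y : sin x * cos y = 2^-1 * (sin (x + y) + sin (x - y)) :> R.
Proof. by rewrite sinB sinD; field. Qed.

Lemma sinMsin x y : sin x * sin y = 2^-1 * (cos (x - y) - cos (x + y)) :> R.
Proof. by rewrite cosB cosD; field. Qed.

Lemma sin_natBpi k n : sin ((k%:R - n%:R) * pi) = 0 :> R.
Proof. by rewrite mulrBl sinB !sin_natpi mul0r mulr0 subrr. Qed.

Lemma Rintegral_cos_natB k n :
  \int[mu]_(x in `[- pi, pi]) cos ((k%:R - n%:R) * x) = 2 * pi * (k == n)%:R.
Proof.
have [->|kn] := eqVneq k n.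
  under eq_Rintegral do rewrite subrr mul0r cos0.
  rewrite Rintegral_cst// mul1r fine_itv_cc ?mulr1; first by ring.
  by have := pi_gt0 R; lra.
rewrite mulr0 Rintegral_cosZ ?sin_natBpi//.
by rewrite subr_eq0 eqr_nat.
Qed.

Lemma Rintegral_cos_natD k n :
  \int[mu]_(x in `[- pi, pi]) cos ((k%:R + n%:R) * x) = 2 * pi * ((k + n)%N == 0%N)%:R.
Proof.
have := Rintegral_cos_natB (k + n) 0.
by rewrite subr0 natrD.
Qed.

Lemma Rintegral_cosMcos k n :
  \int[mu]_(x in `[- pi, pi]) (cos (k%:R * x) * cos (n%:R * x)) =
    pi * (k == n)%:R * (1 + (n == 0%N)%:R).
Proof.
under eq_Rintegral do rewrite cosMcos -mulrBl -mulrDl.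
rewrite Rintegral_contZ; last by move=> x; apply: continuousD; exact: continuous_cosZ.
rewrite (Rintegral_contD _ _ (@continuous_cosZ _) (@continuous_cosZ _)).
rewrite Rintegral_cos_natB Rintegral_cos_natD addn_eq0.
have [->|kn] := eqVneq k n.
  by case: (n == 0%N) => /=; field.
have -> : (k == 0%N) && (n == 0%N) = false.
  by apply/negP => /andP[/eqP k0 /eqP n0]; rewrite k0 n0 eqxx in kn.
by rewrite !mulr0 addr0 mul0r mulr0.
Qed.

Lemma Rintegral_sinMcos k n :
  \int[mu]_(x in `[- pi, pi]) (sin (k%:R * x) * cos (n%:R * x)) = 0.
Proof.
under eq_Rintegral do rewrite sinMcos -mulrBl -mulrDl.
rewrite Rintegral_contZ; last by move=> x; apply: continuousD; exact: continuous_sinZ.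
rewrite (Rintegral_contD _ _ (@continuous_sinZ _) (@continuous_sinZ _)).
by rewrite !Rintegral_sinZ addr0 mulr0.
Qed.

Lemma Rintegral_sinMsin k n :
  \int[mu]_(x in `[- pi, pi]) (sin (k%:R * x) * sin (n%:R * x)) =
    pi * (k == n)%:R * (n != 0%N)%:R.
Proof.
under eq_Rintegral do rewrite sinMsin -mulrBl -mulrDl.
rewrite Rintegral_contZ; last by move=> x; apply: continuousB; exact: continuous_cosZ.
rewrite (Rintegral_contB _ _ (@continuous_cosZ _) (@continuous_cosZ _)).
rewrite Rintegral_cos_natB Rintegral_cos_natD addn_eq0.
have [->|kn] := eqVneq k n.
  by case: (n == 0%N) => /=; field.
have -> : (k == 0%N) && (n == 0%N) = false.
  by apply/negP => /andP[/eqP k0 /eqP n0]; rewrite k0 n0 eqxx in kn.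
by rewrite !mulr0 subr0 mul0r mulr0.
Qed.

End Integrals.

(** * Fourier series *)

Section FourierSeries.
Variable R : realType.
Implicit Types (a b : nat -> R) (A B M e x y t : R) (s k n N : nat).
Notation mu := (@lebesgue_measure R).

Lemma continuous_measurable (D : set R) (f : R -> R) : continuous f -> measurable_fun D f.
Proof. by move=> cf; apply: measurable_funTS; exact: continuous_measurable_fun. Qed.

Definition l1 a A := forall K, \sum_(0 <= k < K) `|a k| <= A.

Lemma hb_l1 a B : hb 1 a B -> l1 a (Num.sqrt (3 * B)).
Proof. by move=> h; apply: sum_norm_sqr_le => K; exact: hb_sum_norm h. Qed.

(** Up to a sign and the exchange of sine and cosine, the coefficients of the derivative. *)
Definition dk a k : R := k%:R * a k.

Lemma hb_dk s a B : hb s.+1 a B -> hb s (dk a) B.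
Proof.
rewrite -[B in X in _ -> X]mul1r; apply: hb_dom => // k; rewrite mul1r /dk exprMn (exprSr (wt k)).
rewrite -mulrA; apply: ler_wpM2l => //; apply: ler_wpM2r; rewrite ?sqr_ge0//.
by rewrite /wt lerDr.
Qed.

Lemma l1_dk a B : hb 2 a B -> l1 (dk a) (Num.sqrt (3 * B)).
Proof. by move=> h; exact/hb_l1/hb_dk. Qed.

Lemma l1N a A : l1 a A -> l1 (fun k => - a k) A.
Proof. by move=> h K; under eq_bigr do rewrite normrN; exact: h. Qed.

Lemma l1D a b A B : l1 a A -> l1 b B -> l1 (fun k => `|a k| + `|b k|) (A + B).
Proof.
move=> ha hb K; under eq_bigr do rewrite ger0_norm ?addr_ge0//.
by rewrite big_split/= lerD.
Qed.

Definition trg a b x k : R := a k * cos (k%:R * x) + b k * sin (k%:R * x).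

Lemma norm_cos_le1 x : `|cos x| <= 1.
Proof. exact: cos_max. Qed.

Lemma norm_sin_le1 x : `|sin x| <= 1.
Proof. by rewrite ler_norml sin_geN1 sin_le1. Qed.

Lemma continuous_trg a b k : continuous (fun x => trg a b x k).
Proof.
move=> x; exact: (is_derive1_continuous
  (is_derive1D (is_derive1Z _ (is_derive1_cosZ _ x)) (is_derive1Z _ (is_derive1_sinZ _ x)))).
Qed.

Lemma trg_bound a b x k : `|trg a b x k| <= `|a k| + `|b k|.
Proof.
apply: le_trans (ler_normD _ _) _; rewrite !normrM.
by apply: lerD; rewrite ler_piMr// ?norm_cos_le1 ?norm_sin_le1.
Qed.

Definition FS a b x : R := limn (series (trg a b x)).

Lemma trg_l1 a b A B x : l1 a A -> l1 b B -> l1 (trg a b x) (A + B).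
Proof.
move=> ha hb K; apply: le_trans (lerD (ha K) (hb K)).
by rewrite -big_split/=; apply: ler_sum => k _; exact: trg_bound.
Qed.

Lemma FS_cvg a b A B x : l1 a A -> l1 b B -> series (trg a b x) @ \oo --> FS a b x.
Proof. by move=> ha hb; exact: sum_norm_is_cvg (trg_l1 x ha hb). Qed.

Lemma FS_norm a b A B x : l1 a A -> l1 b B -> `|FS a b x| <= A + B.
Proof. by move=> ha hb; exact: sum_norm_lim_le (trg_l1 x ha hb). Qed.

Lemma FSD a b a' b' A B A' B' x : l1 a A -> l1 b B -> l1 a' A' -> l1 b' B' ->
  FS (fun k => a k + a' k) (fun k => b k + b' k) x = FS a b x + FS a' b' x.
Proof.
move=> ha hb ha' hb'; rewrite /FS -series_limD.
- by congr (limn (series _)); apply/funext => k; rewrite /trg; ring.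
- exact: (FS_cvg (x := x) ha hb).
- exact: (FS_cvg (x := x) ha' hb').
Qed.

Lemma FSZ a b A B x c : l1 a A -> l1 b B ->
  FS (fun k => c * a k) (fun k => c * b k) x = c * FS a b x.
Proof.
move=> ha hb; rewrite /FS -series_limZ.
- by congr (limn (series _)); apply/funext => k; rewrite /trg; ring.
- exact: (FS_cvg (x := x) ha hb).
Qed.

Lemma FSB a b a' b' A B A' B' x : l1 a A -> l1 b B -> l1 a' A' -> l1 b' B' ->
  FS (fun k => a k - a' k) (fun k => b k - b' k) x = FS a b x - FS a' b' x.
Proof.
move=> ha hb ha' hb'; rewrite /FS -series_limB.
- by congr (limn (series _)); apply/funext => k; rewrite /trg; ring.
- exact: (FS_cvg (x := x) ha hb).
- exact: (FS_cvg (x := x) ha' hb').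
Qed.

(** The Weierstrass test: N0 is taken from the tail of the sum of [|a k| + |b k|] and so serves all
    x at once. *)
Lemma FS_tail a b A B e : l1 a A -> l1 b B -> 0 < e ->
  exists N0, forall N, (N0 <= N)%N -> forall x,
    `|FS a b x - \sum_(0 <= k < N) trg a b x k| <= e.
Proof.
move=> ha hb e0; pose u k := `|a k| + `|b k|.
have cu := sum_norm_is_cvg (l1D ha hb); rewrite -/u in cu.
move/cvgrPdist_le/(_ _ e0): (cu) => [N0 _ hN0].
exists N0 => N N0N x.
have c : `|series (trg a b x) M - \sum_(0 <= k < N) trg a b x k| @[M --> \oo] -->
    `|FS a b x - \sum_(0 <= k < N) trg a b x k|.
  by apply: cvg_norm; apply: cvgB; [exact: (FS_cvg (x := x) ha hb)|exact: cvg_cst].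
apply: (cvgr_to_le c); exists N => // M /= NM.
apply: le_trans (hN0 N N0N); apply: le_trans (ler_norm _).
rewrite lerBrDr; apply: le_trans (nondecreasing_cvgn_le _ cu M); last first.
  by apply: nondecreasing_series => k _ _; rewrite addr_ge0.
rewrite /series/= !(@big_cat_nat _ _ _ N 0 M)//= (addrC (bigop _ _ _)) addrK.
rewrite [leLHS]addrC lerD2l; apply: le_trans (ler_norm_sum _ _ _) _.
by apply: ler_sum => k _; exact: trg_bound.
Qed.

Lemma cos_dist x y : `|cos x - cos y| <= `|x - y|.
Proof.
have [c _ ->] := MVT_dist y x (fun s : R => is_derive_cos s).
by rewrite normrM normrN ler_piMl// norm_sin_le1.
Qed.

Lemma sin_dist x y : `|sin x - sin y| <= `|x - y|.
Proof.
have [c _ ->] := MVT_dist y x (fun s : R => is_derive_sin s).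
by rewrite normrM ler_piMl// norm_cos_le1.
Qed.

Lemma cos_taylor x y : `|cos x - cos y - (x - y) * - sin y| <= (x - y) ^+ 2.
Proof.
have [c cy ->] := MVT_dist y x (fun s : R => is_derive_cos s).
rewrite mulrC -mulrBr normrM -real_normK ?num_real// expr2 ler_wpM2l//.
by rewrite opprK addrC (le_trans (sin_dist _ _))// distrC.
Qed.

Lemma sin_taylor x y : `|sin x - sin y - (x - y) * cos y| <= (x - y) ^+ 2.
Proof.
have [c cy ->] := MVT_dist y x (fun s : R => is_derive_sin s).
rewrite mulrC -mulrBr normrM -real_normK ?num_real// expr2 ler_wpM2l//.
by rewrite (le_trans (cos_dist _ _)).
Qed.

Lemma FS_lipschitz a b A B A' B' x y : l1 a A -> l1 b B ->
  l1 (dk a) A' -> l1 (dk b) B' -> `|FS a b x - FS a b y| <= (A' + B') * `|x - y|.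
Proof.
move=> ha hb ha' hb'; rewrite /FS -series_limB; last 2 first.
- exact: (FS_cvg (x := x) ha hb).
- exact: (FS_cvg (x := y) ha hb).
apply: sum_norm_lim_le => K.
apply: le_trans (ler_wpM2r (normr_ge0 _) (lerD (ha' K) (hb' K))).
rewrite -big_split/= mulr_suml; apply: ler_sum => k _.
have -> : trg a b x k - trg a b y k = a k * (cos (k%:R * x) - cos (k%:R * y)) +
   b k * (sin (k%:R * x) - sin (k%:R * y)) by rewrite /trg; ring.
apply: le_trans (ler_normD _ _) _; rewrite mulrDl; apply: lerD.
- rewrite !normrM (_ : _ * _ * _ = `|a k| * (`|k%:R| * `|x - y|)); last by ring.
  apply: ler_wpM2l => //.
  by apply: le_trans (cos_dist _ _) _; rewrite -mulrBr normrM.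
- rewrite !normrM (_ : _ * _ * _ = `|b k| * (`|k%:R| * `|x - y|)); last by ring.
  apply: ler_wpM2l => //.
  by apply: le_trans (sin_dist _ _) _; rewrite -mulrBr normrM.
Qed.

Lemma continuous_FS a b A B : hb 2 a A -> hb 2 b B -> continuous (FS a b).
Proof.
move=> ha hb x; apply/cvgrPdist_le => e e0.
have ha' := hb_l1 (hb_lower (isT : 1 <= 2)%N ha).
have hb' := hb_l1 (hb_lower (isT : 1 <= 2)%N hb).
have L := FS_lipschitz x _ ha' hb' (l1_dk ha) (l1_dk hb).
set C := Num.sqrt _ + Num.sqrt _ in L.
have C0 : 0 <= C by rewrite addr_ge0 ?sqrtr_ge0.
have C1 : 0 < C + 1 by rewrite ltr_wpDl.
exists (e / (C + 1)) => /=; first by rewrite divr_gt0.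
move=> y /=; rewrite /ball/= ltr_pdivlMr// => xy.
apply: le_trans (L y) _; apply: le_trans (ltW xy).
by rewrite mulrC ler_wpM2l// lerDl.
Qed.

Lemma is_derive1_littleo (f : R -> R) (x l : R) :
  (forall e : R, 0 < e -> exists2 d : R, 0 < d & forall y : R, `|y - x| < d ->
    `|f y - f x - (y - x) * l| <= e * `|y - x|) -> is_derive x 1 f l.
Proof.
move=> h.
have H : (h^-1 *: (f (h *: 1 + x) - f x)) @[h --> 0^'] --> l.
  apply/cvgrPdist_le => e e0; have [d d0 hd] := h e e0; exists d => //=.
  move=> z /=; rewrite /ball/= sub0r normrN => ze z0.
  rewrite /GRing.scale/= mulr1 -(ler_pM2l (_ : 0 < `|z|)) ?normr_gt0//.
  rewrite -normrM mulrBr mulrA mulfV// mul1r distrC.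
  by have := hd (z + x); rewrite addrK (mulrC e) => /(_ ze).
have D : derivable f x 1 by apply/cvg_ex; exists l.
by apply: DeriveDef => //; exact: cvg_lim H.
Qed.

Lemma is_derive1_quadratic (f : R -> R) x d C :
  (forall y, `|f y - f x - (y - x) * d| <= C * (y - x) ^+ 2) -> is_derive x 1 f d.
Proof.
move=> h; have C0 : 0 <= C.
  by have := le_trans (normr_ge0 _) (h (x + 1)); rewrite addrAC subrr add0r expr1n mulr1.
have C1 : 0 < C + 1 by rewrite ltr_wpDl.
apply: is_derive1_littleo => e e0; exists (e / (C + 1)); first by rewrite divr_gt0.
move=> y; rewrite ltr_pdivlMr// => ye; apply: le_trans (h y) _.
rewrite -real_normK ?num_real// expr2 mulrA; apply: ler_wpM2r => //.
by apply: le_trans (ltW ye); rewrite mulrC ler_wpM2l// lerDl.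
Qed.

(** Second order Taylor bounds in each term sum to a quadratic remainder, because k^2 a_k and k^2
    b_k are summable; this is where h^3 is needed. *)
Lemma is_derive_FS a b A B x : hb 3 a A -> hb 3 b B ->
  is_derive x 1 (FS a b) (FS (dk b) (fun k => - dk a k) x).
Proof.
move=> ha hb.
have la := hb_l1 (hb_lower (isT : 1 <= 3)%N ha).
have lb := hb_l1 (hb_lower (isT : 1 <= 3)%N hb).
have la1 := l1N (l1_dk (hb_lower (isT : 2 <= 3)%N ha)).
have lb1 := l1_dk (hb_lower (isT : 2 <= 3)%N hb).
have la2 := l1_dk (hb_dk ha).
have lb2 := l1_dk (hb_dk hb).
apply: (@is_derive1_quadratic _ _ _ (Num.sqrt (3 * A) + Num.sqrt (3 * B))) => y.
rewrite /FS -series_limB; last 2 first.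
- exact: (FS_cvg (x := y) la lb).
- exact: (FS_cvg (x := x) la lb).
rewrite -series_limZ; last exact: (FS_cvg (x := x) lb1 la1).
rewrite -series_limB; last 2 first.
- by apply: is_cvg_seriesB; [exact: (FS_cvg (x := y) la lb)|exact: (FS_cvg (x := x) la lb)].
- by apply: (is_cvg_seriesZ (k := y - x)); exact: (FS_cvg (x := x) lb1 la1).
apply: sum_norm_lim_le => K.
apply: le_trans (ler_wpM2r (sqr_ge0 _) (lerD (la2 K) (lb2 K))).
rewrite -big_split/= mulr_suml; apply: ler_sum => k _.
set c := k%:R : R; have E : c * y - c * x = c * (y - x) by ring.
have -> : trg a b y k - trg a b x k - (y - x) * trg (dk b) (fun k => - dk a k) x k =
  a k * (cos (c * y) - cos (c * x) - (c * y - c * x) * - sin (c * x)) +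
  b k * (sin (c * y) - sin (c * x) - (c * y - c * x) * cos (c * x)).
  by rewrite /trg /dk -/c; ring.
apply: le_trans (ler_normD _ _) _; rewrite [leRHS]mulrDl; apply: lerD; rewrite normrM.
- apply: le_trans (ler_wpM2l (normr_ge0 _) (cos_taylor _ _)) _.
  by rewrite E exprMn /dk -/c !normrM (ger0_norm (ler0n _ _)) -/c le_eqVlt;
    apply/orP; left; apply/eqP; ring.
- apply: le_trans (ler_wpM2l (normr_ge0 _) (sin_taylor _ _)) _.
  by rewrite E exprMn /dk -/c !normrM (ger0_norm (ler0n _ _)) -/c le_eqVlt;
    apply/orP; left; apply/eqP; ring.
Qed.

Lemma cos_natD2pi k x : cos (k%:R * (x + 2 * pi)) = cos (k%:R * x) :> R.
Proof.
have -> : k%:R * (x + 2 * pi) = k%:R * x + (pi *+ 2) *+ k :> R.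
  by rewrite mulrDr -[(pi *+ 2) *+ k]mulr_natl -(mulr_natl pi).
by rewrite (periodicn (@cosD2pi R)).
Qed.

Lemma sin_natD2pi k x : sin (k%:R * (x + 2 * pi)) = sin (k%:R * x) :> R.
Proof.
have -> : k%:R * (x + 2 * pi) = k%:R * x + (pi *+ 2) *+ k :> R.
  by rewrite mulrDr -[(pi *+ 2) *+ k]mulr_natl -(mulr_natl pi).
by rewrite (periodicn (@sinD2pi R)).
Qed.

Lemma periodic_FS a b : periodic2pi (FS a b).
Proof.
by move=> x; rewrite /FS; congr (limn (series _)); apply/funext => k;
  rewrite /trg cos_natD2pi sin_natD2pi.
Qed.

(** Uniform convergence on a set of finite measure. Taking g to be a cosine or a sine recovers
    coefficients; taking the cut-off cotangent gives the Hilbert transform. *)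
Lemma cvg_Rintegral_FS a b A B (D : set R) (g : R -> R) M :
  measurable D -> (mu D < +oo)%E -> measurable_fun D g ->
  (forall x, D x -> `|g x| <= M) -> hb 2 a A -> hb 2 b B ->
  (\sum_(0 <= k < N) (a k * \int[mu]_(x in D) (g x * cos (k%:R * x)) +
                      b k * \int[mu]_(x in D) (g x * sin (k%:R * x)))) @[N --> \oo]
    --> \int[mu]_(x in D) (g x * FS a b x).
Proof.
move=> mD Dfin mg gM ha hb.
have la := hb_l1 (hb_lower (isT : 1 <= 2)%N ha).
have lb := hb_l1 (hb_lower (isT : 1 <= 2)%N hb).
have mFS : measurable_fun D (FS a b).
  by apply: continuous_measurable; exact: (continuous_FS ha hb).
have gi (h : R -> R) (C : R) : measurable_fun D h -> (forall x, D x -> `|h x| <= C) ->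
    mu.-integrable D (EFin \o (fun x => g x * h x)).
  move=> mh hC; apply: (bounded_integrable (M := M * C) mD Dfin).
    exact: measurable_funM.
  by move=> x Dx; rewrite normrM ler_pM ?gM ?hC.
have gcos k : mu.-integrable D (EFin \o (fun x => g x * cos (k%:R * x))).
  apply: (gi _ 1) => [|x _]; last exact: norm_cos_le1.
  by apply: continuous_measurable; exact: continuous_cosZ.
have gsin k : mu.-integrable D (EFin \o (fun x => g x * sin (k%:R * x))).
  apply: (gi _ 1) => [|x _]; last exact: norm_sin_le1.
  by apply: continuous_measurable; exact: continuous_sinZ.
have gtrg k : mu.-integrable D (EFin \o (fun x => g x * trg a b x k)).
  apply: (gi _ (`|a k| + `|b k|)) => [|x _]; last exact: trg_bound.
  by apply: continuous_measurable; exact: continuous_trg.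
have trgE k : \int[mu]_(x in D) (g x * trg a b x k) =
    a k * \int[mu]_(x in D) (g x * cos (k%:R * x)) +
    b k * \int[mu]_(x in D) (g x * sin (k%:R * x)).
  rewrite -!RintegralZl// -RintegralD//; last 2 first.
  - exact: Rintegrable_scale.
  - exact: Rintegrable_scale.
  by apply: eq_Rintegral => x _; rewrite /trg; ring.
have sumE N : mu.-integrable D (EFin \o (fun x => g x * \sum_(0 <= k < N) trg a b x k)) /\
    \int[mu]_(x in D) (g x * \sum_(0 <= k < N) trg a b x k) =
    \sum_(0 <= k < N) \int[mu]_(x in D) (g x * trg a b x k).
  elim: N => [|N [IH1 IH2]].
    have E : (fun x => g x * \sum_(0 <= k < 0) trg a b x k) = fun=> 0.
      by apply/funext => x; rewrite big_geq// mulr0.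
    by rewrite E big_geq// Rintegral_cst// mul0r; split => //; exact: integrable0.
  have E : (fun x => g x * \sum_(0 <= k < N.+1) trg a b x k) =
      fun x => g x * \sum_(0 <= k < N) trg a b x k + g x * trg a b x N.
    by apply/funext => x; rewrite big_nat_recr//= mulrDr.
  rewrite E big_nat_recr//= RintegralD// IH2; split => //.
  exact: Rintegrable_add.
have M0 : 0 <= `|M| * fine (mu D) by rewrite mulr_ge0// fine_ge0.
have M1 : 0 < `|M| * fine (mu D) + 1 by rewrite ltr_wpDl.
apply/cvgrPdist_le => e e0.
(* The added 1 keeps the divisor positive when M is 0 or D is a null set. *)
have e1 : 0 < e / (`|M| * fine (mu D) + 1) by rewrite divr_gt0.
have [N0 hN0] := FS_tail la lb e1; exists N0 => // N /= N0N.
under eq_bigr do rewrite -trgE.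
have [i1 <-] := sumE N.
rewrite -RintegralB//; last by apply: (gi _ _ mFS) => x _; exact: FS_norm la lb.
under eq_Rintegral do rewrite -mulrBr.
have mS : measurable_fun D (fun x => \sum_(0 <= k < N) trg a b x k).
  apply: continuous_measurable; elim: N {N0N i1} => [|N IH].
    have -> : (fun x => \sum_(0 <= k < 0) trg a b x k) = fun=> 0.
      by apply/funext => x; rewrite big_geq.
    exact: cst_continuous.
  have -> : (fun x => \sum_(0 <= k < N.+1) trg a b x k) =
      (fun x => \sum_(0 <= k < N) trg a b x k) + (fun x => trg a b x N).
    by apply/funext => x; rewrite big_nat_recr.
  by move=> x; apply: continuousD; [exact: IH|exact: continuous_trg].
apply: (@le_trans _ _ ((`|M| * (e / (`|M| * fine (mu D) + 1))) * fine (mu D))).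
  apply: Rintegral_bound => //.
    by apply: measurable_funM => //; exact: measurable_funB.
  move=> x Dx; rewrite normrM ler_pM ?hN0//.
  by apply: le_trans (gM x Dx) (ler_norm _).
rewrite (_ : `|M| * _ * _ = e * ((`|M| * fine (mu D)) / (`|M| * fine (mu D) + 1))).
  by rewrite ler_piMr ?(ltW e0)// ler_pdivrMr// mul1r lerDl.
by ring.
Qed.

End FourierSeries.

(** * Completeness of the trigonometric system *)

Section Completeness.
Variable R : realType.
Implicit Types (f g h : R -> R) (x y e d : R) (k n : nat).
Notation mu := (@lebesgue_measure R).

Lemma le_Rintegral_subset (dsp : measure_display) (T : measurableType dsp) (m : {measure set T -> \bar R})
    (A B : set T) (f : T -> R) : measurable A -> measurable B ->
  A `<=` B -> m.-integrable B (EFin \o f) -> (forall x : T, B x -> 0 <= f x) ->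
  \int[m]_(x in A) f x <= \int[m]_(x in B) f x.
Proof.
move=> mA mB AB fi f0; have fiA := integrableS mB mA AB fi.
rewrite /Rintegral fine_le//.
- exact: integrable_fin_num fiA.
- exact: integrable_fin_num fi.
- apply: ge0_subset_integral => //; exact: measurable_int fi.
Qed.

Lemma bernoulli_ge (r : R) n : 1 <= r -> 1 + n%:R * (r - 1) <= r ^+ n.
Proof.
move=> r1; elim: n => [|n IH]; first by rewrite mul0r addr0 expr0.
rewrite exprS -addn1 natrD; have := ler_wpM2l (le_trans ler01 r1) IH.
have : 0 <= n%:R :> R by []; have := sqr_ge0 (r - 1); nra.
Qed.

Lemma pi_gtN : - pi <= pi :> R. Proof. by have := pi_gt0 R; lra. Qed.

Definition trig_null g := forall k,
  \int[mu]_(x in `[- pi, pi]) (g x * cos (k%:R * x)) = 0 /\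
  \int[mu]_(x in `[- pi, pi]) (g x * sin (k%:R * x)) = 0.

(** Product formulas only produce the frequencies k - 1, k, k + 1. Iterated, this gives
    orthogonality to all powers of a trigonometric polynomial of degree one. *)
Lemma trig_nullM g (p c s : R) : continuous g -> trig_null g ->
  trig_null (fun x => g x * (p + c * cos x + s * sin x)).
Proof.
move=> cg g0 k.
have cgc w : continuous (fun x => g x * cos (w * x)).
  by move=> x; apply: continuousM; [exact: cg|exact: continuous_cosZ].
have cgs w : continuous (fun x => g x * sin (w * x)).
  by move=> x; apply: continuousM; [exact: cg|exact: continuous_sinZ].
(* For k = 0 the frequency is -1, which parity sends back to 1. *)
have gcB : \int[mu]_(x in `[- pi, pi]) (g x * cos ((k%:R - 1) * x)) = 0.
  case: (k) => [|j]; last by rewrite -addn1 natrD addrK; exact: (g0 j).1.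
  by under eq_Rintegral do rewrite sub0r mulNr cosN; exact: (g0 1%N).1.
have gsB : \int[mu]_(x in `[- pi, pi]) (g x * sin ((k%:R - 1) * x)) = 0.
  case: (k) => [|j]; last by rewrite -addn1 natrD addrK; exact: (g0 j).2.
  under eq_Rintegral do rewrite sub0r mulNr sinN mulrN -mulN1r.
  by rewrite Rintegral_contZ// (g0 1%N).2 mulr0.
have gcD : \int[mu]_(x in `[- pi, pi]) (g x * cos ((k%:R + 1) * x)) = 0.
  by rewrite natr1; exact: (g0 k.+1).1.
have gsD : \int[mu]_(x in `[- pi, pi]) (g x * sin ((k%:R + 1) * x)) = 0.
  by rewrite natr1; exact: (g0 k.+1).2.
split.
- transitivity (\int[mu]_(x in `[- pi, pi]) (p * (g x * cos (k%:R * x)) +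
     (2^-1 * c * (g x * cos ((k%:R - 1) * x)) +
     (2^-1 * c * (g x * cos ((k%:R + 1) * x)) +
     (2^-1 * s * (g x * sin ((k%:R + 1) * x)) +
     - 2^-1 * s * (g x * sin ((k%:R - 1) * x))))))).
    apply: eq_Rintegral => x _.
    rewrite !mulrBl !mulrDl mul1r cosB cosD sinB sinD.
    by field.
  do ?[rewrite Rintegral_contD; [|by do ?[apply: continuousZ1|apply: continuousD1|exact: cgc|exact: cgs]..]].
  rewrite !Rintegral_contZ//.
  by rewrite gcB gcD gsB gsD (g0 k).1 !mulr0 !addr0.
- transitivity (\int[mu]_(x in `[- pi, pi]) (p * (g x * sin (k%:R * x)) +
     (2^-1 * c * (g x * sin ((k%:R - 1) * x)) +
     (2^-1 * c * (g x * sin ((k%:R + 1) * x)) +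
     (2^-1 * s * (g x * cos ((k%:R - 1) * x)) +
     - 2^-1 * s * (g x * cos ((k%:R + 1) * x))))))).
    apply: eq_Rintegral => x _.
    rewrite !mulrBl !mulrDl mul1r cosB cosD sinB sinD.
    by field.
  do ?[rewrite Rintegral_contD; [|by do ?[apply: continuousZ1|apply: continuousD1|exact: cgc|exact: cgs]..]].
  rewrite !Rintegral_contZ//.
  by rewrite gcB gcD gsB gsD (g0 k).2 !mulr0 !addr0.
Qed.

Lemma cos_le_anti x y : 0 <= x -> x <= y -> y <= pi -> cos y <= cos x.
Proof.
move=> x0 xy ypi; have [->//|xny] := eqVneq x y.
by apply/ltW; rewrite ltr_cos ?in_itv/= ?x0 ?ypi ?(le_trans x0 xy) ?(le_trans xy ypi)//
  lt_neqAle xny.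
Qed.

Lemma cos_le_far x y d : 0 <= d <= pi -> d <= `|x - y| <= 2 * pi - d ->
  cos (x - y) <= cos d.
Proof.
have p0 := pi_gt0 R.
move=> /andP[d0 dpi] /andP[]; rewrite -(cos_norm (x - y)).
set z := `|x - y| => dz zd.
have mono u : d <= u <= pi -> cos u <= cos d.
  by move=> /andP[du upi]; exact: cos_le_anti.
have [zpi|piz] := leP z pi; first by apply: mono; rewrite dz zpi.
have -> : cos z = cos (2 * pi - z).
  by rewrite -(cosN z) -(cosD2pi (- z)); congr cos; rewrite -[pi *+ 2]mulr_natl addrC.
by apply: mono; apply/andP; split; lra.
Qed.

(* If [g x > 0], the kernel [q y = 1 - cos e + cos (y - x)] exceeds 1 near x and is at
   most 1 away from x, so [int g q^n] would grow with n, whereas it vanishes. *)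
Lemma trig_null_le0 g x : continuous g -> trig_null g -> - pi < x < pi -> g x <= 0.
Proof.
move=> cg g0 /andP[xl xr]; rewrite leNgt; apply/negP => gx0.
have p0 := pi_gt0 R.
have /cvgrPdist_lt/(_ (g x / 2)) := cg x.
rewrite divr_gt0// => /(_ isT) [d /= d0 hd].
(* The last two bounds keep [|y - x|] at most 2 pi - e on the whole period, so the peak of q is not
   met again by periodicity. *)
pose e := Num.min (d / 2) (Num.min ((pi - x) / 2) ((pi + x) / 2)).
have e0 : 0 < e.
  by rewrite !lt_min !divr_gt0// ?subr_gt0// -ltrBlDl sub0r.
have ed : e <= d / 2 by rewrite ge_min lexx.
have e1 : e <= (pi - x) / 2 by rewrite !ge_min lexx !orbT.
have e2 : e <= (pi + x) / 2 by rewrite !ge_min lexx !orbT.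
pose q y : R := (1 - cos e) + cos x * cos y + sin x * sin y.
have qE y : q y = 1 - cos e + cos (y - x).
  by rewrite /q cosB -addrA; congr (_ + _); ring.
have cq : continuous q.
  apply: continuousD1; first apply: continuousD1.
  - exact: cst_continuous.
  - by apply: continuousZ1; exact: continuous_cos.
  - by apply: continuousZ1; exact: continuous_sin.
have gq n : continuous (fun y => g y * q y ^+ n) /\ trig_null (fun y => g y * q y ^+ n).
  elim: n => [|n [IH1 IH2]].
    by under eq_fun do rewrite expr0 mulr1.
  have E : (fun y => g y * q y ^+ n.+1) = (fun y => g y * q y ^+ n * q y).
    by apply/funext => y; rewrite exprSr mulrA.
  rewrite E; split; last exact: trig_nullM.
  exact: continuousM1 IH1 cq.
have [c _ hc] : exists2 c, c \in `[- pi, pi] & forall t, t \in `[- pi, pi] -> `|g t| <= `|g c|.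
  apply: EVT_max; first exact: pi_gtN.
  by apply: continuous_subspaceT => y; apply: continuous_comp; [exact: cg|exact: norm_continuous].
pose M : R := `|g c|.
have gd y : `|y - x| <= e -> g x / 2 <= g y.
  move=> yx; have := hd y; rewrite /ball/= distrC => h.
  have /h : `|y - x| < d by apply: le_lt_trans yx (le_lt_trans ed _); lra.
  by rewrite ltr_norml => /andP[_]; lra.
(* A lower bound for q at distance at most e / 2 from x, strictly above 1. *)
pose r := 1 - cos e + cos (e / 2).
have r1 : 1 < r.
  have : cos e < cos (e / 2) by rewrite ltr_cos ?in_itv/=; lra.
  by rewrite /r; lra.
have near y : `|y - x| <= e -> 1 <= q y.
  move=> yx; rewrite qE.
  have : cos e <= cos (y - x).
    by rewrite -(cos_norm (y - x)); apply: cos_le_anti => //; lra.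
  by lra.
have nearer y : `|y - x| <= e / 2 -> r <= q y.
  move=> yx; rewrite qE /r lerD2l.
  by rewrite -(cos_norm (y - x)); apply: cos_le_anti => //; lra.
have far y : - pi <= y <= pi -> e < `|y - x| -> `|q y| <= 1.
  move=> /andP[yl yr] ey; rewrite qE.
  have : cos (y - x) <= cos e.
    apply: cos_le_far; apply/andP; split; try lra.
    by rewrite ler_norml; apply/andP; split; lra.
  have := cos_le1 e; have := cos_geN1 (y - x).
  by rewrite ler_norml => *; apply/andP; split; lra.
have M0 : 0 <= M by exact: normr_ge0.
(* Adding M makes the integrand nonnegative everywhere, so that the integral may be restricted to
   the window of radius e / 2. *)
have lb n y : - pi <= y <= pi -> 0 <= g y * q y ^+ n + M.
  move=> ypi; have [yx|yx] := leP `|y - x| e.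
    have gy := gd y yx; have qy := near y yx.
    by rewrite addr_ge0// mulr_ge0 ?exprn_ge0//; lra.
  have : `|g y * q y ^+ n| <= M.
    rewrite normrM normrX -[M]mulr1; apply: ler_pM; rewrite ?exprn_ge0//.
      by apply: hc; rewrite in_itv.
    by rewrite exprn_ile1// far.
  by rewrite ler_norml => /andP[]; lra.
have key n : g x / 2 * r ^+ n * e <= 2 * pi * M.
  have [cgq tgq] := gq n.
  have cgM : continuous (fun y => g y * q y ^+ n + M).
    by apply: continuousD1 => //; exact: cst_continuous.
  have I : \int[mu]_(y in `[- pi, pi]) (g y * q y ^+ n + M) = 2 * pi * M.
    rewrite Rintegral_contD//; last by move=> y; exact: cst_continuous.
    rewrite Rintegral_cst// fine_itv_cc ?pi_gtN//.
    have := (tgq 0%N).1; under eq_Rintegral do rewrite mul0r cos0 mulr1.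
    by move=> ->; ring.
  rewrite -I; apply: (@le_trans _ _ (\int[mu]_(y in `[x - e / 2, x + e / 2])
      (g y * q y ^+ n + M))); last first.
    apply: le_Rintegral_subset => //.
    - by move=> y /=; rewrite !in_itv/= => /andP[? ?]; apply/andP; split; lra.
    - exact: continuous_integrable.
    - by move=> y /=; rewrite in_itv/=; exact: lb.
  have -> : g x / 2 * r ^+ n * e =
      \int[mu]_(y in `[x - e / 2, x + e / 2]) (g x / 2 * r ^+ n).
    by rewrite Rintegral_cst// fine_itv_cc; [field|lra].
  apply: le_Rintegral => //.
  - by apply: (@continuous_integrable _ (fun=> _)) => y; exact: cst_continuous.
  - exact: continuous_integrable.
  move=> y /=; rewrite in_itv/= => /andP[yl yr].
  have yx : `|y - x| <= e / 2 by rewrite ler_norml; apply/andP; split; lra.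
  apply: ler_wpDr => //; apply: ler_pM; rewrite ?divr_ge0 ?exprn_ge0//; try lra.
    by apply: gd; lra.
  by rewrite lerXn2r ?nnegrE ?nearer//; have := nearer y yx; lra.
(* By Bernoulli's inequality [key n] forces n <= C for every n. *)
pose C := 2 * pi * M / (g x / 2 * e * (r - 1)).
have D0 : 0 < g x / 2 * e * (r - 1) by rewrite !mulr_gt0 ?divr_gt0// subr_gt0.
have C0 : 0 <= C by rewrite divr_ge0 ?(ltW D0)// !mulr_ge0// ltW.
have := archi_boundP C0; set n := Num.Def.archi_bound C; apply/negP; rewrite -leNgt.
rewrite ler_pdivlMr//; apply: le_trans (key n).
have := bernoulli_ge n (ltW r1); have ge : 0 < g x / 2 * e by rewrite mulr_gt0 ?divr_gt0.
by move=> /(ler_wpM2l (ltW ge)); lra.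
Qed.

Lemma trig_null_eq0 g x : continuous g -> trig_null g -> - pi < x < pi -> g x = 0.
Proof.
move=> cg g0 xpi; apply/eqP; rewrite eq_le (trig_null_le0 cg g0 xpi)/=.
rewrite -oppr_le0; apply: (@trig_null_le0 (fun y => - g y)) => //.
  by move=> y; apply: continuousN; exact: cg.
move=> k; split.
- under eq_Rintegral do rewrite mulNr -mulN1r.
  rewrite Rintegral_contZ ?(g0 k).1 ?mulr0// => y.
  by apply: continuousM; [exact: cg|exact: continuous_cosZ].
- under eq_Rintegral do rewrite mulNr -mulN1r.
  rewrite Rintegral_contZ ?(g0 k).2 ?mulr0// => y.
  by apply: continuousM; [exact: cg|exact: continuous_sinZ].
Qed.

Lemma periodic2pi_int f (z : int) : periodic2pi f -> forall x, f (x + z%:~R * (2 * pi)) = f x.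
Proof.
move=> pf; have pn n x : f (x + n%:R * (2 * pi)) = f x.
  elim: n x => [|n IH] x; first by rewrite mul0r addr0.
  by rewrite -addn1 natrD mulrDl mul1r addrA pf IH.
case: z => n x; first exact: pn.
by rewrite -(pn n.+1 (x + _)) NegzE mulrNz mulNr addrNK.
Qed.

(** The endpoint -pi is reached by continuity from the open interval, all other points by
    translation through a multiple of the period. *)
Lemma trig_null_periodic_eq0 g : continuous g -> periodic2pi g -> trig_null g ->
  forall x, g x = 0.
Proof.
move=> cg pg g0; have p0 := pi_gt0 R.
have gpi : g (- pi) = 0.
  apply/eqP; rewrite -normr_le0; apply/ler_addgt0Pr => e e0; rewrite add0r.
  have /cvgrPdist_lt/(_ _ e0) [d /= d0 hd] := cg (- pi).
  pose y := - pi + Num.min (d / 2) pi.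
  have y0 : g y = 0.
    apply: trig_null_eq0 => //; rewrite /y.
    have : Num.min (d / 2) pi <= pi by rewrite ge_min lexx orbT.
    have : 0 < Num.min (d / 2) pi by rewrite lt_min p0 divr_gt0.
    by move=> *; apply/andP; split; lra.
  have := hd y; rewrite /ball/= y0 subr0 => h; apply/ltW/h.
  have -> : - pi - y = - Num.min (d / 2) pi by rewrite /y; ring.
  rewrite normrN ger0_norm; last by rewrite le_min !ltW ?divr_gt0.
  by rewrite (@le_lt_trans _ _ (d / 2))// ?ge_min ?lexx//; lra.
move=> x; pose z := Num.floor ((x + pi) / (2 * pi)).
have pp : 0 < 2 * pi :> R by lra.
pose y := x + (- z)%:~R * (2 * pi).
have <- : g y = g x by exact: periodic2pi_int.
have /andP[zl zr] : (z%:~R <= (x + pi) / (2 * pi) < (z + 1)%:~R)%R.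
  exact: floor_itv.
move: zl zr; rewrite ler_pdivlMr// ltr_pdivrMr// intrD mulrDl mul1r => zl zr.
have yE : y = x - z%:~R * (2 * pi) by rewrite /y mulrNz mulNr.
have [ypi|ypi] := eqVneq y (- pi); first by rewrite ypi.
apply: trig_null_eq0 => //; apply/andP; split; last by rewrite yE; lra.
by rewrite lt_neqAle eq_sym ypi yE; lra.
Qed.

End Completeness.

(** * The Hilbert transform of a Fourier series *)

Section Hilbert.
Variable R : realType.
Implicit Types (a b : nat -> R) (A B M e x y t th : R) (k n N : nat).
Notation mu := (@lebesgue_measure R).

Lemma Rintegral_reflect (G : R -> R) (th a b : R) : a <= b ->
  {within `[th - b, th - a], continuous G} ->
  \int[mu]_(x in `[th - b, th - a]) G x = \int[mu]_(y in `[a, b]) G (th - y).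
Proof.
move=> ab cG; pose F y : R := th - y.
have dF y : is_derive y 1 F (- 1).
  have H := is_derive1B (is_derive1C th y) (is_derive_id y 1).
  by apply: (is_derive_eq H); rewrite sub0r.
have F1 : (F^`())%classic = cst (-1).
  by apply/funext => y; rewrite derive1E; apply: derive_val.
have cF : continuous F by move=> y; exact: is_derive1_continuous (dF y).
rewrite /Rintegral (integration_by_substitution_decreasing (F := F) ab).
- congr fine; apply: eq_integral => y _; rewrite F1 /=.
  by rewrite !fctE opprK mulr1.
- by move=> x y _ _; rewrite /F ltrD2l ltrN2.
- by rewrite F1 => ? _; exact: cst_continuous.
- by rewrite F1; exact: is_cvg_cst.
- by rewrite F1; exact: is_cvg_cst.
- split; [by move=> x _; exact: ex_derive| |].
  + exact/cvg_at_right_filter/cF.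
  + exact/cvg_at_left_filter/cF.
- exact: cG.
Qed.

Lemma Rintegral_shift (G : R -> R) (th a b : R) : a <= b ->
  {within `[th + a, th + b], continuous G} ->
  \int[mu]_(x in `[th + a, th + b]) G x = \int[mu]_(y in `[a, b]) G (th + y).
Proof.
move=> ab cG; pose F y : R := th + y.
have dF y : is_derive y 1 F 1.
  have H := is_derive1D (is_derive1C th y) (is_derive_id y 1).
  by apply: (is_derive_eq H); rewrite add0r.
have F1 : (F^`())%classic = cst 1.
  by apply/funext => y; rewrite derive1E; apply: derive_val.
have cF : continuous F by move=> y; exact: is_derive1_continuous (dF y).
rewrite /Rintegral (integration_by_substitution_increasing (F := F) ab).
- congr fine; apply: eq_integral => y _; rewrite F1 /=.
  by rewrite !fctE mulr1.
- by move=> x y _ _; rewrite /F ltrD2l.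
- by rewrite F1 => ? _; exact: cst_continuous.
- by rewrite F1; exact: is_cvg_cst.
- by rewrite F1; exact: is_cvg_cst.
- split; [by move=> x _; exact: ex_derive| |].
  + exact/cvg_at_right_filter/cF.
  + exact/cvg_at_left_filter/cF.
- exact: cG.
Qed.

Definition ker y : R := cos (y / 2) / sin (y / 2).

(** The cosine sum 1 + 2 cos y + ... + 2 cos((k-1)y) + cos(ky) for k > 0, grouped so that it grows
    by one summand with k. It continues cot(y/2) sin(ky) across y = 0. *)
Definition conj_dirichlet k y : R := \sum_(0 <= j < k) (cos (j%:R * y) + cos (j.+1%:R * y)).

(** With u = y/2 and w = (2k+1)u, the increment of sin(ky) is 2 sin u cos w, and the cotangent turns
    it into 2 cos u cos w. *)
Lemma ker_sinZ k y : sin (y / 2) != 0 -> ker y * sin (k%:R * y) = conj_dirichlet k y.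
Proof.
move=> s0; elim: k => [|k IH]; first by rewrite mul0r sin0 mulr0 /conj_dirichlet big_geq.
rewrite /conj_dirichlet big_nat_recr//= -/(conj_dirichlet k y) -IH /ker.
set u := y / 2; set w := (2 * k%:R + 1) * u.
have -> : k%:R * y = w - u by rewrite /w /u; field.
have -> : k.+1%:R * y = w + u by rewrite -addn1 natrD /w /u; field.
by rewrite sinB sinD cosB cosD; field.
Qed.

(** The primitive of cos(jy) that vanishes at 0. *)
Definition sint j y : R := if j == 0%N then y else j%:R^-1 * sin (j%:R * y).

Lemma is_derive_sint j y : is_derive y 1 (sint j) (cos (j%:R * y)).
Proof.
rewrite /sint; case: eqVneq => [->|j0].
  by rewrite mul0r cos0; exact: is_derive_id.
have H := is_derive1Z j%:R^-1 (is_derive1_sinZ j%:R y).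
by apply: (is_derive_eq H); rewrite mulrA mulVf ?mul1r// pnatr_eq0.
Qed.

Lemma sint_pi j : sint j pi = pi * (j == 0%N)%:R.
Proof. by rewrite /sint; case: ifP => _; rewrite ?mulr1// sin_natpi !mulr0. Qed.

Lemma sint_le j e : 0 <= e -> `|sint j e| <= e.
Proof.
move=> e0; rewrite /sint; case: eqVneq => [_|j0]; first by rewrite ger0_norm.
have jp : 0 < j%:R :> R by rewrite ltr0n lt0n.
rewrite normrM normfV (gtr0_norm jp) mulrC ler_pdivrMr//.
have := sin_dist (j%:R * e) 0; rewrite sin0 !subr0 => /le_trans; apply.
by rewrite normrM (gtr0_norm jp) ger0_norm// mulrC.
Qed.

Lemma continuous_conj_dirichlet k : continuous (conj_dirichlet k).
Proof.
rewrite /conj_dirichlet; elim: k => [|j IH].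
  rewrite (_ : (fun y => _) = fun=> 0); last by apply/funext => y; rewrite big_geq.
  exact: cst_continuous.
rewrite (_ : (fun y => _) = fun y => \sum_(0 <= i < j) (cos (i%:R * y) + cos (i.+1%:R * y)) +
    (cos (j%:R * y) + cos (j.+1%:R * y))); last by apply/funext => y; rewrite big_nat_recr.
by do ?[apply: continuousD1|exact: IH|exact: continuous_cosZ].
Qed.

(** Over [0, pi] only the constant term contributes, giving pi; removing [0, e] costs at most e for
    each of the 2k cosines. *)
Lemma Rintegral_conj_dirichlet k e : 0 <= e <= pi ->
  `|\int[mu]_(y in `[e, pi]) conj_dirichlet k y - pi * (k != 0%N)%:R| <= 2 * k%:R * e.
Proof.
move=> /andP[e0 epi].
pose Phi y := \sum_(0 <= j < k) (sint j y + sint j.+1 y).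
have dPhi y : is_derive y 1 Phi (conj_dirichlet k y).
  apply: is_derive1_sum => j _; apply: is_derive1D; exact: is_derive_sint.
rewrite (Rintegral_FTC epi dPhi (@continuous_conj_dirichlet k)).
have -> : Phi pi = pi * (k != 0%N)%:R.
  rewrite /Phi; under eq_bigr do rewrite !sint_pi mulr0 addr0.
  case: k {Phi dPhi} => [|k]; first by rewrite big_geq// mulr0.
  by rewrite big_nat_recl//= big1 ?addr0// => i _; rewrite mulr0.
rewrite addrAC subrr sub0r normrN; apply: le_trans (ler_norm_sum _ _ _) _.
apply: (@le_trans _ _ (\sum_(0 <= j < k) (e + e))).
  apply: ler_sum => j _; apply: le_trans (ler_normD _ _) _.
  by apply: lerD; exact: sint_le.
by rewrite sumr_const_nat subn0 -mulr_natl le_eqVlt; apply/orP; left; apply/eqP; ring.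
Qed.

Definition pvset th e : set R := [set x | th - pi <= x <= th + pi /\ e < `|th - x|].

Lemma pvsetE th e : 0 < e -> e < pi ->
  pvset th e = `[th - pi, th - e[%classic `|` `]th + e, th + pi]%classic.
Proof.
move=> e0 epi; apply/seteqP; split => x /=; rewrite /pvset/= !in_itv/=.
  move=> [/andP[xl xr]]; rewrite ltr_normr => /orP[|] h.
    by left; apply/andP; split; lra.
  by right; apply/andP; split; lra.
move=> [] /andP[xl xr].
  by split; [apply/andP; split; lra|rewrite ltr_normr; apply/orP; left; lra].
by split; [apply/andP; split; lra|rewrite ltr_normr; apply/orP; right; lra].
Qed.

Lemma sin_half_gt0 y : 0 < y <= pi -> 0 < sin (y / 2).
Proof.
move=> /andP[y0 ypi]; apply: sin_gt0_pi; apply/andP; split; first by rewrite divr_gt0.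
by have := pi_gt0 R; lra.
Qed.

Lemma sin_half_neq0 y : y != 0 -> `|y| <= pi -> sin (y / 2) != 0.
Proof.
move=> y0 ypi; have [yp|yn] := leP 0 y.
  by rewrite gt_eqF// sin_half_gt0// lt_def y0 yp/= -(ger0_norm yp).
rewrite lt_eqF// -oppr_gt0 -sinN -mulNr sin_half_gt0//.
by rewrite oppr_gt0 yn/= -(ltr0_norm yn).
Qed.

Lemma kerN y : ker (- y) = - ker y.
Proof. by rewrite /ker mulNr cosN sinN invrN mulrN. Qed.

Lemma continuous_ker y : sin (y / 2) != 0 -> {for y, continuous ker}.
Proof.
rewrite mulrC => s0.
rewrite (_ : ker = fun y => cos (2^-1 * y) * (sin (2^-1 * y))^-1); last first.
  by apply/funext => z; rewrite /ker mulrC [z / 2]mulrC mulrC.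
apply: continuousM; first exact: continuous_cosZ.
by apply: continuousV => //; exact: continuous_sinZ.
Qed.

Lemma continuous_ker_refl th x : sin ((th - x) / 2) != 0 ->
  {for x, continuous (fun x => ker (th - x))}.
Proof.
move=> s0; apply: (@continuous_comp _ _ _ (fun x => th - x) ker).
  exact: is_derive1_continuous (is_derive1B (is_derive1C th x) (is_derive_id x 1)).
exact: continuous_ker.
Qed.

Section PrincipalValue.
Variables (th e : R).
Hypotheses (e0 : 0 < e) (epi : e < pi).
Local Notation D := (pvset th e).

Lemma pvset_neq0 x : D x -> sin ((th - x) / 2) != 0.
Proof.
move=> [/andP[xl xr] xe]; apply: sin_half_neq0.
  by rewrite -normr_gt0 (lt_trans e0).
by rewrite ler_norml; apply/andP; split; lra.
Qed.

Lemma measurable_pvset : measurable D.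
Proof. by rewrite pvsetE//; apply: measurableU; exact: measurable_itv. Qed.

Lemma pvset_sub : D `<=` `[th - pi, th + pi]%classic.
Proof. by move=> x [h _]; rewrite /= in_itv. Qed.

Lemma pvset_fin : (mu D < +oo)%E.
Proof.
apply: le_lt_trans (itv_cc_fin (th - pi) (th + pi)).
apply: le_measure; rewrite ?inE; [exact: measurable_pvset|exact: measurable_itv|exact: pvset_sub].
Qed.

Lemma measurable_ker_pvset : measurable_fun D (fun x => ker (th - x)).
Proof.
apply: subspace_continuous_measurable_fun; first exact: measurable_pvset.
apply: continuous_in_subspaceT => x; rewrite inE => Dx.
exact/continuous_ker_refl/pvset_neq0.
Qed.

Lemma ker_pvset_bound x : D x -> `|ker (th - x)| <= (sin (e / 2))^-1.
Proof.
move=> Dx; have [/andP[xl xr] xe] := Dx; have p0 := pi_gt0 R.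
have e0' := e0; have epi' := epi.
have s0 : 0 < sin (e / 2) by apply: sin_half_gt0; rewrite e0 ltW.
rewrite /ker normrM -[leRHS]mul1r; apply: ler_pM => //; first exact: norm_cos_le1.
rewrite normfV lef_pV2 ?posrE ?normr_gt0 ?pvset_neq0//.
have mono y : e < y -> y <= pi -> sin (e / 2) <= sin (y / 2).
  move=> ey ypi; apply/ltW; rewrite ltr_sin ?in_itv/= ?ltr_pM2r//.
    by apply/andP; split; lra.
  by apply/andP; split; lra.
have [yp|yn] := leP 0 (th - x).
  rewrite ger0_norm in xe => //.
  by rewrite ger0_norm ?mono//; [lra|apply/ltW/sin_half_gt0; lra].
rewrite ltr0_norm// in xe.
have -> : sin ((th - x) / 2) = - sin ((x - th) / 2) by rewrite -sinN; congr sin; lra.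
rewrite normrN ger0_norm ?mono//; try lra.
by apply/ltW/sin_half_gt0; lra.
Qed.

(* Folding the two halves of the window onto each other cancels the singularity. *)
Lemma Rintegral_pvset (h : R -> R) (C : R) : continuous h -> (forall x, `|h x| <= C) ->
  \int[mu]_(x in D) (ker (th - x) * h x) =
  \int[mu]_(y in `[e, pi]) (ker y * (h (th - y) - h (th + y))).
Proof.
move=> ch hC; pose G x := ker (th - x) * h x.
have e0' := e0; have epi' := ltW epi; have p0 := pi_gt0 R.
have cG x : x != th -> `|th - x| <= pi -> {for x, continuous G}.
  move=> xth xpi; apply: continuousM; last exact: ch.
  by apply/continuous_ker_refl/sin_half_neq0 => //; rewrite subr_eq0 eq_sym.
have cl : {within `[th - pi, th - e], continuous G}.
  have H x : th - pi <= x <= th - e -> {for x, continuous G}.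
    by move=> /andP[xl xr]; apply: cG; [rewrite lt_eqF//; lra|rewrite ler_norml; apply/andP; split; lra].
  by apply: continuous_in_subspaceT => x; rewrite inE/= in_itv/=; exact: H.
have cr : {within `[th + e, th + pi], continuous G}.
  have H x : th + e <= x <= th + pi -> {for x, continuous G}.
    by move=> /andP[xl xr]; apply: cG; [rewrite gt_eqF//; lra|rewrite ler_norml; apply/andP; split; lra].
  by apply: continuous_in_subspaceT => x; rewrite inE/= in_itv/=; exact: H.
have il : mu.-integrable `[th - pi, th - e] (EFin \o G).
  by apply: continuous_compact_integrable => //; exact: segment_compact.
have ir : mu.-integrable `[th + e, th + pi] (EFin \o G).
  by apply: continuous_compact_integrable => //; exact: segment_compact.
have il' : mu.-integrable `[th - pi, th - e[ (EFin \o G).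
  by apply: integrableS il => //; apply: subset_itv; rewrite ?lexx// bnd_simp.
have ir' : mu.-integrable `]th + e, th + pi] (EFin \o G).
  by apply: integrableS ir => //; apply: subset_itv; rewrite ?lexx// bnd_simp.
have iD : mu.-integrable D (EFin \o G).
  apply: (bounded_integrable (M := (sin (e / 2))^-1 * C) measurable_pvset pvset_fin).
    by apply: measurable_funM; [exact: measurable_ker_pvset|exact: continuous_measurable].
  by move=> x Dx; rewrite normrM ler_pM// ker_pvset_bound.
rewrite pvsetE// in iD *; rewrite Rintegral_setU//; last first.
  apply/disj_setPS => x /= []; rewrite !in_itv/= => /andP[_ x1] /andP[x2 _].
  by have := lt_trans x2 x1; rewrite ltrD2l => h0; have := lt_trans e0 h0; rewrite oppr_gt0 ltNge (ltW e0).
rewrite Rintegral_itv_bndo_bndc// Rintegral_itv_obnd_cbnd//.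
rewrite Rintegral_reflect// Rintegral_shift//.
have ck (h1 : R -> R) : continuous h1 -> mu.-integrable `[e, pi] (EFin \o (fun y => ker y * h1 y)).
  move=> ch1; apply: continuous_compact_integrable; first exact: segment_compact.
  have cat y : e <= y <= pi -> {for y, continuous (fun y => ker y * h1 y)}.
    move=> /andP[yl yr]; apply: continuousM; last exact: ch1.
    by apply: continuous_ker; rewrite gt_eqF// sin_half_gt0// yr andbT (lt_le_trans e0).
  by apply: continuous_in_subspaceT => y; rewrite inE/= in_itv/=; exact: cat.
have c1 : continuous (fun y => h (th - y)).
  move=> y; apply: (@continuous_comp _ _ _ (fun x => th - x) h); last exact: ch.
  exact: is_derive1_continuous (is_derive1B (is_derive1C th y) (is_derive_id y 1)).
have c2 : continuous (fun y => - h (th + y)).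
  move=> y; apply: continuousN; apply: (@continuous_comp _ _ _ (fun x => th + x) h); last exact: ch.
  exact: is_derive1_continuous (is_derive1D (is_derive1C th y) (is_derive_id y 1)).
have -> : \int[mu]_(y in `[e, pi]) G (th - y) = \int[mu]_(y in `[e, pi]) (ker y * h (th - y)).
  by apply: eq_Rintegral => y _; rewrite /G; congr (ker _ * _); ring.
have -> : \int[mu]_(y in `[e, pi]) G (th + y) = \int[mu]_(y in `[e, pi]) (ker y * - h (th + y)).
  apply: eq_Rintegral => y _; rewrite /G (_ : th - (th + y) = - y); last by ring.
  by rewrite kerN mulrN mulNr.
rewrite -RintegralD//; [|exact: ck|exact: ck].
by apply: eq_Rintegral => y _; rewrite mulrBr mulrN.
Qed.

(** The folded difference cos(k(th - y)) - cos(k(th + y)) equals 2 sin(k th) sin(ky), and [ker_sinZ]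
    removes the cotangent. *)
Lemma Rintegral_pvset_cos k :
  \int[mu]_(x in D) (ker (th - x) * cos (k%:R * x)) =
  2 * sin (k%:R * th) * \int[mu]_(y in `[e, pi]) conj_dirichlet k y.
Proof.
rewrite (Rintegral_pvset (@continuous_cosZ _ k%:R) (fun x => norm_cos_le1 _)).
rewrite -Rintegral_contZ; last exact: continuous_conj_dirichlet.
apply: eq_Rintegral => y; rewrite inE/= in_itv/= => /andP[ey ypi].
rewrite -ker_sinZ; last by rewrite gt_eqF// sin_half_gt0// ypi andbT (lt_le_trans e0).
by rewrite (mulrBr k%:R) (mulrDr k%:R) cosB cosD; ring.
Qed.

Lemma Rintegral_pvset_sin k :
  \int[mu]_(x in D) (ker (th - x) * sin (k%:R * x)) =
  - 2 * cos (k%:R * th) * \int[mu]_(y in `[e, pi]) conj_dirichlet k y.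
Proof.
rewrite (Rintegral_pvset (@continuous_sinZ _ k%:R) (fun x => norm_sin_le1 _)).
rewrite -Rintegral_contZ; last exact: continuous_conj_dirichlet.
apply: eq_Rintegral => y; rewrite inE/= in_itv/= => /andP[ey ypi].
rewrite -ker_sinZ; last by rewrite gt_eqF// sin_half_gt0// ypi andbT (lt_le_trans e0).
by rewrite (mulrBr k%:R) (mulrDr k%:R) sinB sinD; ring.
Qed.

(** The cut-off perturbs mode k by at most k e times its coefficients; summability of k a_k and k
    b_k makes the principal value converge at rate e. *)
Lemma pv_FS_error a b A B : hb 3 a A -> hb 3 b B ->
  `|FS (fun k => - ((k != 0%N)%:R * b k)) a th -
    (2 * pi)^-1 * \int[mu]_(x in D) (ker (th - x) * FS a b x)| <=
  (Num.sqrt (3 * A) + Num.sqrt (3 * B)) * e.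
Proof.
move=> ha hB; have p0 := pi_gt0 R; have p2 := pi_ge2 R; have pn : pi != 0 :> R by exact: lt0r_neq0.
have ha2 := hb_lower (isT : 2 <= 3)%N ha; have hb2 := hb_lower (isT : 2 <= 3)%N hB.
have la := hb_l1 (hb_lower (isT : 1 <= 3)%N ha).
have lb := hb_l1 (hb_lower (isT : 1 <= 3)%N hB).
have lb' : l1 (fun k => - ((k != 0%N)%:R * b k)) (Num.sqrt (3 * B)).
  move=> K; apply: le_trans (lb K); apply: ler_sum => k _; rewrite normrN normrM.
  by rewrite ler_piMl//; case: (k != 0%N); rewrite ?normr1 ?normr0.
have c1 := FS_cvg (x := th) lb' la.
have c2 := cvg_Rintegral_FS measurable_pvset pvset_fin measurable_ker_pvset
  ker_pvset_bound ha2 hb2.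
have c3 : `|series (trg (fun k => - ((k != 0%N)%:R * b k)) a th) N - (2 * pi)^-1 *
    \sum_(0 <= k < N) (a k * \int[mu]_(x in D) (ker (th - x) * cos (k%:R * x)) +
        b k * \int[mu]_(x in D) (ker (th - x) * sin (k%:R * x)))| @[N --> \oo] -->
    `|FS (fun k => - ((k != 0%N)%:R * b k)) a th -
      (2 * pi)^-1 * \int[mu]_(x in D) (ker (th - x) * FS a b x)|.
  by apply: cvg_norm; apply: cvgB; [exact: c1|apply: cvgM; [exact: cvg_cst|exact: c2]].
apply: (cvgr_to_le c3); apply: nearW => N.
apply: le_trans (ler_wpM2r (ltW e0) (lerD (l1_dk ha2 N) (l1_dk hb2 N))).
rewrite /series/= mulr_sumr -sumrB -big_split/= mulr_suml.
apply: le_trans (ler_norm_sum _ _ _) _; apply: ler_sum => k _.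
rewrite Rintegral_pvset_cos Rintegral_pvset_sin.
set J := \int[mu]_(_ in _) _.
(* The factor 2 of [Rintegral_conj_dirichlet] is absorbed by pi >= 2. *)
have hJ : `|(k != 0%N)%:R - J / pi| <= k%:R * e.
  have -> : (k != 0%N)%:R - J / pi = (pi * (k != 0%N)%:R - J) / pi.
    by rewrite [RHS]mulrBl mulrAC mulfV ?mul1r// lt0r_neq0.
  rewrite normrM normfV (gtr0_norm p0) ler_pdivrMr// distrC.
  apply: le_trans (Rintegral_conj_dirichlet k _) _; first by rewrite !ltW.
  have : 0 <= k%:R * e by rewrite mulr_ge0 ?(ltW e0).
  by nra.
have -> : trg (fun k => - ((k != 0%N)%:R * b k)) a th k -
    (2 * pi)^-1 * (a k * (2 * sin (k%:R * th) * J) + b k * (- 2 * cos (k%:R * th) * J)) =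
    a k * sin (k%:R * th) * ((k != 0%N)%:R - J / pi) +
    - (b k * cos (k%:R * th)) * ((k != 0%N)%:R - J / pi).
  rewrite /trg; case: eqVneq => [->|k0] /=.
    by rewrite (mul0r th) sin0; move: pn; generalize (pi : R) => P pn; field.
  by move: pn; generalize (pi : R) => P pn; field.
apply: le_trans (ler_normD _ _) _; rewrite [leRHS]mulrDl; apply: lerD.
- rewrite /dk !normrM (ger0_norm (ler0n _ _)) (_ : k%:R * `|a k| * e = `|a k| * 1 * (k%:R * e)).
    by do ?apply: ler_pM => //; exact: norm_sin_le1.
  by ring.
- rewrite /dk !normrM normrN normrM (ger0_norm (ler0n _ _)).
  rewrite (_ : k%:R * `|b k| * e = `|b k| * 1 * (k%:R * e)).
    by do ?apply: ler_pM => //; rewrite ?mulr_ge0//; exact: norm_cos_le1.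
  by ring.
Qed.

End PrincipalValue.

Lemma is_hilbert_FS a b A B th : hb 3 a A -> hb 3 b B ->
  is_hilbert (FS a b) th (FS (fun k => - ((k != 0%N)%:R * b k)) a th).
Proof.
move=> ha hB; apply/cvgrPdist_le => d d0.
set L := Num.sqrt (3 * A) + Num.sqrt (3 * B).
have L0 : 0 <= L by rewrite addr_ge0 ?sqrtr_ge0.
have L1 : 0 < L + 1 by rewrite ltr_wpDl.
exists (Num.min pi (d / (L + 1))) => /=; first by rewrite lt_min pi_gt0 divr_gt0.
move=> e /=; rewrite /ball/= sub0r normrN => ed e0; move: ed.
rewrite gtr0_norm// lt_min => /andP[epi]; rewrite ltr_pdivlMr// => ed.
apply: le_trans (pv_FS_error th e0 epi ha hB) _; apply: le_trans (ltW ed).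
by rewrite mulrC ler_wpM2l ?(ltW e0)// lerDl.
Qed.

End Hilbert.

(** * Sobolev norms through Fourier coefficients *)

Section SobolevCoefficients.
Variable R : realType.
Implicit Types (f g : R -> R) (a b : nat -> R) (A B c e x : R) (k n s : nat).
Notation mu := (@lebesgue_measure R).

(** The normalisation in which [FS (ca f) (cb f)] is the Fourier series of f: [fcos f 0] is twice
    the mean. *)
Definition ca f k : R := if k == 0%N then fcos f 0 / 2 else fcos f k.
Definition cb f k : R := fsin f k.

(** The part of [inH] that makes the Fourier coefficients linear in f. *)
Definition sqint f := measurable_fun setT f /\
  mu.-integrable `[- pi, pi] (fun x => ((f x) ^+ 2)%:E).

Lemma sqint_continuous f : continuous f -> sqint f.
Proof.
move=> cf; split; first exact: continuous_measurable.
apply: (@continuous_integrable _ (fun x => f x ^+ 2)).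
by under eq_fun do rewrite expr2; exact: continuousM1.
Qed.

Lemma sqint_dom f g : measurable_fun setT f ->
  mu.-integrable `[- pi, pi] (EFin \o g) -> (forall x, f x ^+ 2 <= g x) -> sqint f.
Proof.
move=> mf gi h; split => //; apply: (le_integrable _ _ _ gi) => //.
  apply/measurable_EFinP; apply: measurable_funTS.
  by under eq_fun do rewrite expr2; exact: measurable_funM.
move=> x _; rewrite /= lee_fin ger0_norm ?sqr_ge0//.
by apply: le_trans (h x) (ler_norm _).
Qed.

Lemma sqintZ f c : sqint f -> sqint (fun x => c * f x).
Proof.
move=> [mf fi]; apply: (@sqint_dom _ (fun x => c ^+ 2 * f x ^+ 2)).
- by apply: measurable_funM => //; exact: measurable_cst.
- exact: (@Rintegrable_scale _ _ (fun x => f x ^+ 2)).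
- by move=> x; rewrite exprMn.
Qed.

Lemma sqintD f g : sqint f -> sqint g -> sqint (fun x => f x + g x).
Proof.
move=> [mf fi] [mg gi]; apply: (@sqint_dom _ (fun x => 2 * f x ^+ 2 + 2 * g x ^+ 2)).
- exact: measurable_funD.
- apply: Rintegrable_add => //.
    exact: (@Rintegrable_scale _ _ (fun x => f x ^+ 2)).
  exact: (@Rintegrable_scale _ _ (fun x => g x ^+ 2)).
- by move=> x; have := sqr_ge0 (f x - g x); nra.
Qed.

Lemma sqintB f g : sqint f -> sqint g -> sqint (fun x => f x - g x).
Proof.
move=> hf /(sqintZ (-1)) hg; have := sqintD hf hg.
by under eq_fun do rewrite mulN1r.
Qed.

Lemma sqint_integrableM f (phi : R -> R) : sqint f -> continuous phi ->
  (forall x, `|phi x| <= 1) -> mu.-integrable `[- pi, pi] (EFin \o (fun x => f x * phi x)).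
Proof.
move=> [mf fi] cphi h.
have gi : mu.-integrable `[- pi, pi] (EFin \o (fun x => 1 + f x ^+ 2)).
  apply: Rintegrable_add => //.
  by apply: (@continuous_integrable _ (fun=> 1)) => y; exact: cst_continuous.
apply: (le_integrable _ _ _ gi) => //.
  apply/measurable_EFinP; apply: measurable_funTS.
  by apply: measurable_funM => //; exact: continuous_measurable.
move=> x _; rewrite /= lee_fin [leRHS]ger0_norm ?addr_ge0 ?sqr_ge0// normrM.
apply: (@le_trans _ _ `|f x|); first by rewrite ler_piMr.
by rewrite -real_normK ?num_real//; have := sqr_ge0 (`|f x| - 1); have := normr_ge0 (f x); nra.
Qed.

Lemma fcosZ f c k : sqint f -> fcos (fun x => c * f x) k = c * fcos f k.
Proof.
move=> hf; rewrite /fcos mulrCA; congr (_ * _).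
under eq_Rintegral do rewrite -mulrA.
rewrite RintegralZl//; apply: sqint_integrableM => //.
  exact: continuous_cosZ.
by move=> x; exact: norm_cos_le1.
Qed.

Lemma fsinZ f c k : sqint f -> fsin (fun x => c * f x) k = c * fsin f k.
Proof.
move=> hf; rewrite /fsin mulrCA; congr (_ * _).
under eq_Rintegral do rewrite -mulrA.
rewrite RintegralZl//; apply: sqint_integrableM => //.
  exact: continuous_sinZ.
by move=> x; exact: norm_sin_le1.
Qed.

Lemma fcosB f g k : sqint f -> sqint g -> fcos (fun x => f x - g x) k = fcos f k - fcos g k.
Proof.
move=> hf hg; rewrite /fcos -mulrBr; congr (_ * _).
under eq_Rintegral do rewrite mulrBl.
rewrite RintegralB//; apply: sqint_integrableM => //;
  by [exact: continuous_cosZ|move=> x; exact: norm_cos_le1].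
Qed.

Lemma fsinB f g k : sqint f -> sqint g -> fsin (fun x => f x - g x) k = fsin f k - fsin g k.
Proof.
move=> hf hg; rewrite /fsin -mulrBr; congr (_ * _).
under eq_Rintegral do rewrite mulrBl.
rewrite RintegralB//; apply: sqint_integrableM => //;
  by [exact: continuous_sinZ|move=> x; exact: norm_sin_le1].
Qed.

Lemma caZ f c : sqint f -> ca (fun x => c * f x) = fun k => c * ca f k.
Proof. by move=> hf; apply/funext => k; rewrite /ca !fcosZ//; case: ifP; rewrite ?mulrA. Qed.

Lemma cbZ f c : sqint f -> cb (fun x => c * f x) = fun k => c * cb f k.
Proof. by move=> hf; apply/funext => k; rewrite /cb fsinZ. Qed.

Lemma caB f g : sqint f -> sqint g ->
  ca (fun x => f x - g x) = fun k => ca f k - ca g k.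
Proof. by move=> hf hg; apply/funext => k; rewrite /ca !fcosB// mulrBl; case: ifP. Qed.

Lemma cbB f g : sqint f -> sqint g ->
  cb (fun x => f x - g x) = fun k => cb f k - cb g k.
Proof. by move=> hf hg; apply/funext => k; rewrite /cb fsinB. Qed.

Lemma cb0 f : cb f 0%N = 0.
Proof.
rewrite /cb /fsin; under eq_Rintegral do rewrite mul0r sin0 mulr0.
by rewrite Rintegral_cst// mul0r mulr0.
Qed.

Lemma wt0 : wt 0 = 1 :> R. Proof. by rewrite /wt expr0n addr0. Qed.

(** The two sides agree at k = 0 and differ by a factor 2 elsewhere; [le_sob_term] is the reverse
    comparison. *)
Lemma sob_term_le s f k :
  sob_term s f k <= wt k ^+ s * ca f k ^+ 2 + wt k ^+ s * cb f k ^+ 2.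
Proof.
rewrite -mulrDr /sob_term /ca; case: eqVneq => [->|k0].
  rewrite cb0 wt0 expr1n mul1r expr0n addr0.
  by rewrite le_eqVlt; apply/orP; left; apply/eqP; field.
rewrite -[X in _ * X / _]/(fcos f k ^+ 2 + cb f k ^+ 2) -/(wt k) -mulrA ler_wpM2l//.
by have := sqr_ge0 (fcos f k); have := sqr_ge0 (cb f k); lra.
Qed.

Lemma le_sob_term s f k :
  wt k ^+ s * ca f k ^+ 2 + wt k ^+ s * cb f k ^+ 2 <= 2 * sob_term s f k.
Proof.
rewrite -mulrDr /sob_term /ca; case: eqVneq => [->|k0].
  rewrite cb0 wt0 expr1n mul1r expr0n addr0 exprMn.
  by have := sqr_ge0 (fcos f 0); lra.
rewrite -[X in _ <= 2 * (_ * X / _)]/(fcos f k ^+ 2 + cb f k ^+ 2) -/(wt k).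
by rewrite le_eqVlt; apply/orP; left; apply/eqP; field.
Qed.

Lemma sob_term_ge0 s f k : 0 <= sob_term s f k.
Proof.
rewrite -(pmulr_rge0 _ (ltr0n R 2)); apply: le_trans (le_sob_term s f k).
by rewrite addr_ge0// mulr_ge0 ?sqr_ge0.
Qed.

Lemma sob_cvg s f A B : hb s (ca f) A -> hb s (cb f) B ->
  cvgn (series (sob_term s f)) /\ limn (series (sob_term s f)) <= A + B.
Proof.
move=> ha hB; have H K : \sum_(0 <= k < K) `|sob_term s f k| <= A + B.
  apply: le_trans (lerD (ha K) (hB K)); rewrite -big_split/=.
  by apply: ler_sum => k _; rewrite ger0_norm ?sob_term_ge0// sob_term_le.
split; first exact: sum_norm_is_cvg H.
by apply: le_trans (ler_norm _) _; exact: sum_norm_lim_le H.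
Qed.

Lemma Hnorm_lt s f A B e : hb s (ca f) A -> hb s (cb f) B -> 0 < e ->
  A + B < e ^+ 2 -> Hnorm s f < e.
Proof.
move=> ha hB e0 ABe; have [_ h] := sob_cvg ha hB.
rewrite /Hnorm -(ger0_norm (ltW e0)) -sqrtr_sqr ltr_sqrt ?exprn_gt0//.
exact: le_lt_trans h ABe.
Qed.

(** Convergence has to be assumed, as [Hnorm] says nothing about f when the series diverges and
    [limn] returns a default value. *)
Lemma Hnorm_hb s f e : cvgn (series (sob_term s f)) -> 0 <= e -> Hnorm s f <= e ->
  hb s (ca f) (2 * e ^+ 2) /\ hb s (cb f) (2 * e ^+ 2).
Proof.
move=> cf e0 he; have L : limn (series (sob_term s f)) <= e ^+ 2.
  have l0 : 0 <= limn (series (sob_term s f)).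
    by apply: limr_ge => //; apply: nearW => K; apply: sumr_ge0 => k _; exact: sob_term_ge0.
  by rewrite -(sqr_sqrtr l0) lerXn2r// nnegrE sqrtr_ge0.
have H K : \sum_(0 <= k < K) (wt k ^+ s * ca f k ^+ 2 + wt k ^+ s * cb f k ^+ 2) <= 2 * e ^+ 2.
  apply: (@le_trans _ _ (2 * series (sob_term s f) K)).
    by rewrite /series/= mulr_sumr; apply: ler_sum => k _; exact: le_sob_term.
  rewrite ler_wpM2l//; apply: le_trans L; apply: nondecreasing_cvgn_le => //.
  by apply: nondecreasing_series => k _ _; exact: sob_term_ge0.
split=> K; apply: le_trans (H K); apply: ler_sum => k _.
- by rewrite lerDl hb_term_ge0.
- by rewrite lerDr hb_term_ge0.
Qed.

Lemma inH_sqint s f : inH s f -> sqint f.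
Proof. by case. Qed.

Lemma inH_hb s f : inH s f -> exists A, hb s (ca f) A /\ hb s (cb f) A.
Proof.
move=> [_ _ _ cf]; exists (2 * Hnorm s f ^+ 2).
by apply: Hnorm_hb => //; exact: sqrtr_ge0.
Qed.

Lemma hb_inH s f A B : periodic2pi f -> sqint f -> hb s (ca f) A -> hb s (cb f) B -> inH s f.
Proof. by move=> pf [mf fi] ha hB; split => //; exact: (sob_cvg ha hB).1. Qed.

Lemma Rintegral_FS_cos a b A B n : hb 2 a A -> hb 2 b B ->
  \int[mu]_(x in `[- pi, pi]) (FS a b x * cos (n%:R * x)) =
    pi * (1 + (n == 0%N)%:R) * a n.
Proof.
move=> ha hB.
have H := @cvg_Rintegral_FS _ a b A B `[- pi, pi]%classic (fun x => cos (n%:R * x)) 1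
  (measurable_itv _) (itv_cc_fin _ _) _ (fun x _ => norm_cos_le1 _) ha hB.
under eq_Rintegral do rewrite mulrC.
have {}H := cvg_lim (@Rhausdorff R) (H (continuous_measurable (@continuous_cosZ _ _))).
rewrite -H; apply: cvg_lim => //; apply: cvg_near_cst; exists n.+1 => // N /= nN.
(* Orthogonality leaves one term as soon as N > n; [trunc] provides the vanishing beyond N that
   [sum_delta] asks for. *)
transitivity (\sum_(0 <= k < N) (k == n)%:R * (pi * (1 + (n == 0%N)%:R) * trunc N a k)).
  apply: eq_big_nat => k /andP[_ kN].
  rewrite trunc_lt// (_ : \int[mu]_(x in _) (_ * sin _) = 0); last first.
    by under eq_Rintegral do rewrite mulrC; exact: Rintegral_sinMcos.
  rewrite (_ : \int[mu]_(x in _) (_ * _) = pi * (k == n)%:R * (1 + (n == 0%N)%:R)); last first.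
    by under eq_Rintegral do rewrite mulrC; exact: Rintegral_cosMcos.
  by rewrite mulr0 addr0; ring.
rewrite (@sum_delta _ N n (fun k => pi * (1 + (n == 0%N)%:R) * trunc N a k)) ?trunc_lt//.
by move=> k Nk; rewrite trunc_ge// mulr0.
Qed.

Lemma Rintegral_FS_sin a b A B n : hb 2 a A -> hb 2 b B ->
  \int[mu]_(x in `[- pi, pi]) (FS a b x * sin (n%:R * x)) =
    pi * (n != 0%N)%:R * b n.
Proof.
move=> ha hB.
have H := @cvg_Rintegral_FS _ a b A B `[- pi, pi]%classic (fun x => sin (n%:R * x)) 1
  (measurable_itv _) (itv_cc_fin _ _) _ (fun x _ => norm_sin_le1 _) ha hB.
under eq_Rintegral do rewrite mulrC.
have {}H := cvg_lim (@Rhausdorff R) (H (continuous_measurable (@continuous_sinZ _ _))).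
rewrite -H; apply: cvg_lim => //; apply: cvg_near_cst; exists n.+1 => // N /= nN.
transitivity (\sum_(0 <= k < N) (k == n)%:R * (pi * (n != 0%N)%:R * trunc N b k)).
  apply: eq_big_nat => k /andP[_ kN].
  rewrite trunc_lt// (_ : \int[mu]_(x in _) (_ * cos _) = 0); last exact: Rintegral_sinMcos.
  rewrite (_ : \int[mu]_(x in _) (_ * _) = pi * (k == n)%:R * (n != 0%N)%:R); last first.
    by under eq_Rintegral do rewrite mulrC; exact: Rintegral_sinMsin.
  by rewrite mulr0 add0r; ring.
rewrite (@sum_delta _ N n (fun k => pi * (n != 0%N)%:R * trunc N b k)) ?trunc_lt//.
by move=> k Nk; rewrite trunc_ge// mulr0.
Qed.

Lemma ca_FS a b A B : hb 2 a A -> hb 2 b B -> ca (FS a b) = a.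
Proof.
move=> ha hB; have pn : pi != 0 :> R by exact/lt0r_neq0/pi_gt0.
apply/funext => k; rewrite /ca /fcos !(Rintegral_FS_cos _ ha hB)/=.
move: pn; generalize (pi : R) => P pn.
by case: eqVneq => [->|k0] /=; field.
Qed.

(** The value [b 0] multiplies sin 0 and cannot be recovered, whence the mask that accompanies sine
    coefficients. *)
Lemma cb_FS a b A B k : hb 2 a A -> hb 2 b B -> cb (FS a b) k = (k != 0%N)%:R * b k.
Proof.
move=> ha hB; have pn : pi != 0 :> R by exact/lt0r_neq0/pi_gt0.
rewrite /cb /fsin (Rintegral_FS_sin _ ha hB).
by move: pn; generalize (pi : R) => P pn; field.
Qed.

Lemma hb_cb_FS s a b A B C : hb 2 a A -> hb 2 b B -> hb s b C -> hb s (cb (FS a b)) C.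
Proof.
move=> ha hB h; rewrite -[C]mul1r; apply: hb_dom h => // k.
rewrite (cb_FS _ ha hB) mul1r exprMn ler_wpM2l// ler_piMl ?sqr_ge0//.
by case: (k != 0%N); rewrite ?expr1n ?expr0n.
Qed.

Lemma inH_FS s a b A B : (2 <= s)%N -> hb s a A -> hb s b B -> inH s (FS a b).
Proof.
move=> s2 ha hB; have ha2 := hb_lower s2 ha; have hb2 := hb_lower s2 hB.
apply: (hb_inH (A := A) (B := B)).
- exact: periodic_FS.
- apply: sqint_continuous; exact: (continuous_FS ha2 hb2).
- by rewrite (ca_FS ha2 hb2).
- exact: hb_cb_FS ha2 hb2 hB.
Qed.

(** The difference is continuous, periodic and has no Fourier coefficient left, so completeness
    applies. *)
Lemma FS_coef f A B : continuous f -> periodic2pi f -> hb 2 (ca f) A -> hb 2 (cb f) B ->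
  forall x, f x = FS (ca f) (cb f) x.
Proof.
move=> cf pf ha hB x; apply/eqP; rewrite -subr_eq0; apply/eqP; move: x.
have cFS : continuous (FS (ca f) (cb f)) by exact: (continuous_FS ha hB).
have sf := sqint_continuous cf; have sF := sqint_continuous cFS.
have pn : pi^-1 != 0 :> R by rewrite invr_eq0; exact/lt0r_neq0/pi_gt0.
apply: trig_null_periodic_eq0.
- by move=> x; apply: continuousB; [exact: cf|exact: cFS].
- by move=> x; rewrite pf (periodic_FS (ca f) (cb f)).
move=> k; split; apply: (mulfI pn); rewrite mulr0.
- rewrite -[LHS]/(fcos (fun x => f x - FS (ca f) (cb f) x) k).
  have : ca (fun x => f x - FS (ca f) (cb f) x) k = 0.
    by rewrite caB// (ca_FS ha hB) subrr.
  rewrite /ca; case: eqVneq => [->|//] /eqP.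
  by rewrite mulf_eq0 invr_eq0 pnatr_eq0 orbF => /eqP.
- rewrite -[LHS]/(cb (fun x => f x - FS (ca f) (cb f) x) k).
  rewrite cbB// (cb_FS _ ha hB); case: eqVneq => [->|k0]; first by rewrite cb0 mul0r subrr.
  by rewrite mul1r subrr.
Qed.

End SobolevCoefficients.

(** * The equation in Fourier variables *)

Section Bracket.
Variable R : realType.
Implicit Types (x y a b : nat -> R) (A B e t th : R) (k n s : nat).

Definition up x n : R := if n is k.+2 then x k else 0.
(** Modes 1 and 0 land on the frequencies -1 and -2 with weights [wdn 1] = 3/2 and [wdn 0] = 1; they
    are recorded at 1 and 2. *)
Definition lowmode x n : R := (n == 1%N)%:R * (3 / 2 * x 1%N) + (n == 2%N)%:R * x 0%N.
Definition wup k : R := 1 - k%:R / 2.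
Definition wdn k : R := 1 + k%:R / 2.

Definition pm (b : bool) : R := if b then 1 else -1.

(* Fourier coefficients of [{f, sin (2 th)}]: the mode k is sent to k + 2 with
   weight [wup k] and to |k - 2| with weight [wdn k]; the modes k = 0, 1 are folded
   back with the parity sign. *)
Definition brk (ev : bool) x n : R := up (fun k => wup k * x k) n +
  (if ev || (n != 0%N) then wdn n.+2 * x n.+2 else 0) +
  pm ev * lowmode x n.

Lemma hb_affine s x B (w : nat -> R) : (forall k, `|w k| <= k%:R + 1) ->
  hb s.+1 x B -> hb s (fun k => w k * x k) (2 * B).
Proof.
move=> hw; apply: hb_dom => // k; rewrite exprMn.
have h : w k ^+ 2 <= 2 * wt k by apply: le_trans (sqr_le_of_norm (hw k)) (sqr_succ_le_wt R k).
rewrite (_ : _ * (_ * _) = wt k ^+ s * x k ^+ 2 * w k ^+ 2); last by ring.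
rewrite (_ : 2 * (wt k ^+ s.+1 * x k ^+ 2) = wt k ^+ s * x k ^+ 2 * (2 * wt k)); last first.
  by rewrite (exprSr (wt k)); ring.
by rewrite ler_wpM2l ?hb_term_ge0.
Qed.

Lemma wup_le k : `|wup k| <= k%:R + 1.
Proof. by have := ler0n R k; rewrite /wup ler_norml => k0; apply/andP; split; lra. Qed.

Lemma wdn_le k : `|wdn k| <= k%:R + 1.
Proof. by have := ler0n R k; rewrite /wdn ler_norml => k0; apply/andP; split; lra. Qed.

Lemma hb_up s x B : hb s x B -> hb s (up x) (5 ^+ s * B).
Proof. exact: hb_unshift. Qed.

Lemma hb_lowmode s x : exists B, hb s (lowmode x) B.
Proof.
exists (\sum_(0 <= k < 3) wt k ^+ s * lowmode x k ^+ 2); apply: hb_finite => k k3.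
by rewrite /lowmode !gtn_eqF ?mul0r ?addr0// (leq_trans _ k3).
Qed.

Lemma series_down (u : nat -> R) (l : R) : series (fun n => u n.+2) @ \oo --> l ->
  series u @ \oo --> u 0%N + u 1%N + l.
Proof.
move=> h; rewrite -(cvg_shiftn 2).
have -> : (fun n => series u (n + 2)%N) = (fun n => u 0%N + u 1%N + series (fun n => u n.+2) n).
  by apply/funext => n; rewrite addn2 /series/= sum_shift2.
by apply: cvgD => //; exact: cvg_cst.
Qed.

Lemma l1_add a b A B : l1 a A -> l1 b B -> l1 (fun k => a k + b k) (A + B).
Proof.
move=> ha hB K; apply: le_trans (lerD (ha K) (hB K)).
by rewrite -big_split/=; apply: ler_sum => k _; exact: ler_normD.
Qed.

(** Product formulas split each term of the series into a part X at frequency k + 2 and a part Y at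
    frequency k - 2; both series converge separately and are reindexed. *)
Lemma FS_bracket a b A B th : hb 2 a A -> hb 2 b B ->
  FS a b th * (2 * cos (2 * th)) - sin (2 * th) * FS (dk b) (fun k => - dk a k) th =
  FS (brk true a) (brk false b) th.
Proof.
move=> ha hB.
have la := hb_l1 (hb_lower (isT : 1 <= 2)%N ha).
have lb := hb_l1 (hb_lower (isT : 1 <= 2)%N hB).
have la1 := l1N (l1_dk ha); have lb1 := l1_dk hB.
have ua := hb_l1 (hb_up (hb_affine wup_le ha)); have ub := hb_l1 (hb_up (hb_affine wup_le hB)).
have da := hb_l1 (hb_shift (hb_affine wdn_le ha)); have db := hb_l1 (hb_shift (hb_affine wdn_le hB)).
have [Ea /hb_l1 ea] := hb_lowmode 1 a; have [Eb /hb_l1 eb] := hb_lowmode 1 b.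
have cL : series (fun k => trg a b th k * (2 * cos (2 * th)) -
     sin (2 * th) * trg (dk b) (fun k => - dk a k) th k) @ \oo -->
   FS a b th * (2 * cos (2 * th)) - sin (2 * th) * FS (dk b) (fun k => - dk a k) th.
  have -> : series (fun k => trg a b th k * (2 * cos (2 * th)) -
     sin (2 * th) * trg (dk b) (fun k => - dk a k) th k) =
     fun N => series (trg a b th) N * (2 * cos (2 * th)) -
       sin (2 * th) * series (trg (dk b) (fun k => - dk a k) th) N.
    apply/funext => N; rewrite /series/= mulr_suml mulr_sumr -sumrB.
    by apply: eq_bigr.
  by apply: cvgB; apply: cvgM; [exact: (FS_cvg (x := th) la lb)|exact: cvg_cst|
    exact: cvg_cst|exact: (FS_cvg (x := th) lb1 la1)].
pose X k := wup k * (a k * cos (k.+2%:R * th) + b k * sin (k.+2%:R * th)).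
pose Y k := wdn k * (a k * cos ((k%:R - 2) * th) + b k * sin ((k%:R - 2) * th)).
have cX : series X @ \oo --> FS (up (fun k => wup k * a k)) (up (fun k => wup k * b k)) th.
  have c := FS_cvg (x := th) ua ub; rewrite -(cvg_shiftn 2) in c.
  have E : (fun n => series (trg (up (fun k => wup k * a k)) (up (fun k => wup k * b k)) th)
      (n + 2)%N) = series X.
    apply/funext => n; rewrite addn2 /series/= sum_shift2 /trg/= !mul0r !add0r.
    by apply: eq_bigr => k _; rewrite /X; ring.
  by rewrite E in c.
have cY : series Y @ \oo --> Y 0%N + Y 1%N +
    FS (fun k => wdn k.+2 * a k.+2) (fun k => wdn k.+2 * b k.+2) th.
  apply: series_down; have c := FS_cvg (x := th) da db.
  have E : series (trg (fun k => wdn k.+2 * a k.+2) (fun k => wdn k.+2 * b k.+2) th) =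
      series (fun n => Y n.+2).
    congr series; apply/funext => k; rewrite /Y /trg (_ : k.+2%:R - 2 = k%:R).
      by ring.
    by rewrite natSS addrK.
  by rewrite E in c.
have EXY : (fun k => trg a b th k * (2 * cos (2 * th)) -
     sin (2 * th) * trg (dk b) (fun k => - dk a k) th k) = fun k => X k + Y k.
  apply/funext => k; rewrite /X /Y /trg /dk /wup /wdn (natSS R k).
  rewrite (mulrDl k%:R 2 th) (mulrBl th k%:R 2) cosB sinB cosD sinD.
  by field.
have cR : series (fun k => trg a b th k * (2 * cos (2 * th)) -
     sin (2 * th) * trg (dk b) (fun k => - dk a k) th k) @ \oo -->
   FS (up (fun k => wup k * a k)) (up (fun k => wup k * b k)) th + (Y 0%N + Y 1%N +
    FS (fun k => wdn k.+2 * a k.+2) (fun k => wdn k.+2 * b k.+2) th).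
  by rewrite EXY -[series _]/(series (X + Y)) seriesD; exact: cvgD.
rewrite (cvg_unique _ cL cR)//.
(* These two terms have negative frequency: cosine is even and sine is odd, whence the sign on b. *)
have EY : Y 0%N + Y 1%N = FS (lowmode a) (fun k => (-1) * lowmode b k) th.
  rewrite /FS (@series_eventually0_lim _ _ 3).
    rewrite 3?big_nat_recr//= big_geq// add0r /Y /trg /lowmode /wdn /=.
    rewrite (_ : (0 - 2) * th = - (2 * th)); last by ring.
    rewrite (_ : (1 - 2) * th = - (1 * th)); last by ring.
    by rewrite !cosN !sinN; field.
  move=> k k3; rewrite /trg /lowmode !(gtn_eqF (leq_trans _ k3))//.
  by rewrite !mul0r addr0 mulr0 !mul0r addr0.
have eb' : l1 (fun k => (-1) * lowmode b k) (Num.sqrt (3 * Eb)).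
  by move=> K; under eq_bigr do rewrite mulN1r normrN; exact: eb.
rewrite EY addrCA addrC -(FSD _ ua ub da db) -(FSD _ (l1_add ua da) (l1_add ub db) ea eb').
rewrite /FS; congr (limn (series _)); apply/funext => k; rewrite /trg /brk /=.
by case: k => [|k]; rewrite ?mul0r ?sin0 ?mulr0 ?mul1r.
Qed.

End Bracket.

(** * The velocity and the band operators of the system *)

Section Velocity.
Variable R : realType.
Implicit Types (x y a b : nat -> R) (A B e t th : R) (k n s : nat) (ev p : bool).

(** At k = 0 the first summand vanishes since [0^-1 = 0], which leaves the integration constant. *)
Definition va a k : R := - k%:R^-1 * a k + (k == 0%N)%:R * prim0 a.
Definition vb b k : R := - k%:R^-1 * b k.

Lemma invn_le1 k : `|k%:R^-1 : R| <= 1.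
Proof.
rewrite ger0_norm ?invr_ge0//; case: k => [|k]; first by rewrite invr0.
by rewrite invf_le1// ler1n.
Qed.

Lemma hb_vb s b B : hb s b B -> hb s (vb b) B.
Proof.
rewrite -[B in X in _ -> X]mul1r; apply: hb_dom => // k; rewrite mul1r /vb exprMn sqrrN.
apply: ler_wpM2l => //; rewrite ler_piMl ?sqr_ge0//.
by have := sqr_le_of_norm (invn_le1 k); rewrite expr1n.
Qed.

Lemma hb_mode0 s (c : R) : hb s (fun k => (k == 0%N)%:R * c) (c ^+ 2).
Proof.
have h : forall k, (1 <= k)%N -> (k == 0%N)%:R * c = 0 by case=> // k _; rewrite mul0r.
move=> K; apply: le_trans (hb_finite s h K) _.
by rewrite big_nat1 eqxx wt0 expr1n !mul1r.
Qed.

Lemma hb_va s a A : hb s a A -> hb s (va a) (2 * A + 2 * (prim0 a ^+ 2)).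
Proof. by move=> ha; apply: hbD; [exact: hb_vb|exact: hb_mode0]. Qed.

Definition vel a b (t : R) : R := FS (va a) (vb b) t.

Lemma is_derive_vel a b A B th : hb 3 a A -> hb 3 b B ->
  is_derive th 1 (vel a b) (FS (fun k => - ((k != 0%N)%:R * b k)) a th).
Proof.
move=> ha hB; have := is_derive_FS th (hb_va ha) (hb_vb hB).
have -> // : FS (dk (vb b)) (fun k => - dk (va a) k) th =
  FS (fun k => - ((k != 0%N)%:R * b k)) a th.
rewrite /FS; congr (limn (series _)); apply/funext => k; rewrite /trg /dk /va /vb.
case: k => [|k]; first by rewrite /= !mul0r sin0; ring.
have k1 : k.+1%:R != 0 :> R by [].
by rewrite /= mul0r addr0 mul1r !(mulrA k.+1%:R) mulrN divff// !mulN1r opprK.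
Qed.

Lemma vel0 a b A B : hb 2 a A -> hb 2 b B -> vel a b 0 = 0.
Proof.
move=> ha hB; have h0 := hb_lower (isT : 0 <= 2)%N ha.
have c1 := prim0_cvg h0.
have e1 : series (fun k => (k == 0%N)%:R * prim0 a) @ \oo --> prim0 a.
  have h : forall k, (1 <= k)%N -> (k == 0%N)%:R * prim0 a = 0 by case=> // k _; rewrite mul0r.
  by have := series_eventually0 h; rewrite big_nat1 eqxx mul1r.
rewrite /vel /FS.
have -> : trg (va a) (vb b) 0 = fun k => (k == 0%N)%:R * prim0 a - k%:R^-1 * a k.
  by apply/funext => k; rewrite /trg mulr0 cos0 sin0 mulr0 mulr1 addr0 /va addrC mulNr.
rewrite series_limB//; last exact: cvgP e1.
by rewrite (cvg_lim _ e1)// subrr.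
Qed.

(** The Fourier multiplier of half of eta plus or minus v, apart from the constant mode that [fco]
    adds. *)
Definition sg p k : R := 2^-1 - pm R p * k%:R^-1.

Definition fco ev p x k : R := sg p k * x k + (ev && (k == 0%N))%:R * (pm R p * prim0 x).

Lemma sg_le p k : `|sg p k| <= 3 / 2.
Proof.
have := invn_le1 k; rewrite /sg /pm !ler_norml => /andP[h1 h2].
by case: p; apply/andP; split; lra.
Qed.

Lemma hb_fco s ev p x B : hb s x B -> exists B', hb s (fco ev p x) B'.
Proof.
move=> h; eexists; apply: hbD.
  apply: (hb_dom (c := (3 / 2) ^+ 2) _ _ h) => [|k]; first exact: sqr_ge0.
  rewrite exprMn mulrCA; apply: ler_wpM2r; first exact: hb_term_ge0.
  exact: sqr_le_of_norm (sg_le p k).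
case: ev; first exact: hb_mode0.
by move=> K; rewrite big1 ?sqr_ge0// => k _; rewrite mul0r expr0n mulr0.
Qed.

Lemma FS_half_vel a b A B p th : hb 2 a A -> hb 2 b B ->
  FS a b th / 2 + pm R p * vel a b th = FS (fco true p a) (fco false p b) th.
Proof.
move=> ha hB.
have la := hb_l1 (hb_lower (isT : 1 <= 2)%N ha).
have lb := hb_l1 (hb_lower (isT : 1 <= 2)%N hB).
have lva := hb_l1 (hb_lower (isT : 1 <= 2)%N (hb_va ha)).
have lvb := hb_l1 (hb_lower (isT : 1 <= 2)%N (hb_vb hB)).
rewrite mulrC -(FSZ _ _ la lb) -(FSZ _ _ lva lvb).
have lz c (u : nat -> R) U : l1 u U -> l1 (fun k => c * u k) (`|c| * U).
  by move=> h K; under eq_bigr do rewrite normrM; rewrite -mulr_sumr ler_wpM2l.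
rewrite -(FSD _ (lz _ _ _ la) (lz _ _ _ lb) (lz _ _ _ lva) (lz _ _ _ lvb)).
by congr (FS _ _ th); apply/funext => k; rewrite /fco /sg /va /vb /=; ring.
Qed.

Lemma lie_bracket_FS a b A B th : hb 3 a A -> hb 3 b B ->
  lie_bracket (FS a b) (fun t => sin (2 * t)) th = FS (brk true a) (brk false b) th.
Proof.
move=> ha hB; rewrite -(FS_bracket th (hb_lower (isT : 2 <= 3)%N ha) (hb_lower (isT : 2 <= 3)%N hB)).
have d1 := is_derive_FS th ha hB; have d2 := is_derive1_sinZ 2 th.
by rewrite /lie_bracket !derive1E !derive_val.
Qed.

Lemma lie_bracket_flow a b A B p th : hb 3 a A -> hb 3 b B ->
  lie_bracket (fun t => FS a b t / 2 + pm R p * vel a b t) (fun t => sin (2 * t)) th =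
  FS (brk true (fco true p a)) (brk false (fco false p b)) th.
Proof.
move=> ha hB; have [A' ha'] := hb_fco true p ha; have [B' hb'] := hb_fco false p hB.
rewrite -(lie_bracket_FS th ha' hb'); congr (lie_bracket _ _ _); apply/funext => x.
exact: (FS_half_vel _ _ (hb_lower (isT : 2 <= 3)%N ha) (hb_lower (isT : 2 <= 3)%N hB)).
Qed.

(** The entries of [brk ev] composed with [fco ev p]. The exceptional terms at n = 1 and n = 2 come
    from [lowmode]; the 2 in [ocr] reflects that the bracket of the constant 1 with sin(2 th) is 2
    cos(2 th). *)
Definition ocp ev p n : R := if (n < 2)%N then 0 else
  wup R (n - 2) * sg p (n - 2) + (n == 2%N)%:R * (pm R ev / 2).
Definition ocd ev p n : R := (n == 1%N)%:R * (pm R ev * (3 / 2) * sg p 1).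
Definition ocq ev p n : R := if ev || (n != 0%N) then wdn R n.+2 * sg p n.+2 else 0.
Definition ocr ev p n : R := (ev && (n == 2%N))%:R * (2 * pm R p).

Lemma pm_le ev : `|pm R ev| <= 1.
Proof. by case: ev; rewrite /pm ?normrN normr1. Qed.

Lemma normM_le (u v M N : R) : `|u| <= M -> `|v| <= N -> `|u * v| <= M * N.
Proof. by move=> hu hv; rewrite normrM ler_pM. Qed.

Lemma normD_le (u v M N : R) : `|u| <= M -> `|v| <= N -> `|u + v| <= M + N.
Proof. by move=> hu hv; apply: le_trans (ler_normD _ _) _; apply: lerD. Qed.

Lemma norm_natb (c : bool) : `|c%:R : R| <= 1.
Proof. by case: c; rewrite ?normr1 ?normr0. Qed.

(** The 20 is a generous common bound for all entries; only its independence of k matters. *)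
Lemma ocp_le ev p k : `|ocp ev p k| <= 20 * (k%:R + 1).
Proof.
have k0 := ler0n R k; rewrite /ocp; case: ltnP => k2; first by rewrite normr0; lra.
have h1 := normM_le (wup_le R (k - 2)) (sg_le p (k - 2)).
have h2 := normM_le (norm_natb (k == 2%N)) (normM_le (pm_le ev) (lexx `|2^-1 : R|)).
apply: le_trans (normD_le h1 h2) _; rewrite natrB// ger0_norm; lra.
Qed.

Lemma ocd_le ev p k : `|ocd ev p k| <= 20.
Proof.
have h := normM_le (norm_natb (k == 1%N)) (normM_le (normM_le (pm_le ev) (lexx `|3 / 2 : R|)) (sg_le p 1)).
by apply: le_trans h _; rewrite ger0_norm; lra.
Qed.

Lemma ocr_le ev p k : `|ocr ev p k| <= 20.
Proof.
have h := normM_le (norm_natb (ev && (k == 2%N))) (normM_le (lexx `|2 : R|) (pm_le p)).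
by apply: le_trans h _; rewrite ger0_norm; lra.
Qed.

Lemma ocq_le ev p k : `|ocq ev p k| <= 20 * (k%:R + 1).
Proof.
have k0 := ler0n R k; rewrite /ocq; case: ifP => _; last by rewrite normr0; lra.
by apply: le_trans (normM_le (wdn_le R k.+2) (sg_le p k.+2)) _; rewrite (natSS R k); lra.
Qed.

(** The linear parts -z/4 and z/4 cancel: this is the antisymmetry that the energy estimate lives
    on. *)
Lemma principal_part (z c : R) : z != 0 -> z + 2 != 0 ->
  (1 - z / 2) * (2^-1 - c * z^-1) + (1 + (z + 2) / 2) * (2^-1 - c * (z + 2)^-1) =
  3 / 2 - c * z^-1 - c * (z + 2)^-1.
Proof. by move=> z1 z2; field; rewrite z1 z2. Qed.

Lemma ocpq_le ev p k : `|ocp ev p k.+2 + ocq ev p k| <= 20.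
Proof.
(* At k = 0 the convention [0^-1 = 0] and the [lowmode] term escape [principal_part], so each piece
   is bounded directly. *)
rewrite /ocp subn2 /= eqSS; case: k => [|k] /=.
  have h1 := normM_le (wup_le R 0) (sg_le p 0).
  have h2 := normM_le (norm_natb (0 == 0 :> nat)%N) (normM_le (pm_le ev) (lexx `|2^-1 : R|)).
  have h3 := ocq_le ev p 0; apply: le_trans (normD_le (normD_le h1 h2) _) _.
    rewrite /ocq; case: ifP => _; last by rewrite normr0; exact: (ler0n R 5).
    apply: le_trans (normM_le (wdn_le R 2) (sg_le p 2)) _; lra.
  by rewrite ger0_norm; lra.
rewrite /ocq orbT mul0r addr0 (_ : _ + _ = 3 / 2 - pm R p * k.+1%:R^-1 - pm R p * k.+3%:R^-1).
  have h1 := normM_le (pm_le p) (invn_le1 k.+1); have h3 := normM_le (pm_le p) (invn_le1 k.+3).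
  rewrite -!mulNr in h1 h3 *.
  have n1 : `|- pm R p * k.+1%:R^-1| <= 1 * 1 by rewrite mulNr normrN.
  have n3 : `|- pm R p * k.+3%:R^-1| <= 1 * 1 by rewrite mulNr normrN.
  by apply: le_trans (normD_le (normD_le (lexx `|3 / 2 : R|) n1) n3) _; rewrite ger0_norm; lra.
rewrite /sg /wup /wdn (natSS R k.+1); apply: principal_part => //.
Qed.

Lemma ocr0 ev p k : (3 <= k)%N -> ocr ev p k = 0.
Proof. by move=> k3; rewrite /ocr (gtn_eqF k3) andbF mul0r. Qed.

Definition opr ev p : bandop R := @Bandop R (ocp ev p) (ocd ev p) (ocq ev p) (ocr ev p) 20
  (ler0n R 20) erefl erefl (ocp_le ev p) (ocq_le ev p) (ocd_le ev p) (ocr_le ev p)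
  (ocr0 ev p) (ocpq_le ev p).

Lemma bapp_opr ev p x : bapp (opr ev p) x = brk ev (fco ev p x).
Proof.
have F : false%:R = 0 :> R by [].
apply/funext => n; rewrite /bapp /= /brk /fco /lowmode /ocp /ocd /ocq /ocr.
case: n => [|[|[|n]]] /=; rewrite ?subn2 /= ?orbT ?andbF ?andbT ?F.
- by case: ev => /=; ring.
- by ring.
- by rewrite /wup /pm /sg invr0; case: ev => /=; field.
- by ring.
Qed.

End Velocity.

(** * Continuity and differentiability of time-dependent coefficients *)

Section Families.
Variable R : realType.
Implicit Types (E F : R -> R -> R) (a b : R -> nat -> R) (B e t u th T d : R) (k s m : nat).

(** The bound may depend on t; with continuity it becomes uniform by compactness
    ([hcont_bounded]). *)
Definition hbd s T a := forall t, 0 <= t <= T -> exists B, hb s (a t) B.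

Definition hcont s T a := forall t e, 0 <= t <= T -> 0 < e ->
  exists2 d : R, 0 < d & forall u, 0 <= u <= T -> `|u - t| < d ->
    hb s (fun k => a u k - a t k) e.

(** The denominator is cleared, so u = t needs no exclusion; [hb] measures squared norms, whence the
    squared increment. *)
Definition hdiff s T a a' := forall t e, 0 <= t <= T -> 0 < e ->
  exists2 d : R, 0 < d & forall u, 0 <= u <= T -> `|u - t| < d ->
    hb s (fun k => a u k - a t k - (u - t) * a' t k) (e * (u - t) ^+ 2).

Lemma hb_mask s (x : nat -> R) B : hb s x B -> hb s (fun k => (k != 0%N)%:R * x k) B.
Proof.
rewrite -[B in X in _ -> X]mul1r; apply: hb_dom => // k; rewrite mul1r.
by case: (k != 0%N); rewrite ?mul1r ?mul0r ?expr0n ?mulr0 ?hb_term_ge0.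
Qed.

Lemma hcont_mask s T a : hcont s T a -> hcont s T (fun t k => (k != 0%N)%:R * a t k).
Proof.
move=> h t e tT e0; have [d d0 hd] := h t e tT e0; exists d => // u uT ud.
apply: hb_ext (hb_mask (hd u uT ud)) => k; by rewrite mulrBr.
Qed.

Lemma hdiff_mask s T a a' : hdiff s T a a' ->
  hdiff s T (fun t k => (k != 0%N)%:R * a t k) (fun t k => (k != 0%N)%:R * a' t k).
Proof.
move=> h t e tT e0; have [d d0 hd] := h t e tT e0; exists d => // u uT ud.
apply: hb_ext (hb_mask (hd u uT ud)) => k; by ring.
Qed.

Lemma cont_H_hcont s T E : cont_H s T E ->
  hcont s T (fun t => ca (E t)) /\ hcont s T (fun t => cb (E t)).
Proof.
move=> [hin hc].
have H t e : 0 <= t <= T -> 0 < e -> exists2 d : R, 0 < d & forall u, 0 <= u <= T -> `|u - t| < d ->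
    hb s (fun k => ca (E u) k - ca (E t) k) e /\ hb s (fun k => cb (E u) k - cb (E t) k) e.
  move=> tT e0; have e2 : 0 < e / 2 by rewrite divr_gt0.
  (* The half compensates the factor 2 of [Hnorm_hb]. *)
  have r0 : 0 < Num.sqrt (e / 2) by rewrite sqrtr_gt0.
  have [d d0 hd] := hc t tT _ r0; exists d => // u uT ud.
  have iu := hin u uT; have it := hin t tT.
  have su := inH_sqint iu; have st := inH_sqint it.
  have [A [ha hb']] := inH_hb iu; have [A' [ha' hb'']] := inH_hb it.
  have ha1 := hbB ha ha'; have hb1 := hbB hb' hb''.
  rewrite -(caB su st) in ha1; rewrite -(cbB su st) in hb1.
  have := Hnorm_hb (sob_cvg ha1 hb1).1 (ltW r0) (ltW (hd u uT ud)).
  rewrite (caB su st) (cbB su st) sqr_sqrtr ?(ltW e2)//.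
  by rewrite (_ : 2 * (e / 2) = e); last by field.
by split => t e tT e0; have [d d0 hd] := H t e tT e0; exists d => // u uT ud; case: (hd u uT ud).
Qed.

Lemma hcont_cont_H s T E : (forall t, 0 <= t <= T -> inH s (E t)) ->
  hcont s T (fun t => ca (E t)) -> hcont s T (fun t => cb (E t)) -> cont_H s T E.
Proof.
move=> hin ha hB; split => // t tT e e0; have e4 : 0 < e ^+ 2 / 4 by rewrite divr_gt0// exprn_gt0.
have [d1 d10 h1] := ha t _ tT e4; have [d2 d20 h2] := hB t _ tT e4.
exists (Num.min d1 d2) => [|u uT]; first by rewrite lt_min d10.
rewrite lt_min => /andP[u1 u2].
have su := inH_sqint (hin u uT); have st := inH_sqint (hin t tT).
apply: (@Hnorm_lt _ _ _ (e ^+ 2 / 4) (e ^+ 2 / 4)) => //.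
- by rewrite caB//; exact: h1.
- by rewrite cbB//; exact: h2.
- by have : 0 < e ^+ 2 by [rewrite exprn_gt0]; lra.
Qed.

Lemma deriv_H_hdiff s T E F : deriv_H s T E F ->
  hdiff s T (fun t => ca (E t)) (fun t => ca (F t)) /\
  hdiff s T (fun t => cb (E t)) (fun t => cb (F t)).
Proof.
move=> [hin hc].
have H t e : 0 <= t <= T -> 0 < e -> exists2 d : R, 0 < d & forall u, 0 <= u <= T -> `|u - t| < d ->
    hb s (fun k => ca (E u) k - ca (E t) k - (u - t) * ca (F t) k) (e * (u - t) ^+ 2) /\
    hb s (fun k => cb (E u) k - cb (E t) k - (u - t) * cb (F t) k) (e * (u - t) ^+ 2).
  move=> tT e0; have e2 : 0 < e / 2 by rewrite divr_gt0.
  have r0 : 0 < Num.sqrt (e / 2) by rewrite sqrtr_gt0.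
  have [d d0 hd] := hc t tT _ r0; exists d => // u uT ud.
  have [ut|ut] := eqVneq u t.
    have z (x y : nat -> R) : hb s (fun k => x k - x k - (t - t) * y k) (e * (t - t) ^+ 2).
      by move=> K; rewrite big1 ?subrr ?expr0n ?mulr0// => k _; rewrite !subrr mul0r subrr expr0n mulr0.
    by rewrite ut; split; exact: z.
  have ut0 : u - t != 0 by rewrite subr_eq0.
  have [iu _] := hin u uT; have [it jt] := hin t tT.
  have su := inH_sqint iu; have st := inH_sqint it; have sj := inH_sqint jt.
  have sut := sqintB su st; have sq := sqintZ (u - t)^-1 sut.
  have [A [ha hb']] := inH_hb iu; have [A' [ha' hb'']] := inH_hb it.
  have [C [hc1 hc2]] := inH_hb jt.
  have := hd u uT; rewrite normr_gt0 ut0 ud => /(_ isT).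
  have -> : (fun th => (E u th - E t th) / (u - t) - F t th) =
      (fun th => (u - t)^-1 * (E u th - E t th) - F t th).
    by apply/funext => th; rewrite mulrC.
  have ea : ca (fun th => (u - t)^-1 * (E u th - E t th) - F t th) =
      fun k => (u - t)^-1 * (ca (E u) k - ca (E t) k) - ca (F t) k.
    by rewrite (caB sq sj) (caZ _ sut) (caB su st).
  have eb : cb (fun th => (u - t)^-1 * (E u th - E t th) - F t th) =
      fun k => (u - t)^-1 * (cb (E u) k - cb (E t) k) - cb (F t) k.
    by rewrite (cbB sq sj) (cbZ _ sut) (cbB su st).
  have ha1 := hbB (hbZ (u - t)^-1 (hbB ha ha')) hc1; rewrite -ea in ha1.
  have hb1 := hbB (hbZ (u - t)^-1 (hbB hb' hb'')) hc2; rewrite -eb in hb1.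
  move=> /ltW /(Hnorm_hb (sob_cvg ha1 hb1).1 (ltW r0)).
  rewrite ea eb sqr_sqrtr ?(ltW e2)// (_ : 2 * (e / 2) = e); last by field.
  by move=> [/(hbZ (u - t)) h1 /(hbZ (u - t)) h2]; rewrite mulrC; split;
    [apply: hb_ext h1|apply: hb_ext h2] => k; rewrite mulrBr mulrA mulfV// mul1r.
by split => t e tT e0; have [d d0 hd] := H t e tT e0; exists d => // u uT ud; case: (hd u uT ud).
Qed.

Lemma hdiff_deriv_H s T E F : (forall t, 0 <= t <= T -> inH s (E t) /\ inH s (F t)) ->
  hdiff s T (fun t => ca (E t)) (fun t => ca (F t)) ->
  hdiff s T (fun t => cb (E t)) (fun t => cb (F t)) -> deriv_H s T E F.
Proof.
move=> hin ha hB; split => // t tT e e0; have e4 : 0 < e ^+ 2 / 4 by rewrite divr_gt0// exprn_gt0.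
have [d1 d10 h1] := ha t _ tT e4; have [d2 d20 h2] := hB t _ tT e4.
exists (Num.min d1 d2) => [|u uT]; first by rewrite lt_min d10.
rewrite lt_min normr_gt0 => /andP[ut0 /andP[u1 u2]].
have [/inH_sqint su _] := hin u uT; have [/inH_sqint st /inH_sqint sj] := hin t tT.
have sut := sqintB su st; have sq := sqintZ (u - t)^-1 sut.
have -> : (fun th => (E u th - E t th) / (u - t) - F t th) =
    (fun th => (u - t)^-1 * (E u th - E t th) - F t th).
  by apply/funext => th; rewrite mulrC.
have Z (x y z : nat -> R) : hb s (fun k => x k - y k - (u - t) * z k) (e ^+ 2 / 4 * (u - t) ^+ 2) ->
    hb s (fun k => (u - t)^-1 * (x k - y k) - z k) (e ^+ 2 / 4).
  move=> /(hbZ (u - t)^-1); rewrite (mulrC (e ^+ 2 / 4)) mulrA -exprMn mulVf// expr1n mul1r.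
  by apply: hb_ext => k; rewrite mulrBr mulrA mulVf// mul1r.
apply: (@Hnorm_lt _ _ _ (e ^+ 2 / 4) (e ^+ 2 / 4)) => //.
- by rewrite (caB sq sj) (caZ _ sut) (caB su st); exact/Z/h1.
- by rewrite (cbB sq sj) (cbZ _ sut) (cbB su st); exact/Z/h2.
- by have : 0 < e ^+ 2 by [rewrite exprn_gt0]; lra.
Qed.

Lemma hcont_bapp (o : bandop R) s T a : hbd s.+1 T a -> hcont s.+1 T a ->
  hcont s T (fun t => bapp o (a t)).
Proof.
move=> hB h t e tT e0; have [c c0 hc] := bapp_bound o s.
have c1 : 0 < c + 1 by rewrite ltr_wpDl.
have [d d0 hd] := h t (e / (c + 1)) tT (divr_gt0 e0 c1); exists d => // u uT ud.
have [Bu hu] := hB u uT; have [Bt ht] := hB t tT.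
have := hc _ _ (hd u uT ud); rewrite (funext (bappB o (hb_lower (leq0n _) hu) (hb_lower (leq0n _) ht))).
apply: hb_le; rewrite mulrA ler_pdivrMr// mulrC ler_wpM2l ?(ltW e0)// lerDl.
exact: ler01.
Qed.

Lemma hdiff_bapp (o : bandop R) s T a a' : hbd s.+1 T a -> hbd s.+1 T a' ->
  hdiff s.+1 T a a' -> hdiff s T (fun t => bapp o (a t)) (fun t => bapp o (a' t)).
Proof.
move=> hB hB' h t e tT e0; have [c c0 hc] := bapp_bound o s.
have c1 : 0 < c + 1 by rewrite ltr_wpDl.
have [d d0 hd] := h t (e / (c + 1)) tT (divr_gt0 e0 c1); exists d => // u uT ud.
have [Bu /(hb_lower (leq0n _)) hu] := hB u uT; have [Bt /(hb_lower (leq0n _)) ht] := hB t tT.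
have [Bt' /(hb_lower (leq0n _)) ht'] := hB' t tT.
have := hc _ _ (hd u uT ud).
rewrite (funext (bappB o (hbB hu ht) (hbZ (u - t) ht'))) (funext (bappB o hu ht)) (funext (bappZ o (u - t) ht')).
apply: hb_le; rewrite mulrA; apply: ler_wpM2r; first exact: sqr_ge0.
by rewrite mulrA ler_pdivrMr// mulrC ler_wpM2l ?(ltW e0)// lerDl ler01.
Qed.

(** Evaluation at th is continuous on h^1, which embeds into l^1, so a derivative in h^1 is also a
    pointwise one. *)
Lemma FS_time_derive T a b a' b' t th : hbd 1 T a -> hbd 1 T b -> hbd 1 T a' -> hbd 1 T b' ->
  hdiff 1 T a a' -> hdiff 1 T b b' -> 0 < t < T ->
  is_derive t 1 (fun u => FS (a u) (b u) th) (FS (a' t) (b' t) th).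
Proof.
move=> ha hB ha' hB' da db /andP[t0 tT]; apply: is_derive1_littleo => e e0.
have tT' : 0 <= t <= T by rewrite !ltW.
(* After the factor 3 of [hb_l1] and the square root, a and b contribute e / 2 each. *)
have e12 : 0 < e ^+ 2 / 12 by rewrite divr_gt0// exprn_gt0.
have [d1 d10 h1] := da t _ tT' e12; have [d2 d20 h2] := db t _ tT' e12.
exists (Num.min (Num.min d1 d2) (Num.min t (T - t))) => [|u].
  by rewrite !lt_min d10 d20 t0 subr_gt0.
rewrite !lt_min -!andbA => /and4P[u1 u2 u3 u4].
have uT : 0 <= u <= T.
  move: u3 u4; rewrite !ltr_norml => /andP[? _] /andP[_ ?]; apply/andP; split; lra.
have [A1 /hb_l1 la] := ha u uT; have [B1 /hb_l1 lb] := hB u uT.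
have [A2 /hb_l1 la2] := ha t tT'; have [B2 /hb_l1 lb2] := hB t tT'.
have [A3 ha3] := ha' t tT'; have [B3 hb3] := hB' t tT'.
have la3 := hb_l1 ha3; have lb3 := hb_l1 hb3.
have la3' := hb_l1 (hbZ (u - t) ha3); have lb3' := hb_l1 (hbZ (u - t) hb3).
have lau := hb_l1 (h1 u uT u1); have lbu := hb_l1 (h2 u uT u2).
have lB (x y : nat -> R) X Y : l1 x X -> l1 y Y -> l1 (fun k => x k - y k) (X + Y).
  by move=> hx hy; apply: l1_add => //; exact: l1N.
rewrite -(FSB _ la lb la2 lb2) -(FSZ _ _ la3 lb3).
rewrite -(FSB _ (lB _ _ _ _ la la2) (lB _ _ _ _ lb lb2) la3' lb3').
apply: le_trans (FS_norm _ lau lbu) _.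
rewrite (_ : 3 * (e ^+ 2 / 12 * (u - t) ^+ 2) = (e / 2 * (u - t)) ^+ 2); last by field.
by rewrite sqrtr_sqr normrM ger0_norm ?divr_ge0 ?(ltW e0)// -mulrDl -splitr.
Qed.

End Families.

(** * Existence and uniqueness *)

Section Existence.
Variable R : realType.
Implicit Types (a b : R -> nat -> R) (v : nat -> R) (B e t u th T d : R) (k s m : nat) (p : bool).

(* The equation for one sign: [p = true] is the one for eta^+, [p = false] for eta^-. *)
Definition solves m T p (e0 : R -> R) (eta : R -> R -> R) : Prop :=
  [/\ cont_H m T eta, C2_H (m - 2) T eta, (forall th, eta 0 th = e0 th) &
    exists w : R -> R -> R, forall t, 0 < t <= T ->
      [/\ forall th, [/\ derivable (eta t) th 1, derivable (w t) th 1 &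
            is_hilbert (eta t) th (derive1 (w t) th)],
          w t 0 = 0 &
          t < T -> forall th, derivable (fun u => eta u th) t 1 /\
            derive1 (fun u => eta u th) t =
              lie_bracket (fun x => eta t x / 2 + pm R p * w t x) (fun x => sin (2 * x)) th]].

Lemma hbd_lower s s' T a : (s <= s')%N -> hbd s' T a -> hbd s T a.
Proof. by move=> ss h t tT; have [B hB] := h t tT; exists B; exact: hb_lower hB. Qed.

Lemma hdiff_lower s s' T a a' : (s <= s')%N -> hdiff s' T a a' -> hdiff s T a a'.
Proof.
move=> ss h t e tT e0; have [d d0 hd] := h t e tT e0; exists d => // u uT ud.
exact: hb_lower (hd u uT ud).
Qed.

Lemma hbd_bapp (o : bandop R) s T a : hbd s.+1 T a -> hbd s T (fun t => bapp o (a t)).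
Proof.
by move=> h t tT; have [B hB] := h t tT; have [c _ hc] := bapp_bound o s; exists (c * B); exact: hc.
Qed.

Lemma flow_hbd (o : bandop R) s v B T : hb s v B -> hbd s T (flow o v).
Proof.
move=> h t /andP[t0 tT]; have [B' hB'] := flow_bound o T h; exists B'.
by apply: hB'; rewrite ger0_norm.
Qed.

Lemma flow_hcont (o : bandop R) s v B T : hb s v B -> hcont s T (flow o v).
Proof.
move=> h t e tT e0; have [d d0 hd] := flow_continuous o h t e0.
by exists d => // u _; exact: hd.
Qed.

Lemma flow_hdiff (o : bandop R) s v B T : hb s.+1 v B ->
  hdiff s T (flow o v) (fun t => bapp o (flow o v t)).
Proof.
move=> h t e tT e0; have [d d0 hd] := flow_derive o h t e0.
by exists d => // u _; exact: hd.
Qed.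

Lemma ca_FS_fun s T a b t : (2 <= s)%N -> hbd s T a -> hbd s T b -> 0 <= t <= T ->
  ca (FS (a t) (b t)) = a t /\ cb (FS (a t) (b t)) = fun k => (k != 0%N)%:R * b t k.
Proof.
move=> s2 ha hB tT; have [A /(hb_lower s2) hA] := ha t tT; have [B /(hb_lower s2) hB'] := hB t tT.
by split; [exact: ca_FS hA hB'|apply/funext => k; exact: (cb_FS _ hA hB')].
Qed.

Lemma inH_FS_fun s T a b t : (2 <= s)%N -> hbd s T a -> hbd s T b -> 0 <= t <= T ->
  inH s (FS (a t) (b t)).
Proof.
by move=> s2 ha hB tT; have [A hA] := ha t tT; have [B hB'] := hB t tT; exact: inH_FS hA hB'.
Qed.

Lemma hcont_ext s T a b : (forall t, 0 <= t <= T -> a t = b t) -> hcont s T a -> hcont s T b.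
Proof.
move=> E h t e tT e0; have [d d0 hd] := h t e tT e0; exists d => // u uT ud.
by rewrite -!E//; exact: hd.
Qed.

Lemma hdiff_ext s T a b a' b' : (forall t, 0 <= t <= T -> a t = b t) ->
  (forall t, 0 <= t <= T -> a' t = b' t) -> hdiff s T a a' -> hdiff s T b b'.
Proof.
move=> E E' h t e tT e0; have [d d0 hd] := h t e tT e0; exists d => // u uT ud.
by rewrite -!E// -E'//; exact: hd.
Qed.

(* At t = 0 the datum itself is used: it agrees with its Fourier series only almost
   everywhere. *)
Definition flow_sol p (e0 : R -> R) t : R -> R :=
  if t == 0 then e0 else FS (flow (opr R true p) (ca e0) t) (flow (opr R false p) (cb e0) t).

Lemma solves_flow_sol s p (e0 : R -> R) T : (2 <= s)%N -> inH s.+2 e0 -> 0 < T ->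
  solves s.+2 T p e0 (flow_sol p e0).
Proof.
move=> s2 he T0; rewrite /solves subn2 /=.
have [A [ha hB]] := inH_hb he.
set oa := opr R true p; set ob := opr R false p.
pose a := flow oa (ca e0); pose b := flow ob (cb e0).
pose a1 (t : R) := bapp oa (a t); pose b1 (t : R) := bapp ob (b t).
pose a2 (t : R) := bapp oa (a1 t); pose b2 (t : R) := bapp ob (b1 t).
have Ha : hbd s.+2 T a := flow_hbd oa ha; have Hb : hbd s.+2 T b := flow_hbd ob hB.
have Ha1 : hbd s.+1 T a1 := hbd_bapp oa Ha; have Hb1 : hbd s.+1 T b1 := hbd_bapp ob Hb.
have Ha2 : hbd s T a2 := hbd_bapp oa Ha1; have Hb2 : hbd s T b2 := hbd_bapp ob Hb1.
have Ca : hcont s.+2 T a := flow_hcont oa ha; have Cb : hcont s.+2 T b := flow_hcont ob hB.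
have Da : hdiff s.+1 T a a1 := flow_hdiff oa ha; have Db : hdiff s.+1 T b b1 := flow_hdiff ob hB.
have Ca2 : hcont s T a2 := hcont_bapp oa (hbd_bapp oa Ha) (hcont_bapp oa Ha Ca).
have Cb2 : hcont s T b2 := hcont_bapp ob (hbd_bapp ob Hb) (hcont_bapp ob Hb Cb).
have Da1 : hdiff s T a1 a2 := hdiff_bapp oa (hbd_lower (leqnSn _) Ha) Ha1 Da.
have Db1 : hdiff s T b1 b2 := hdiff_bapp ob (hbd_lower (leqnSn _) Hb) Hb1 Db.
have s22 : (2 <= s.+2)%N by []. have s12 : (2 <= s.+1)%N by exact: ltnW.
pose E1 (t : R) := FS (a1 t) (b1 t); pose E2 (t : R) := FS (a2 t) (b2 t).
have caE t : 0 <= t <= T -> ca (flow_sol p e0 t) = a t.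
  rewrite /flow_sol; case: eqP => [->|_] tT; last by case: (ca_FS_fun s22 Ha Hb tT).
  by rewrite /a (flow0 _ (hb_lower (leq0n _) ha)).
(* At t = 0 the mask changes nothing, by [cb0]; for other t it comes from [cb_FS]. *)
have cbE t : 0 <= t <= T -> cb (flow_sol p e0 t) = fun k => (k != 0%N)%:R * b t k.
  rewrite /flow_sol; case: eqP => [->|_] tT; last by case: (ca_FS_fun s22 Ha Hb tT).
  rewrite /b (flow0 _ (hb_lower (leq0n _) hB)); apply/funext => k.
  by case: k => [|k]; rewrite ?mul1r// cb0 mul0r.
have inE t : 0 <= t <= T -> inH s.+2 (flow_sol p e0 t).
  by rewrite /flow_sol; case: eqP => [_ _|_ tT]; [exact: he|exact: (@inH_FS_fun s.+2 T a b t s22 Ha Hb tT)].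
have inE' t : 0 <= t <= T -> inH s (flow_sol p e0 t).
  move=> tT; have i := inE t tT; have [C [h1 h2]] := inH_hb i; have [i1 _ _ _] := i.
  have ss : (s <= s.+2)%N by rewrite -addn2 leq_addr.
  exact: (hb_inH i1 (inH_sqint i) (hb_lower ss h1) (hb_lower ss h2)).
have in1 t : 0 <= t <= T -> inH s (E1 t).
  by move=> tT; exact: (inH_FS_fun s2 (hbd_lower (leqnSn _) Ha1) (hbd_lower (leqnSn _) Hb1) tT).
have in2 t : 0 <= t <= T -> inH s (E2 t) by exact: (@inH_FS_fun s T a2 b2 t s2 Ha2 Hb2).
have [ca1 cb1] : (forall t, 0 <= t <= T -> ca (E1 t) = a1 t) /\
    (forall t, 0 <= t <= T -> cb (E1 t) = fun k => (k != 0%N)%:R * b1 t k).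
  by split => t tT; case: (ca_FS_fun s12 Ha1 Hb1 tT).
have [ca2 cb2] : (forall t, 0 <= t <= T -> ca (E2 t) = a2 t) /\
    (forall t, 0 <= t <= T -> cb (E2 t) = fun k => (k != 0%N)%:R * b2 t k).
  by split => t tT; case: (ca_FS_fun s2 Ha2 Hb2 tT).
have sym (x y : R -> nat -> R) : (forall t, 0 <= t <= T -> x t = y t) ->
    forall t, 0 <= t <= T -> y t = x t by move=> h t tT; rewrite h.
split.
- apply: hcont_cont_H => //.
    exact: (hcont_ext (sym _ _ caE) Ca).
  exact: (hcont_ext (sym _ _ cbE) (hcont_mask Cb)).
- exists E1, E2; split.
  + apply: hdiff_deriv_H; first by move=> t tT; split; [exact: inE'|exact: in1].
      exact: (hdiff_ext (sym _ _ caE) (sym _ _ ca1) (hdiff_lower (leqnSn _) Da)).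
    exact: (hdiff_ext (sym _ _ cbE) (sym _ _ cb1) (hdiff_mask (hdiff_lower (leqnSn _) Db))).
  + apply: hdiff_deriv_H; first by move=> t tT; split; [exact: in1|exact: in2].
      exact: (hdiff_ext (sym _ _ ca1) (sym _ _ ca2) Da1).
    exact: (hdiff_ext (sym _ _ cb1) (sym _ _ cb2) (hdiff_mask Db1)).
  + apply: hcont_cont_H => //.
      exact: (hcont_ext (sym _ _ ca2) Ca2).
    exact: (hcont_ext (sym _ _ cb2) (hcont_mask Cb2)).
- by move=> th; rewrite /flow_sol eqxx.
exists (fun t => vel (a t) (b t)) => t /andP[t0 tT].
have tT' : 0 <= t <= T by rewrite tT ltW.
have et : flow_sol p e0 t = FS (a t) (b t) by rewrite /flow_sol gt_eqF.
have s3 : (3 <= s.+2)%N by [].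
have [A3 /(hb_lower s3) ha3] := Ha t tT'; have [B3 /(hb_lower s3) hb3] := Hb t tT'.
rewrite et; split.
- move=> th; have dF := is_derive_FS th ha3 hb3; have dv := is_derive_vel th ha3 hb3.
  by split => //; rewrite derive1E derive_val; exact: is_hilbert_FS.
- exact: (vel0 (hb_lower (isT : 2 <= 3)%N ha3) (hb_lower (isT : 2 <= 3)%N hb3)).
move=> tltT th; have s1 : (1 <= s)%N by exact: ltnW.
have l1' s' x : (s <= s')%N -> hbd s' T x -> hbd 1 T x.
  by move=> ss; apply: hbd_lower; exact: leq_trans ss.
have t0T : 0 < t < T by rewrite t0.
have D := FS_time_derive th (hbd_lower (isT : 1 <= s.+2)%N Ha) (hbd_lower (isT : 1 <= s.+2)%N Hb)
  (hbd_lower (isT : 1 <= s.+1)%N Ha1) (hbd_lower (isT : 1 <= s.+1)%N Hb1)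
  (hdiff_lower (isT : 1 <= s.+1)%N Da) (hdiff_lower (isT : 1 <= s.+1)%N Db) t0T.
(* Near t > 0 the exceptional value of [flow_sol] at time 0 is not met. *)
have D' : is_derive t 1 (fun u => flow_sol p e0 u th) (FS (a1 t) (b1 t) th).
  apply: near_eq_is_derive D.
  near=> u; rewrite /flow_sol gt_eqF//; near: u; exact: lt_nbhsr.
split => //; rewrite derive1E derive_val (lie_bracket_flow p th ha3 hb3).
by rewrite -!bapp_opr.
Unshelve. all: by end_near.
Qed.

End Existence.

Section Uniqueness.
Variable R : realType.
Implicit Types (a b : R -> nat -> R) (v : nat -> R) (B e t u th T d : R) (k s m : nat) (p : bool).

Lemma hb_norm s v B k : hb s v B -> `|v k| <= Num.sqrt B.
Proof.
move=> h; have B0 := hb_ge0 h; rewrite -sqrtr_sqr ler_sqrt//.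
apply: le_trans (hb_term k h); rewrite ler_peMl ?sqr_ge0//.
by rewrite exprn_ege1// wt_ge1.
Qed.

Lemma hdiff_is_derive s T a a' t k : hdiff s T a a' -> 0 < t < T ->
  is_derive t 1 (a ^~ k) (a' t k).
Proof.
move=> h /andP[t0 tT]; apply: is_derive1_littleo => e e0.
have tT' : 0 <= t <= T by rewrite !ltW.
have [d d0 hd] := h t _ tT' (exprn_gt0 2 e0).
exists (Num.min d (Num.min t (T - t))) => [|u]; first by rewrite !lt_min d0 t0 subr_gt0.
rewrite !lt_min => /and3P[u1 u3 u4].
have uT : 0 <= u <= T.
  by move: u3 u4; rewrite !ltr_norml => /andP[? _] /andP[_ ?]; apply/andP; split; lra.
have := hb_norm k (hd u uT u1).
by rewrite -exprMn sqrtr_sqr normrM (gtr0_norm e0).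
Qed.

Lemma hcontB s T a b : hcont s T a -> hcont s T b -> hcont s T (fun t k => a t k - b t k).
Proof.
move=> ha hB t e tT e0; have e4 : 0 < e / 4 by rewrite divr_gt0.
have [d1 d10 h1] := ha t _ tT e4; have [d2 d20 h2] := hB t _ tT e4.
exists (Num.min d1 d2) => [|u uT]; first by rewrite lt_min d10.
rewrite lt_min => /andP[u1 u2].
have := hbB (h1 u uT u1) (h2 u uT u2).
rewrite (_ : 2 * (e / 4) + 2 * (e / 4) = e); last by field.
by apply: hb_ext => k; ring.
Qed.

Lemma hcont_within s T T' a k : T' <= T -> hcont s T a ->
  {within `[0, T'], continuous (a ^~ k)}.
Proof.
move=> TT h; apply/subspace_continuousP => t /=; rewrite in_itv/= => /andP[t0 tT'].
apply/cvgrPdist_le => e e0.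
have tT : 0 <= t <= T by rewrite t0 (le_trans tT').
have [d d0 hd] := h t _ tT (exprn_gt0 2 e0).
rewrite near_withinE; exists d => //= u /= ud; rewrite in_itv/= => /andP[u0 uT'].
have uT : 0 <= u <= T by rewrite u0 (le_trans uT').
rewrite distrC; rewrite /ball/= distrC in ud.
by have := hb_norm k (hd u uT ud); rewrite sqrtr_sqr (gtr0_norm e0).
Qed.

Lemma hcont_bounded s T a : hbd s T a -> hcont s T a ->
  exists B, forall t, 0 <= t <= T -> hb s (a t) B.
Proof.
move=> ha hc; apply: (@locally_bounded_segment _ (fun t B => hb s (a t) B)).
  by move=> u B B'; exact: hb_le.
move=> t tT; have [d d0 hd] := hc t 1 tT ltr01; have [B hB] := ha t tT.
exists d => //; exists (2 * 1 + 2 * B) => u uT ud.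
by apply: hb_ext (hbD (hd u uT ud) hB) => k; rewrite subrK.
Qed.

(** [bapp_unique] concludes at the end of its interval only, so it is applied on [0, T'] for every
    T'. *)
Lemma ode_unique (o : bandop R) s T a b : (2 <= s)%N ->
  hbd s T a -> hbd s T b -> hcont s T a -> hcont s T b ->
  (forall t k, 0 < t < T -> is_derive t 1 (a ^~ k) (bapp o (a t) k)) ->
  (forall t k, 0 < t < T -> is_derive t 1 (b ^~ k) (bapp o (b t) k)) ->
  a 0 = b 0 -> forall t, 0 <= t <= T -> a t = b t.
Proof.
move=> s2 ha hB ca' cb' da db ab0 T' /andP[T'0 T'T]; apply/funext => k.
have [A hA] := hcont_bounded ha ca'; have [B hB'] := hcont_bounded hB cb'.
have sub t : 0 <= t <= T' -> 0 <= t <= T by move=> /andP[-> /le_trans]; exact.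
pose Z (t : R) j := a t j - b t j; have cZ : hcont s T Z by exact: hcontB.
apply/eqP; rewrite -subr_eq0 -/(Z T' k); apply/eqP.
apply: (@bapp_unique _ o Z T' (2 * A + 2 * B) T'0).
- by move=> t /sub tT; apply: hb_lower s2 _; apply: hbB; [exact: hA|exact: hB'].
- by move=> j; exact: (hcont_within (k := j) T'T cZ).
- move=> t j /andP[t0 tT']; have tT : 0 < t < T by rewrite t0 (lt_le_trans tT').
  have tT2 : 0 <= t <= T by rewrite (ltW t0) (ltW (lt_le_trans tT' T'T)).
  rewrite /Z (bappB o (hb_lower (leq0n _) (hA t tT2)) (hb_lower (leq0n _) (hB' t tT2))).
  exact: is_derive1B (da t j tT) (db t j tT).
- by move=> j; rewrite /Z ab0 subrr.
Qed.

Lemma derive_eq (f g df : R -> R) : (forall x : R, is_derive x 1 f (df x)) ->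
  (forall x : R, is_derive x 1 g (df x)) -> f 0 = g 0 -> f = g.
Proof.
move=> hf hg fg0; apply/funext => x.
have [c _] := MVT_dist 0 x (fun s : R => is_derive1B (hf s) (hg s)).
by rewrite subrr mul0r fg0 subrr subr0 => /eqP; rewrite subr_eq0 => /eqP.
Qed.

Lemma hilbert_unique (f : R -> R) th (l l' : R) : is_hilbert f th l -> is_hilbert f th l' -> l = l'.
Proof. by move=> h h'; exact: (cvg_unique _ h h'). Qed.

(** This matches [cb0] and settles mode 0, which a comparison of sine series cannot see. *)
Lemma bapp_opr_sin0 p v : bapp (opr R false p) v 0%N = 0.
Proof. by rewrite /bapp /= /ocp /ocd /ocq /ocr /= !mul0r !addr0. Qed.

Lemma solves_FS s T p (e0 : R -> R) (eta : R -> R -> R) t : (2 <= s)%N ->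
  solves s.+2 T p e0 eta -> 0 < t <= T ->
  eta t = FS (ca (eta t)) (cb (eta t)).
Proof.
move=> s2 [[hin _] _ _ [w hw]] tT; have [hd _ _] := hw t tT.
have tT' : 0 <= t <= T by case/andP: tT => /ltW -> ->.
have i := hin t tT'; have [B [hA hB]] := inH_hb i; have [pi1 _ _ _] := i.
apply/funext; apply: (FS_coef _ pi1 (hb_lower _ hA) (hb_lower _ hB)) => // th.
by have [D _ _] := hd th; apply/differentiable_continuous/derivable1_diffP.
Qed.

Lemma solves_rhs s T p (e0 : R -> R) (eta : R -> R -> R) t th : (2 <= s)%N ->
  solves s.+2 T p e0 eta -> 0 < t < T ->
  is_derive t 1 (fun u => eta u th)
    (FS (bapp (opr R true p) (ca (eta t))) (bapp (opr R false p) (cb (eta t))) th).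
Proof.
move=> s2 S /andP[t0 tT]; have t0T : 0 < t <= T by rewrite t0 ltW.
have F := solves_FS s2 S t0T; case: S => [[hin _] _ _ [w hw]].
have [hd w0 /(_ tT th) [D E]] := hw t t0T.
have tT' : 0 <= t <= T by rewrite !ltW.
have [B [hA hB]] := inH_hb (hin t tT').
have s3 : (3 <= s.+2)%N by exact: ltnW.
have hA3 := hb_lower s3 hA; have hB3 := hb_lower s3 hB.
(* The principal value is a limit, hence unique, so both functions have the same derivative; both
   vanish at 0. *)
have W : w t = vel (ca (eta t)) (cb (eta t)).
  apply: (derive_eq (df := fun x => FS (fun k => - ((k != 0%N)%:R * cb (eta t) k)) (ca (eta t)) x)).
  - move=> x; have [_ D2 H] := hd x; rewrite F in H.
    rewrite -(hilbert_unique H (is_hilbert_FS (th := x) hA3 hB3)) derive1E.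
    exact: (DeriveDef D2 erefl).
  - by move=> x; exact: is_derive_vel.
  by rewrite w0 (vel0 (hb_lower (isT : 2 <= 3)%N hA3) (hb_lower (isT : 2 <= 3)%N hB3)).
apply: DeriveDef => //; rewrite -derive1E E W.
rewrite !bapp_opr -(lie_bracket_flow p th hA3 hB3).
by congr (lie_bracket _ _ _); apply/funext => x; rewrite {1}F.
Qed.

(** A solution has two time derivatives: [E1] in the Sobolev sense and the pointwise one given by
    the equation. They agree at every th, and reading off Fourier coefficients turns the former into
    the coefficient system. *)
Lemma solves_ode s T p (e0 : R -> R) (eta : R -> R -> R) t k : (2 <= s)%N ->
  solves s.+2 T p e0 eta -> 0 < t < T ->
  is_derive t 1 (fun u => ca (eta u) k) (bapp (opr R true p) (ca (eta t)) k) /\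
  is_derive t 1 (fun u => cb (eta u) k) (bapp (opr R false p) (cb (eta t)) k).
Proof.
move=> s2 S t0T; have [[hin _] C _ _] := S.
move: C; rewrite subn2 /= => -[E1 [E2 [D1 _ _]]].
have [hda hdb] := deriv_H_hdiff D1; have [hin1 _] := D1.
have [t0 tT] := andP t0T; have tT' : 0 <= t <= T by rewrite !ltW.
have s1 : (1 <= s)%N by exact: ltnW.
have Ha : hbd s T (fun t => ca (E1 t)).
  by move=> u uT; have [_ /inH_hb[B [hA _]]] := hin1 u uT; exists B.
have Hb : hbd s T (fun t => cb (E1 t)).
  by move=> u uT; have [_ /inH_hb[B [_ hB]]] := hin1 u uT; exists B.
have Ka : hbd s.+2 T (fun t => ca (eta t)).
  by move=> u uT; have /inH_hb[B [hA _]] := hin u uT; exists B.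
have Kb : hbd s.+2 T (fun t => cb (eta t)).
  by move=> u uT; have /inH_hb[B [_ hB]] := hin u uT; exists B.
have E th : FS (ca (E1 t)) (cb (E1 t)) th =
    FS (bapp (opr R true p) (ca (eta t))) (bapp (opr R false p) (cb (eta t))) th.
  have d1 := FS_time_derive th (hbd_lower (isT : 1 <= s.+2)%N Ka) (hbd_lower (isT : 1 <= s.+2)%N Kb)
    (hbd_lower s1 Ha) (hbd_lower s1 Hb) (hdiff_lower s1 hda) (hdiff_lower s1 hdb) t0T.
  have d1' : is_derive t 1 (fun u => eta u th) (FS (ca (E1 t)) (cb (E1 t)) th).
    apply: near_eq_is_derive d1; near=> u.
    rewrite [in RHS](solves_FS s2 S (t := u))//; apply/andP; split.
      by near: u; exact: lt_nbhsr.
    by apply: ltW; near: u; exact: lt_nbhsl.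
  have [_ <-] := d1'; have [_ <-] := solves_rhs th s2 S t0T; reflexivity.
have [A1 /(hb_lower s2) a1] := Ha t tT'; have [B1 /(hb_lower s2) b1] := Hb t tT'.
have s2' : (2 <= s.+1)%N by exact: ltnW.
have [A2 /(hb_lower s2') a2] := hbd_bapp (opr R true p) Ka tT'.
have [B2 /(hb_lower s2') b2] := hbd_bapp (opr R false p) Kb tT'.
have ea : ca (E1 t) = bapp (opr R true p) (ca (eta t)).
  by rewrite -(ca_FS a1 b1) (funext E) (ca_FS a2 b2).
have eb : cb (E1 t) = bapp (opr R false p) (cb (eta t)).
  apply/funext => -[|j]; first by rewrite cb0 bapp_opr_sin0.
  have := cb_FS j.+1 a1 b1; rewrite (funext E) (cb_FS j.+1 a2 b2).
  by rewrite !mul1r.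
rewrite -ea -eb; split; [exact: (hdiff_is_derive k hda)|exact: (hdiff_is_derive k hdb)].
Unshelve. all: by end_near.
Qed.

Lemma solves_unique s T p (e0 : R -> R) (eta eta' : R -> R -> R) : (2 <= s)%N -> 0 < T ->
  solves s.+2 T p e0 eta -> solves s.+2 T p e0 eta' ->
  forall t, 0 <= t <= T -> eta t = eta' t.
Proof.
move=> s2 T0 S S' t tT.
have i0 : eta 0 = eta' 0.
  by have [_ _ h _] := S; have [_ _ h' _] := S'; apply/funext => x; rewrite h h'.
have [t0|t0] := eqVneq t 0; first by rewrite t0.
have tT' : 0 < t <= T by case/andP: tT => t0' ->; rewrite lt_neqAle eq_sym t0 t0'.
have K (z : R -> R -> R) : solves s.+2 T p e0 z ->
    [/\ hbd s.+2 T (fun t => ca (z t)), hbd s.+2 T (fun t => cb (z t)),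
        hcont s.+2 T (fun t => ca (z t)) & hcont s.+2 T (fun t => cb (z t))].
  move=> [c _ _ _]; have [h1 h2] := cont_H_hcont c; case: c => [hin _].
  by split => // u uT; have /inH_hb[B [hA hB]] := hin u uT; exists B.
have [Ka Kb Ca Cb] := K _ S; have [Ka' Kb' Ca' Cb'] := K _ S'.
have ea : ca (eta t) = ca (eta' t).
  apply: (ode_unique (o := opr R true p) (isT : 2 <= s.+2)%N Ka Ka' Ca Ca') => //.
  - by move=> u k uT; have [] := solves_ode k s2 S uT.
  - by move=> u k uT; have [] := solves_ode k s2 S' uT.
  - by rewrite i0.
have eb : cb (eta t) = cb (eta' t).
  apply: (ode_unique (o := opr R false p) (isT : 2 <= s.+2)%N Kb Kb' Cb Cb') => //.
  - by move=> u k uT; have [] := solves_ode k s2 S uT.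
  - by move=> u k uT; have [] := solves_ode k s2 S' uT.
  - by rewrite i0.
by rewrite [LHS](solves_FS s2 S tT') [RHS](solves_FS s2 S' tT') ea eb.
Qed.

End Uniqueness.

Theorem theorem3p2 (R : realType) (m : nat) (e0p e0m : R -> R) :
  (3 < m)%N -> inH m e0p -> inH m e0m ->
  forall T : R, 0 < T ->
    exists etap etam : R -> R -> R,
      lin_solution m T e0p e0m etap etam /\
      forall etap' etam' : R -> R -> R,
        lin_solution m T e0p e0m etap' etam' ->
        forall t, 0 <= t <= T -> forall th,
          etap' t th = etap t th /\ etam' t th = etam t th.
Proof.
case: m => [|[|s]]// s4 hp hm T T0; have s2 : (2 <= s)%N by rewrite !ltnS in s4; exact: s4.
have pmE (f g : R -> R) : (fun x => f x / 2 + pm R true * g x) = (fun x => f x / 2 + g x).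
  by apply/funext => x; rewrite /pm mul1r.
have mpE (f g : R -> R) : (fun x => f x / 2 + pm R false * g x) = (fun x => f x / 2 - g x).
  by apply/funext => x; rewrite /pm mulN1r.
(* The two signs do not interact, so existence and uniqueness are applied to each of them. *)
have split' (ep em : R -> R -> R) : lin_solution s.+2 T e0p e0m ep em ->
    solves s.+2 T true e0p ep /\ solves s.+2 T false e0m em.
  move=> [[c1 c2] [d1 d2] i [vp [vm h]]]; split.
    split => //; first by move=> th; case: (i th).
    exists vp => t tT; have [h1 h2 h3 h4] := h t tT; split => //.
      by move=> th; have [[? ?] [? ?] ? ?] := h1 th.
    by move=> tltT th; rewrite pmE; have [? ? ? ?] := h4 tltT th.
  split => //; first by move=> th; case: (i th).
  exists vm => t tT; have [h1 h2 h3 h4] := h t tT; split => //.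
    by move=> th; have [[? ?] [? ?] ? ?] := h1 th.
  by move=> tltT th; rewrite mpE; have [? ? ? ?] := h4 tltT th.
have Sp := solves_flow_sol true s2 hp T0; have Sm := solves_flow_sol false s2 hm T0.
exists (flow_sol true e0p), (flow_sol false e0m); split; last first.
  move=> ep em /split'[Up Um] t tT th.
  by rewrite (solves_unique s2 T0 Up Sp tT) (solves_unique s2 T0 Um Sm tT).
have [cp dp ip [vp hvp]] := Sp; have [cm dm im [vm hvm]] := Sm.
split => //; exists vp, vm => t tT; have [h1 h2 h3] := hvp t tT; have [g1 g2 g3] := hvm t tT.
split => //; first by move=> th; have [? ? ?] := h1 th; have [? ? ?] := g1 th.
move=> tltT th; have [D1 E1] := h3 tltT th; have [D2 E2] := g3 tltT th.
rewrite (pmE (flow_sol true e0p t) (vp t)) in E1.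
rewrite (mpE (flow_sol false e0m t) (vm t)) in E2.
by split; [exact: D1|exact: D2|exact: E1|exact: E2].
Qed.
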